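(* Assume that either (1) $\mathbf{X}$ is uniformly distributed on $\mathcal{X}$, where $\mathcal{X}\subseteq\mathbb{R}^n$ is bounded and convex, or (2) $\mathbf{X}\sim\mathcal{N}(\mathbf{0},\mathbf{I})$ on $\mathbb{R}^n$ (so $\mathcal{X}=\mathbb{R}^n$). Let $\epsilon>0$ and $\|\mathbf{W}-\hat{\mathbf{W}}\|\le\epsilon$. Then there is a constant $C>0$, depending only on the distribution of $\mathbf{X}$ (in particular not on $f$, $k$, $N$, $\epsilon$ or $\hat{\mathbf{W}}$), such that for every integer $N\ge1$ $$\mathbb{E}\Big[\mathbb{E}_{\mathbf{X}}\big[(f_{\hat g}(\mathbf{X})-f_{\hat g_N}(\mathbf{X},\cdot))^2\big]\Big]=\mathbb{E}\Big[\mathbb{E}_{\mathbf{Y}}\big[(\hat g(\hat{\mathbf{Y}})-\hat g_N(\hat{\mathbf{Y}},\cdot))^2\big]\Big]\le\frac{C}{N}\Big(\epsilon(\lambda_1+\cdots+\lambda_k)^{1/2}+(\lambda_{k+1}+\cdots+\lambda_n)^{1/2}\Big)^2.$$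
   Context: Let $n\ge2$ and let $\rho_{\mathbf{X}}:\mathbb{R}^n\to[0,\infty)$ be a probability density with respect to Lebesgue measure. Put $\mathcal{X}=\{\mathbf{x}:\rho_{\mathbf{X}}(\mathbf{x})>0\}$; it is assumed that $\mathcal{X}$ is open, that $\partial\mathcal{X}$ has Lebesgue measure zero, and that $\rho_{\mathbf{X}}$ is bounded and continuous on $\mathcal{X}$. Let $\mathbf{X}$ be a random vector with density $\rho_{\mathbf{X}}$ on a probability space $(\Omega,\mathcal{A},\mathbb{P})$. Let $f:\mathcal{X}\to\mathbb{R}$ be measurable with partial derivatives that are square integrable with respect to $\rho_{\mathbf{X}}$. Define $\mathbf{C}=\int_{\mathcal{X}}\nabla f(\mathbf{x})\nabla f(\mathbf{x})^\top\rho_{\mathbf{X}}(\mathbf{x})\,d\mathbf{x}=\mathbf{W}\Lambda\mathbf{W}^\top$, with $\Lambda=\mathrm{diag}(\lambda_1,\dots,\lambda_n)$, $\lambda_1\ge\dots\ge\lambda_n\ge0$, and $\mathbf{W}$ an orthogonal matrix of eigenvectors. Fix $k\in\{1,\dots,n-1\}$. Let $\hat{\mathbf{W}}=[\hat{\mathbf{W}}_1\;\hat{\mathbf{W}}_2]$ be an orthogonal $n\times n$ matrix (a perturbation of $\mathbf{W}$) with $\hat{\mathbf{W}}_1\in\mathbb{R}^{n\times k}$, $\hat{\mathbf{W}}_2\in\mathbb{R}^{n\times(n-k)}$. $\|\cdot\|$ is the matrix norm induced by the Euclidean norm. Put $\hat{\mathbf{Y}}=\hat{\mathbf{W}}_1^\top\mathbf{X}$,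 $\hat{\mathcal{Y}}=\hat{\mathbf{W}}_1^\top\mathcal{X}$, $\rho_{\hat{\mathbf{Y}}}(\hat{\mathbf{y}})=\int_{\mathbb{R}^{n-k}}\rho_{\mathbf{X}}(\hat{\mathbf{W}}_1\hat{\mathbf{y}}+\hat{\mathbf{W}}_2\hat{\mathbf{z}})\,d\hat{\mathbf{z}}$ (the density of $\hat{\mathbf{Y}}$), and for $\hat{\mathbf{y}}\in\hat{\mathcal{Y}}$ (where $\rho_{\hat{\mathbf{Y}}}(\hat{\mathbf{y}})>0$) put $\rho_{\hat{\mathbf{Z}}|\hat{\mathbf{Y}}}(\hat{\mathbf{z}}|\hat{\mathbf{y}})=\rho_{\mathbf{X}}(\hat{\mathbf{W}}_1\hat{\mathbf{y}}+\hat{\mathbf{W}}_2\hat{\mathbf{z}})/\rho_{\hat{\mathbf{Y}}}(\hat{\mathbf{y}})$; let $\mathbb{P}^{\hat{\mathbf{y}}}_{\hat{\mathbf{Z}}|\hat{\mathbf{Y}}}$ be the probability measure on $\mathbb{R}^{n-k}$ with this density. It is assumed that $\hat{\mathbf{z}}\mapsto f(\hat{\mathbf{W}}_1\hat{\mathbf{y}}+\hat{\mathbf{W}}_2\hat{\mathbf{z}})$ is integrable with respect to this measure for every $\hat{\mathbf{y}}\in\hat{\mathcal{Y}}$. For $\hat{\mathbf{y}}\in\hat{\mathcal{Y}}$ define $$\hat g(\hat{\mathbf{y}})=\int f(\hat{\mathbf{W}}_1\hat{\mathbf{y}}+\hat{\mathbf{W}}_2\hat{\mathbf{z}})\,\rho_{\hat{\mathbf{Z}}|\hat{\mathbf{Y}}}(\hat{\mathbf{z}}|\hat{\mathbf{y}})\,d\hat{\mathbf{z}},\qquad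 \hat g_N(\hat{\mathbf{y}},\omega)=\frac1N\sum_{j=1}^N f(\hat{\mathbf{W}}_1\hat{\mathbf{y}}+\hat{\mathbf{W}}_2\hat{\mathbf{Z}}^{\hat{\mathbf{y}}}_j(\omega)),$$ where, for each $\hat{\mathbf{y}}$, $\hat{\mathbf{Z}}^{\hat{\mathbf{y}}}_1,\dots,\hat{\mathbf{Z}}^{\hat{\mathbf{y}}}_N$ are i.i.d. random vectors on $\Omega$ with law $\mathbb{P}^{\hat{\mathbf{y}}}_{\hat{\mathbf{Z}}|\hat{\mathbf{Y}}}$, and each map $(\hat{\mathbf{y}},\omega)\mapsto\hat{\mathbf{Z}}^{\hat{\mathbf{y}}}_j(\omega)$ is $\mathcal{B}(\hat{\mathcal{Y}})\otimes\mathcal{A}$-measurable. For $\mathbf{x}\in\mathcal{X}$ put $f_{\hat g}(\mathbf{x})=\hat g(\hat{\mathbf{W}}_1^\top\mathbf{x})$ and $f_{\hat g_N}(\mathbf{x},\omega)=\hat g_N(\hat{\mathbf{W}}_1^\top\mathbf{x},\omega)$. $\mathbb{E}_{\mathbf{X}}$ and $\mathbb{E}_{\mathbf{Y}}$ denote integration in $\mathbf{x}$ against $\rho_{\mathbf{X}}(\mathbf{x})d\mathbf{x}$ and in $\hat{\mathbf{y}}$ against $\rho_{\hat{\mathbf{Y}}}(\hat{\mathbf{y}})d\hat{\mathbf{y}}$, with the sampling variable $\omega$ held fixed; the outer $\mathbb{E}$ is integration over $\omega$ with respect to $\mathbb{P}$. *)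

(* Defs.v *)
From HB Require Import structures.
From mathcomp Require Import all_boot all_order all_algebra.
From mathcomp Require Import all_classical all_reals all_analysis.
From mathcomp Require Import measurable_realfun.

Set Implicit Arguments.
Unset Strict Implicit.
Unset Printing Implicit Defensive.

Import Order.TTheory GRing.Theory Num.Theory.
Import numFieldNormedType.Exports.

Local Open Scope classical_set_scope.
Local Open Scope ring_scope.

(* Borel sets for the library's (sup-norm, hence Euclidean) topology. *)
Definition borel_mx (R : realType) (m n : nat) : set (set 'M[R]_(m, n)) :=
  <<s @open 'M[R]_(m, n) >>.

HB.instance Definition _ (R : realType) (m n : nat) :=
  @isMeasurable.Build default_measure_display 'M[R]_(m, n) (@borel_mx R m n)
    (@sigma_algebra0 _ setT open) (@sigma_algebraC _ open)
    (@sigma_algebra_bigcup _ setT open).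

Section borel_matrix.
Context {R : realType} {m n : nat}.

Lemma open_measurable_mx (U : set 'M[R]_(m, n)) : open U -> measurable U.
Proof. by move=> oU; apply: sub_sigma_algebra. Qed.

Lemma measurable_coord (i : 'I_m) (j : 'I_n) :
  measurable_fun setT (fun A : 'M[R]_(m, n) => A i j).
Proof.
apply: (@measurability _ _ 'M[R]_(m, n) R setT _
  (@RGenOpens.G R)).
  exact: RGenOpens.measurableE.
move=> _ [_ [a [b ->] <-]].
rewrite setTI; apply: open_measurable_mx.
by apply: open_comp; [move=> x _; exact: coord_continuous|exact: interval_open].
Qed.

Lemma measurable_fun_mxP d (T : measurableType d) (D : set T)
    (f : T -> 'M[R]_(m, n)) : measurable D ->
  measurable_fun D f <->
  forall i j, measurable_fun D (fun t => f t i j).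
Proof.
move=> mD; split=> [mf i j|mf].
  exact: (measurableT_comp (measurable_coord i j) mf).
apply: (@measurability _ _ T 'M[R]_(m, n) D f open) => //.
move=> _ [U oU <-].
pose c (q : 'M[rat]_(m, n)) : 'M[R]_(m, n) := map_mx ratr q.
pose F (q : 'M[rat]_(m, n) * nat) : set 'M[R]_(m, n) :=
  if `[< ball (c q.1) q.2.+1%:R^-1 `<=` U >]
  then ball (c q.1) q.2.+1%:R^-1 else set0.
have UE : U = \bigcup_q F q.
  apply/seteqP; split => [x Ux|x [q _]]; last first.
    by rewrite /F; case: asboolP => // sub /sub.
  have /nbhs_ballP[e /= e0 eU] : nbhs x U by apply: open_nbhs_nbhs.
  have e20 : 0 < e / 2 by rewrite divr_gt0.
  have [k _ /(_ k (leqnn k)) ke] := near_infty_natSinv_lt (PosNum e20).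
  have k0 : 0 < k.+1%:R^-1 :> R by rewrite invr_gt0.
  have Q i j : exists q : rat, ball (ratr q : R) k.+1%:R^-1 (x i j).
    have /rat_in_itvoo[q qx] : x i j - k.+1%:R^-1 < x i j + k.+1%:R^-1 :> R.
      by rewrite ltrD2l (lt_trans _ k0)// oppr_lt0.
    by exists q; rewrite /ball/= ltr_distl; rewrite in_itv/= in qx.
  pose q : 'M[rat]_(m, n) := \matrix_(i, j) xchoose (Q i j).
  have qx : ball (c q) k.+1%:R^-1 x.
    by split=> // i j; rewrite !mxE; exact: (xchooseP (Q i j)).
  exists (q, k) => //; rewrite /F; case: asboolP => // -[] y qy /=.
  apply: eU; rewrite (splitr e).
  apply: ball_triangle (le_ball (ltW ke) qy).
  exact/(le_ball (ltW ke))/ball_sym.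
rewrite UE preimage_bigcup setI_bigcupr.
apply: countable_bigcupT_measurable => // q.
rewrite /F; case: asboolP => _; last by rewrite preimage_set0 setI0.
rewrite (_ : D `&` _ = \bigcap_(ij in [set: 'I_m * 'I_n])
    (D `&` (fun t => f t ij.1 ij.2) @^-1`
           ball (c q.1 ij.1 ij.2) q.2.+1%:R^-1) `&` D).
  apply: measurableI => //; apply: fin_bigcap_measurable => // ij _.
  by apply: mf => //; exact: measurable_ball.
apply/seteqP; split => [t [Dt [_ ft]]|t [ft Dt]].
  by split => // ij _; split => //; exact: ft.
split => //; split => [|i j]; last by have [] := ft (i, j) I.
by rewrite invr_gt0.
Qed.

End borel_matrix.

Section lebesgue_vector.
Context {R : realType}.

Definition cons_vec n (p : R * 'cV[R]_n) : 'cV[R]_n.+1 :=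
  col_mx (p.1%:M : 'cV[R]_1) p.2.

Definition uncons_vec n (x : 'cV[R]_n.+1) : R * 'cV[R]_n :=
  (x ord0 ord0, dsubmx (x : 'cV[R]_(1 + n))).

Lemma cons_vec0 n (p : R * 'cV[R]_n) j : cons_vec p ord0 j = p.1.
Proof.
have := col_mxEu (p.1%:M : 'cV[R]_1) p.2 ord0 j.
rewrite [X in _ = X]mxE [j]ord1 eqxx mulr1n => <-.
by rewrite /cons_vec; congr (col_mx _ _ _ _); exact/val_inj.
Qed.

Lemma cons_vecS n (p : R * 'cV[R]_n) i j :
  cons_vec p (lift ord0 i) j = p.2 i j.
Proof.
have <- := col_mxEd (p.1%:M : 'cV[R]_1) p.2 i j.
by rewrite /cons_vec; congr (col_mx _ _ _ _); exact/val_inj.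
Qed.

Lemma cons_vecK n : cancel (@cons_vec n) (@uncons_vec n).
Proof.
by case=> a v; rewrite /uncons_vec cons_vec0 /cons_vec (@col_mxKd _ 1 n 1).
Qed.

Lemma measurable_cons_vec n : measurable_fun setT (@cons_vec n).
Proof.
apply/measurable_fun_mxP => // i j.
case: (unliftP ord0 i) => [k ->|->].
  under eq_fun do rewrite cons_vecS.
  exact: (measurableT_comp (measurable_coord k j) measurable_snd).
under eq_fun do rewrite cons_vec0.
exact: measurable_fst.
Qed.

Lemma measurable_uncons_vec n : measurable_fun setT (@uncons_vec n).
Proof.
apply/measurable_fun_pair; first exact: measurable_coord.
apply/measurable_fun_mxP => // i j.
under eq_fun do rewrite mxE.
exact: measurable_coord.
Qed.

Section cons_measure.
Variables (n : nat) (mu : {sigma_finite_measure set 'cV[R]_n -> \bar R}).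

(* Product of the Lebesgue measure on R with [mu], transported along the
   identification of R * R^n with R^(n+1). *)
Definition cons_measure : set 'cV[R]_n.+1 -> \bar R :=
  pushforward (@lebesgue_measure R \x mu)%E (@cons_vec n).

Let cons_measure0 : cons_measure set0 = 0%E.
Proof. by rewrite /cons_measure /pushforward preimage_set0 measure0. Qed.

Let cons_measure_ge0 A : (0 <= cons_measure A)%E.
Proof. by rewrite /cons_measure /pushforward measure_ge0. Qed.

Let cons_measure_sigma_additive : semi_sigma_additive cons_measure.
Proof.
have mp A : measurable A -> measurable (@cons_vec n @^-1` A).
  by move=> mA; rewrite -[X in measurable X]setTI; exact: measurable_cons_vec.
move=> F mF tF mUF; rewrite /cons_measure /pushforward preimage_bigcup.
apply: measure_semi_sigma_additive => [i||]; first exact: mp.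
- apply/trivIsetP => i j _ _ ij; rewrite -preimage_setI.
  by move/trivIsetP : tF => /(_ _ _ _ _ ij) ->//; rewrite preimage_set0.
- by rewrite -preimage_bigcup; exact: mp.
Qed.

HB.instance Definition _ := isMeasure.Build _ _ _ cons_measure
  cons_measure0 cons_measure_ge0 cons_measure_sigma_additive.

Lemma cons_measure_setX (A : set R) (B : set 'cV[R]_n) :
  measurable A -> measurable B ->
  cons_measure (@uncons_vec n @^-1` (A `*` B)) =
  (@lebesgue_measure R A * mu B)%E.
Proof.
move=> mA mB; rewrite /cons_measure /pushforward -comp_preimage.
rewrite (_ : _ \o _ = id) ?preimage_id; first exact: product_measure1E.
by apply/funext => p; exact: cons_vecK.
Qed.

Let cons_measure_sigma_finite : sigma_finite setT cons_measure.
Proof.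
have /sigma_finiteP[F [TF ndF Foo]] := sigma_finiteT (@lebesgue_measure R).
have /sigma_finiteP[G [TG ndG Goo]] := sigma_finiteT mu.
exists (fun i => @uncons_vec n @^-1` (F i `*` G i)).
  rewrite -preimage_bigcup; apply/esym/seteqP; split => // x _.
  have [i _ Fi] : (\bigcup_i F i) (uncons_vec x).1 by rewrite -TF.
  have [j _ Gj] : (\bigcup_i G i) (uncons_vec x).2 by rewrite -TG.
  exists (maxn i j) => //; split.
  - by move: Fi; exact/subsetPset/ndF/leq_maxl.
  - by move: Gj; exact/subsetPset/ndG/leq_maxr.
move=> i; have [mF Fi] := Foo i; have [mG Gi] := Goo i; split.
  rewrite -[X in measurable X]setTI; apply: measurable_uncons_vec => //.
  exact: measurableX.
by rewrite cons_measure_setX// lte_mul_pinfty// ge0_fin_numE.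
Qed.

HB.instance Definition _ :=
  Measure_isSigmaFinite.Build _ _ _ cons_measure cons_measure_sigma_finite.

End cons_measure.

Fixpoint lebesgue_vec (n : nat) :
    {sigma_finite_measure set 'cV[R]_n -> \bar R} :=
  match n with
  | 0 => \d_(0 : 'cV[R]_0)
  | n'.+1 => cons_measure (lebesgue_vec n')
  end.

Lemma lebesgue_vec_box n (A : 'I_n -> set R) :
  (forall i, measurable (A i)) ->
  lebesgue_vec n [set x | forall i, A i (x i ord0)] =
  (\prod_(i < n) @lebesgue_measure R (A i))%E.
Proof.
elim: n A => [|n IH] A mA.
  rewrite big_ord0 (_ : [set x | _] = setT); first exact: diracT.
  by apply/seteqP; split => // x _ [].
have mB : measurable [set v : 'cV[R]_n | forall i, A (lift ord0 i) (v i ord0)].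
  rewrite (_ : [set v | _] = \bigcap_(i in [set: 'I_n])
      ((fun v : 'cV[R]_n => v i ord0) @^-1` A (lift ord0 i))); last first.
    by apply/seteqP; split => v /= Av i; [move=> _|]; exact: Av.
  apply: fin_bigcap_measurable => // i _.
  by rewrite -[X in measurable X]setTI; exact: measurable_coord.
rewrite big_ord_recl -IH// -cons_measure_setX//.
have shiftE i : rshift 1 i = lift ord0 i :> 'I_n.+1 by exact/val_inj.
congr (cons_measure _ _); apply/seteqP; split => x /=.
  by move=> Ax; split => //= i; rewrite mxE shiftE.
move=> [Ax0 Ax] i; case: (unliftP ord0 i) => [j ->|-> //].
by have := Ax j; rewrite mxE shiftE.
Qed.

End lebesgue_vector.

Section linear_algebra.
Context {R : realType}.

Definition norm2 n (x : 'cV[R]_n) : R := Num.sqrt (\sum_i x i ord0 ^+ 2).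

(* Norm induced by the Euclidean norm; the library norm on matrices is the
   entrywise maximum. *)
Definition opnorm n (A : 'M[R]_n) : R :=
  sup [set norm2 (A *m x) | x in [set x | norm2 x <= 1]].

Definition orthogonal_mx n (A : 'M[R]_n) : Prop := A^T *m A = 1%:M.

Definition hblock_mx n k m (e : (k + m)%N = n)
    (A1 : 'M[R]_(n, k)) (A2 : 'M[R]_(n, m)) : 'M[R]_n :=
  castmx (erefl n, e) (row_mx A1 A2).

End linear_algebra.

Section densities.
Context {R : realType} {n : nat}.
Implicit Types (rho : 'cV[R]_n -> R) (f : 'cV[R]_n -> R).

Definition boundary (X : set 'cV[R]_n) : set 'cV[R]_n := closure X `\` X°.

Definition prob_density rho : Prop :=
  [/\ forall x, 0 <= rho x, measurable_fun setT rho &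
      (\int[lebesgue_vec n]_x (rho x)%:E = 1)%E].

Definition pos_set rho : set 'cV[R]_n := [set x | 0 < rho x].

Definition admissible_density rho : Prop :=
  [/\ prob_density rho, open (pos_set rho),
      lebesgue_vec n (boundary (pos_set rho)) = 0%E,
      [bounded rho x | x in pos_set rho] &
      {within pos_set rho, continuous rho}].

Definition uniform_bounded_convex rho : Prop :=
  [/\ bounded_set (pos_set rho),
      convex_set (pos_set rho : set (convex_lmodType 'cV[R]_n)) &
      forall x, pos_set rho x ->
        rho x = (fine (lebesgue_vec n (pos_set rho)))^-1].

Definition standard_normal rho : Prop :=
  forall x, rho x = ((2 * pi) `^ (n%:R / 2))^-1 * expR (- (norm2 x ^+ 2) / 2).

Definition partial f (i : 'I_n) (x : 'cV[R]_n) : R :=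
  'D_(delta_mx i ord0) f x.

(* Functions on [pos_set rho] are represented by total functions; on this open
   set the partial derivatives do not see the values taken elsewhere. *)
Definition square_integrable_partials rho f : Prop :=
  forall i,
    (forall x, pos_set rho x -> derivable f x (delta_mx i ord0)) /\
    (lebesgue_vec n).-integrable (pos_set rho)
      (fun x => (partial f i x ^+ 2 * rho x)%:E).

Definition gradient_moment rho f : 'M[R]_n :=
  \matrix_(i, j) \int[lebesgue_vec n]_(x in pos_set rho)
    (partial f i x * partial f j x * rho x).

End densities.

Section random_vectors.
Context {R : realType} d {Omega : measurableType d} (P : probability Omega R).

Definition has_density m (Z : Omega -> 'cV[R]_m) (q : 'cV[R]_m -> R) : Prop :=
  measurable_fun setT Z /\
  forall A, measurable A ->
    P (Z @^-1` A) = (\int[lebesgue_vec m]_(z in A) (q z)%:E)%E.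

Definition mutually_independent m N (Z : 'I_N -> Omega -> 'cV[R]_m) : Prop :=
  forall (J : {set 'I_N}) (A : 'I_N -> set 'cV[R]_m),
    (forall j, measurable (A j)) ->
    P (\bigcap_(j in [set` J]) Z j @^-1` A j) =
    (\prod_(j in J) P (Z j @^-1` A j))%E.

Definition iid_density m N (Z : 'I_N -> Omega -> 'cV[R]_m) q : Prop :=
  (forall j, has_density (Z j) q) /\ mutually_independent Z.

End random_vectors.

Section conditional_average.
Context {R : realType} {n k m : nat}.
Variables (rho f : 'cV[R]_n -> R) (W1 : 'M[R]_(n, k)) (W2 : 'M[R]_(n, m)).

Definition active_domain : set 'cV[R]_k := (mulmx W1^T) @` pos_set rho.

(* Real-valued integral: [rho] has finite integrals along all slices in the
   uniform (bounded support) and Gaussian cases. *)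
Definition active_density (y : 'cV[R]_k) : R :=
  \int[lebesgue_vec m]_z rho (W1 *m y + W2 *m z).

Definition cond_density (y : 'cV[R]_k) (z : 'cV[R]_m) : R :=
  rho (W1 *m y + W2 *m z) / active_density y.

Definition cond_integrable : Prop :=
  forall y, active_domain y ->
    (lebesgue_vec m).-integrable setT
      (fun z => (f (W1 *m y + W2 *m z) * cond_density y z)%:E).

Definition ghat (y : 'cV[R]_k) : R :=
  \int[lebesgue_vec m]_z (f (W1 *m y + W2 *m z) * cond_density y z).

(* The represented function lives on [pos_set rho], which a sample leaves with
   probability zero; [f] is replaced by 0 outside. *)
Definition ghatN (Omega : Type) N (Z : 'I_N -> 'cV[R]_k -> Omega -> 'cV[R]_m)
    (y : 'cV[R]_k) (w : Omega) : R :=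
  N%:R^-1 * \sum_(j < N)
    patch (cst 0) (pos_set rho) f (W1 *m y + W2 *m Z j y w).

End conditional_average.

(* Main.v *)
(** The squared error of the mean of N i.i.d. samples is, for fixed y, at most 1/N
times the double integral of (f - f')^2 over the conditional law, so it
suffices to bound the integral of (f(y,z') - f(y,z))^2 rho(y,z) rho(y,z') /
rho_Y(y) by a constant times the integral of |W2^T grad f|^2 rho: a Poincare
inequality on the slices y = const whose constant does not depend on the
slice. For a uniform law on a convex set one integrates along the segment from
z to the midpoint of z and z'; for the Gaussian law one integrates along the
rotation cos t z + sin t z', which preserves the product measure. In both
cases the path stays in the slice.

Only the existence of partial derivatives is assumed, so f need not be
absolutely continuous along these oblique paths. After a bounded truncation f
is convolved with a C^1 bump of radius delta on regions that lie at distance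
delta from the boundary of the support and exhaust it. The convolution is
differentiable along the paths, its gradient is the convolution of grad f, and
its L^2(rho) distance to f is controlled by delta and by the increments along
the coordinate axes; these are integrals of partial derivatives because an
everywhere differentiable function with integrable derivative satisfies the
fundamental theorem of calculus. Fatou's lemma removes the truncation and the
exhaustion.

Finally, the integral of |W2^T grad f|^2 rho is the trace of W2^T C W2, which
is the sum over j of lambda_j |W2^T w_j|^2. Here |W2^T w_j| <= 1, and for j <=
k the columns of W2 are orthogonal to the j-th column of the perturbed matrix,
so that |W2^T w_j| <= eps. *)

Require Import Defs.
From HB Require Import structures.
From mathcomp Require Import all_boot all_order all_algebra.
From mathcomp Require Import all_classical all_reals all_analysis.
From mathcomp Require Import measurable_realfun ring lra.

Set Implicit Arguments.
Unset Strict Implicit.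
Unset Printing Implicit Defensive.

Import Order.TTheory GRing.Theory Num.Theory.
Import numFieldNormedType.Exports.

Local Open Scope classical_set_scope.
Local Open Scope ring_scope.

(** * The fundamental theorem of calculus for everywhere differentiable functions *)

(** Partial derivatives that merely exist control [f] along the axes only, while segments and
    rotations inside a slice are oblique, and no chain rule for [f] holds there. Path estimates are
    therefore stated for pairs [h], [A] that do obey a chain rule along curves, and reach [f]
    through mollification. Mollifying in L^2(rho) requires [rho x <= K * rho (x + v)] for small [v];
    the exhausting regions are chosen so that [K] stays fixed while [delta] tends to 0. [K] is 1 for
    a constant density, and exp(3/2) on the ball of radius r when [delta] is 1/r. Stopping at the
    midpoint keeps the Jacobian (1 - t)^m of z -> (1 - t) z + t z' above 2^-m. Under the rotation,
    position and velocity are the two rotated coordinates, so the velocity integrates to a Gaussian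
    second moment. Neither constant sees the slice: the uniform one because the conditional mass is
    at most one, the Gaussian one because the density factorises. Both depend on the split only
    through 2^m <= 2^n. Truncation comes first because [f] times the bump must vanish to second
    order at the edge of the bump, which needs a bounded [f]. *)

Section local_growth.
Context {R : realType}.

(** The supremum of the points up to which the bound holds satisfies it too, by the local comparison
    at that point; the same comparison carries the bound further unless the supremum is [b]. The
    local hypothesis compares with the fixed point [x] only, which is what differentiability at [x]
    can supply. *)
Lemma local_growth_le (f phi : R -> R) (a b : R) : a <= b ->
  (forall x y, a <= x -> x <= y -> y <= b -> phi x <= phi y) ->
  (forall x, a <= x <= b -> exists2 e : R, 0 < e & forall y, a <= y <= b ->
     `|y - x| < e -> `|f y - f x| <= `|phi y - phi x|) ->
  `|f b - f a| <= phi b - phi a.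
Proof.
move=> ab ndphi loc.
pose S := [set x | a <= x <= b /\ `|f x - f a| <= phi x - phi a].
have Sa : S a by split; rewrite ?lexx ?ab// !subrr normr0.
have ubS : ubound S b by move=> x [/andP[]].
have supS : has_sup S by split; [exists a|exists b].
pose s := sup S.
have asb : a <= s <= b.
  apply/andP; split; first by apply: ub_le_sup => //; exists b.
  by apply: ge_sup => //; exists a.
have /andP[as_ sb] := asb.
have [e e0 He] := loc s asb.
have [x Sx sx] := sup_adherent e0 supS.
have [/andP[ax xb] fx] := Sx.
have xs : x <= s by apply: ub_le_sup => //; exists b.
have Ss : S s.
  split => //.
  have : `|x - s| < e by rewrite distrC ger0_norm ?subr_ge0// ltrBlDr addrC -ltrBlDr.
  move=> /(He x); rewrite ax xb => /(_ isT).
  have := ndphi x s ax xs sb.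
  rewrite -subr_ge0 => h; rewrite (distrC (phi x)) (ger0_norm h) (distrC (f x)) => h2.
  have -> : f s - f a = (f s - f x) + (f x - f a) by ring.
  apply: (le_trans (ler_normD _ _)); lra.
case: (ltgtP s b) sb => // [sb _|sb _]; last by move: Ss => [_]; rewrite sb.
(* The half step keeps [y] within the radius [e] of [s], the minimum keeps it in the interval. *)
pose y := Num.min b (s + e / 2).
have sy : s < y by rewrite lt_min sb/= ltrDl divr_gt0.
have yb : y <= b by rewrite ge_min lexx.
have : S y.
  have ay : a <= y by rewrite (le_trans as_)// ltW.
  split; first by rewrite ay.
  have : `|y - s| < e.
    rewrite ger0_norm ?subr_ge0 1?ltW// ltrBlDr.
    rewrite (@le_lt_trans _ _ (s + e / 2))//; first by rewrite ge_min lexx orbT.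
    rewrite addrC ltrD2r; lra.
  move=> /(He y); rewrite ay yb => /(_ isT).
  have := ndphi s y as_ (ltW sy) yb.
  rewrite -subr_ge0 => h; rewrite (ger0_norm h) => h2.
  have [_ h3] := Ss.
  have -> : f y - f a = (f y - f s) + (f s - f a) by ring.
  apply: (le_trans (ler_normD _ _)); lra.
move=> Sy; have : y <= s by apply: ub_le_sup => //; exists b.
by rewrite leNgt sy.
Qed.

End local_growth.

Section derivative_integral.
Context {R : realType}.
Local Notation mu := (@lebesgue_measure R).

(** The primitive [phi] of [G] has slope at least [c] wherever [G] is at least [c], so near each
    point [f] changes no faster than [phi]. Asking for [c <= G] on a whole neighbourhood is a
    semicontinuity condition: [G] acts as a lower semicontinuous majorant of the derivative. *)
Lemma growth_le_integral (f : R -> R) (G : R -> \bar R) (a b : R) : a <= b ->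
  measurable_fun `[a, b] G -> (forall x, (0 <= G x)%E) ->
  (forall x, a <= x <= b -> exists c e : R, [/\ 0 <= c, 0 < e &
     forall y, a <= y <= b -> `|y - x| < e ->
       `|f y - f x| <= c * `|y - x| /\ (c%:E <= G y)%E]) ->
  (`|f b - f a|%:E <= \int[mu]_(x in `[a, b]) G x)%E.
Proof.
move=> ab mG G0 loc.
have [Ioo|] := ltP (\int[mu]_(x in `[a, b]) G x)%E +oo%E; last first.
  by rewrite leye_eq => /eqP ->; rewrite leey.
have subI x y : a <= x -> y <= b -> `]x, y] `<=` `[a, b].
  move=> ax yb z /=; rewrite !in_itv/= => /andP[xz zy].
  by rewrite (le_trans ax (ltW xz)) (le_trans zy yb).
have subI' y : y <= b -> `[a, y] `<=` `[a, b].
  by move=> yb z /=; rewrite !in_itv/= => /andP[-> zy]; rewrite (le_trans zy yb).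
have Ifin (A : set R) : measurable A -> A `<=` `[a, b] ->
    (\int[mu]_(x in A) G x)%E \is a fin_num.
  move=> mA AI; rewrite ge0_fin_numE; last exact: integral_ge0.
  by rewrite (le_lt_trans _ Ioo)//; apply: ge0_subset_integral.
pose phi x := fine (\int[mu]_(z in `[a, x]) G z)%E.
have phiB x y : a <= x -> x <= y -> y <= b ->
    phi y - phi x = fine (\int[mu]_(z in `]x, y]) G z)%E.
  move=> ax xy yb; rewrite /phi.
  have -> : `[a, y]%classic = `[a, x] `|` `]x, y].
    apply/seteqP; split=> z /=; rewrite !in_itv/=.
      move=> /andP[-> ->] /=; case: (leP z x) => ?; [by left|by right].
    case=> /andP[h1 h2]; first by rewrite h1 (le_trans h2).
    by rewrite h2 andbT (le_trans ax) ?ltW.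
  have xb := le_trans xy yb.
  rewrite ge0_integral_setU//=.
  - by rewrite fineD ?Ifin//; [lra|exact: subI'|exact: subI].
  - apply: measurable_funS mG => //.
    by rewrite subUset; split; [exact: subI'|exact: subI].
  - apply/disj_setPS => z /=; rewrite !in_itv/= => -[/andP[_ h1] /andP[h2 _]].
    by move: h1; rewrite leNgt h2.
have -> : (\int[mu]_(x in `[a, b]) G x)%E = (phi b - phi a)%:E.
  rewrite phiB ?lexx// fineK ?Ifin//; last exact: subI.
  by rewrite integral_itv_obnd_cbnd//; apply: measurable_funS mG => //; exact: subI.
rewrite lee_fin; apply: local_growth_le => //.
  move=> x y ax xy yb; rewrite -subr_ge0 phiB// fine_ge0//.
  exact: integral_ge0.
move=> x axb; have [c [e [c0 e0 ce]]] := loc x axb.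
exists e => // y ayb yx.
have key u v : a <= u -> u <= v -> v <= b ->
    (forall z, u < z <= v -> (c%:E <= G z)%E) -> c * (v - u) <= phi v - phi u.
  move=> au uv vb cG; rewrite phiB// -lee_fin fineK ?Ifin//; last exact: subI.
  rewrite (@le_trans _ _ (\int[mu]_(z in `]u, v]) (cst c%:E z))%E)//.
    rewrite integral_cst//= lebesgue_measure_itv/= lte_fin.
    case: ltP => h; first by rewrite -EFinD -EFinM.
    by rewrite mule0 lee_fin (_ : v = u) ?subrr ?mulr0//; apply/le_anti/andP.
  apply: ge0_le_integral => //.
  by apply: measurable_funS mG => //; exact: subI.
have [/andP[ax xb] /andP[ay yb]] := (axb, ayb).
have [h1 _] := ce y ayb yx.
apply: (le_trans h1).
case: (leP x y) => xy.
  rewrite ger0_norm ?subr_ge0//; apply: le_trans (ler_norm _).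
  apply: key => // z /andP[xz zy].
  apply: (ce z _ _).2; first by rewrite (le_trans ax (ltW xz)) (le_trans zy yb).
  rewrite ger0_norm ?subr_ge0 1?ltW//; apply: le_lt_trans yx.
  by rewrite ger0_norm ?subr_ge0// lerB.
rewrite distrC ger0_norm ?subr_ge0; last exact: ltW.
rewrite (distrC (phi y)).
apply: le_trans (ler_norm _); apply: key => //; first exact: ltW.
move=> z /andP[yz zx].
apply: (ce z _ _).2; first by rewrite (le_trans ay (ltW yz)) (le_trans zx xb).
rewrite distrC ger0_norm ?subr_ge0//; apply: le_lt_trans yx.
rewrite distrC ger0_norm ?subr_ge0; last exact: ltW.
by rewrite lerB// ltW.
Qed.

Lemma derive1_growth (f : R -> R) (x c : R) : derivable f x 1 ->
  `|derive1 f x| < c -> \forall y \near x, `|f y - f x| <= c * `|y - x|.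
Proof.
move=> df fc.
have [d d0 Hd] : exists2 d, 0 < d & forall h, `|h| < d -> h != 0 ->
    `|h^-1 * (f (h + x) - f x)| < c.
  have cv : (fun h => h^-1 *: (f (h *: (1 : R) + x) - f x)) @ 0^' --> derive1 f x.
    by rewrite derive1E; exact: df.
  have /cvgr_norm_lt/(_ _ fc) := cv.
  move=> /nbhs_ballP[d /= d0 dH]; exists d => // h hd h0.
  have := dH h; rewrite /ball/= sub0r normrN => /(_ hd h0).
  by rewrite /= -/(_ *: _) (_ : h *: 1 = h)// /GRing.scale/= mulr1.
apply/nbhs_ballP; exists d => //= y; rewrite /ball/= distrC => yd.
have [->|yx] := eqVneq y x; first by rewrite !subrr normr0 mulr0.
have h0 : y - x != 0 by rewrite subr_eq0.
have := Hd (y - x) yd h0.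
rewrite subrK normrM normfV mulrC ltr_pdivrMr ?normr_gt0//.
by move=> /ltW.
Qed.

(** The absolute derivative is not bounded below near a point by its value there, so it is replaced
    by a majorant in the manner of Vitali and Caratheodory: the level sets [E k] are enlarged to
    open sets [U k] of almost the same measure, and each excess is charged the level it belongs
    to. *)
Lemma le_integral_derive1 (f : R -> R) (a b : R) : a <= b ->
  (forall x, a <= x <= b -> derivable f x 1) ->
  measurable_fun `[a, b] (derive1 f) ->
  (`|f b - f a|%:E <= \int[mu]_(x in `[a, b]) `|derive1 f x|%:E)%E.
Proof.
move=> ab df mdf.
apply/lee_addgt0Pr => e' e'0.
(* The losses will be [e * (b - a)] from raising the derivative by [e] and [e] from the open
   enlargements, together [e']. *)
pose e := e' / (b - a + 1).
have ba0 : 0 < b - a + 1 by lra.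
have e0 : 0 < e by rewrite divr_gt0.
pose E k := `[a, b] `&` (fun x => `|derive1 f x|) @^-1` `[k%:R * e, k.+1%:R * e[.
have mE k : measurable (E k).
  by apply: measurableT_comp => //; exact: measurableT_comp.
(* An excess of measure below [d k], charged with the level (k + 1) e, costs at most e / 2^(k + 1);
   these costs sum to [e]. *)
pose d k := e / (2 ^ k.+1)%:R / (k.+1%:R * e).
have d0 k : 0 < d k.
  have p2 : 0 < (2 ^ k.+1)%:R :> R by rewrite ltr0n expn_gt0.
  by apply: divr_gt0; [exact: divr_gt0|exact: mulr_gt0].
have Efin k : (mu (E k) < +oo)%E.
  rewrite (@le_lt_trans _ _ (mu `[a, b]))//.
  by apply: le_measure; rewrite ?inE//; [exact: mE|move=> z []].
  by rewrite lebesgue_measure_itv/=; case: ifP => // _; rewrite -EFinD ltry.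
have /choice[U HU] : forall k, exists U : set R,
    [/\ open U, E k `<=` U & (mu (U `\` E k) < (d k)%:E)%E].
  by move=> k; apply: lebesgue_regularity_outer; [exact: mE|exact: Efin|exact: d0].
pose G2 x := (\sum_(0 <= k <oo) (k.+1%:R * e * \1_(U k `\` E k) x)%:E)%E.
have mUE k : measurable (U k `\` E k).
  by apply: measurableD; [have [oU _ _] := HU k; exact: open_measurable|exact: mE].
have G20 k x : (0 <= (k.+1%:R * e * \1_(U k `\` E k) x)%:E)%E.
  by rewrite lee_fin mulr_ge0//; apply: mulr_ge0 => //; exact: ltW.
have mG2k k (A : set R) : measurable_fun A (fun x => (k.+1%:R * e * \1_(U k `\` E k) x)%:E).
  by apply/measurable_EFinP/measurable_funM.
pose G x := ((`|derive1 f x| + e)%:E + G2 x)%E.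
have G2_ge0 x : (0 <= G2 x)%E by apply: nneseries_ge0.
have mG2 : measurable_fun `[a, b] G2 by apply: ge0_emeasurable_sum.
have mabs : measurable_fun `[a, b] (fun x => (`|derive1 f x|)%:E).
  by apply/measurable_EFinP; exact: measurableT_comp.
have mabse : measurable_fun `[a, b] (fun x => (`|derive1 f x| + e)%:E).
  by apply/measurable_EFinP; apply: measurable_funD => //; exact: measurableT_comp.
(* On [E k] the derivative plus [e] already reaches the level (k + 1) e; on the rest of [U k] the
   k-th term of the series equals it. *)
have Gk k x : U k x -> a <= x <= b -> ((k.+1%:R * e)%:E <= G x)%E.
  move=> Ux xab; have [Ex|nEx] := pselect (E k x).
    rewrite -[leLHS]adde0; apply: leeD => //; rewrite lee_fin.
    by case: Ex => _ /=; rewrite in_itv/= => /andP[h _]; rewrite -natr1; lra.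
  rewrite -[leLHS]add0e; apply: leeD; first by rewrite lee_fin addr_ge0// ltW.
  apply: (@le_trans _ _ (\sum_(0 <= j < k.+1) (j.+1%:R * e * \1_(U j `\` E j) x)%:E)%E).
    rewrite big_nat_recr//= -[leLHS]add0e; apply: leeD; first exact: sume_ge0.
    by rewrite indicE mem_set ?mulr1.
  exact: nneseries_lim_ge.
apply: (@le_trans _ _ (\int[mu]_(x in `[a, b]) G x)%E).
  apply: growth_le_integral => //.
  - by apply: emeasurable_funD.
  - by move=> x; rewrite adde_ge0// lee_fin addr_ge0// ltW.
  - move=> x xab.
    pose k := Num.truncn (`|derive1 f x| / e).
    have : (k%:R <= `|derive1 f x| / e < k.+1%:R) by apply: truncn_itv; rewrite divr_ge0// ltW.
    rewrite ler_pdivlMr// ltr_pdivrMr// => kx.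
    have Ekx : E k x by split; rewrite /= in_itv.
    have [oU EU _] := HU k.
    have [_ fx] := andP kx.
    have /nbhs_ballP[r1 /= r10 h1] := derive1_growth (df x xab) fx.
    have /nbhs_ballP[r2 /= r20 h2] : nbhs x (U k) by apply: open_nbhs_nbhs; split; [|exact: EU].
    exists (k.+1%:R * e), (Num.min r1 r2); split.
    + by rewrite mulr_ge0// ltW.
    + by rewrite lt_min r10.
    + move=> y yab; rewrite lt_min => /andP[yr1 yr2]; split.
        by apply: h1; rewrite /ball/= distrC.
      by apply: Gk => //; apply: h2; rewrite /ball/= distrC.
rewrite ge0_integralD//; last by move=> x _; rewrite lee_fin addr_ge0// ltW.
under eq_integral do rewrite EFinD.
rewrite ge0_integralD//; last by move=> x _; rewrite lee_fin ltW.
rewrite -addeA; apply: leeD => //.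
rewrite integral_cst//= integral_nneseries//; last by move=> k; exact: mG2k.
apply: (@le_trans _ _ ((e * (b - a))%:E + e%:E)%E); last first.
  rewrite -EFinD lee_fin -{2}[e]mulr1 -mulrDr /e mulfVK//; lra.
apply: leeD.
  rewrite lebesgue_measure_itv/= lte_fin; case: ltP => h; first by rewrite -EFinD -EFinM.
  by rewrite mule0 lee_fin mulr_ge0 ?subr_ge0// ltW.
apply: le_trans (epsilon_trick0 xpredT (ltW e0)).
apply: lee_nneseries => k _; first by move=> _; exact: integral_ge0.
have ke0 : 0 < k.+1%:R * e by apply: mulr_gt0.
have mI : measurable_fun `[a, b] (EFin \o (\1_(U k `\` E k) : R -> R)).
  by apply/measurable_EFinP; exact: measurable_indic.
under eq_integral do rewrite EFinM.
have ke0' : (0 <= (k.+1%:R * e)%:E)%E by rewrite lee_fin (ltW ke0).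
rewrite (@ge0_integralZl _ _ R mu _ (measurable_itv _) _ mI _ _ ke0')//;
  last by move=> x _; rewrite /= lee_fin.
rewrite integral_indic//; last exact: mUE.
have [_ _ dk] := HU k.
rewrite (@le_trans _ _ ((k.+1%:R * e)%:E * (d k)%:E)%E)//.
  apply: lee_wpmul2l; first by rewrite lee_fin (ltW ke0).
  rewrite (le_trans _ (ltW dk))//; apply: le_measure; rewrite ?inE//.
    by apply: measurableI; [exact: mUE|exact: measurable_itv].
  exact: mUE.
by rewrite -EFinM lee_fin /d mulrC divfK// gt_eqF.
Qed.

(** A continuous [g n] close to the derivative in L^1 has a classical primitive [Phi]. The
    inequality for everywhere differentiable functions, applied to [f - Phi], bounds the increment
    of the difference by the L^1 distance, and the integral of [g n] differs from that of the
    derivative by no more. *)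
Lemma integral_derive1 (f : R -> R) (a b : R) : a < b ->
  (forall x, a <= x <= b -> derivable f x 1) ->
  mu.-integrable `[a, b] (EFin \o derive1 f) ->
  (\int[mu]_(x in `[a, b]) (derive1 f x)%:E = (f b - f a)%:E)%E.
Proof.
move=> ab df If.
have mI : measurable (`[a, b]%classic : set R) by [].
have Ioo : (mu `[a, b] < +oo)%E.
  by rewrite lebesgue_measure_itv/=; case: ifP => // _; rewrite -EFinD ltry.
have mdf : measurable_fun `[a, b] (derive1 f).
  by have /integrableP[/measurable_EFinP] := If.
have [g [cg Ig gcvg]] := approximation_continuous_integrable mI Ioo If.
set L := (\int[mu]_(x in _) _)%E.
have Lfin : L \is a fin_num by apply: integrable_fin_num.
rewrite -(fineK Lfin); congr EFin; apply/eqP; rewrite eq_sym -subr_eq0 -normr_le0.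
apply/ler_addgt0Pr => e e0; rewrite add0r -lee_fin.
have [n Hn] : exists n, (\int[mu]_(z in `[a, b]) `|(derive1 f z - g n z)%:E| < (e / 2)%:E)%E.
  have e20 : 0 < e / 2 by rewrite divr_gt0.
  have : \forall n \near \oo, (\int[mu]_(z in `[a, b]) `|(derive1 f z - g n z)%:E| < (e / 2)%:E)%E.
    have : nbhs (0 : \bar R)%E [set y | (y < (e / 2)%:E)%E] by apply: open_ereal_lt'; rewrite lte_fin.
    by move=> /gcvg.
  by move=> [N _ HN]; exists N; exact: HN (leqnn N).
have Igc (A : R) (B : R) : mu.-integrable `[A, B] (EFin \o g n).
  by apply: continuous_compact_integrable; [exact: segment_compact|exact: continuous_subspaceT].
(* Starting the primitive at [a - 1] makes [a] an interior point, so that [Phi] is differentiable on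
   the closed interval. *)
pose Phi (x : R) := \int[mu]_(t in `[a - 1, x]) g n t.
have dPhi x : a <= x <= b -> derivable Phi x 1 /\ derive1 Phi x = g n x.
  move=> /andP[ax xb]; apply: (@continuous_FTC1_closed _ _ _ _ (x + 1)) => //; last 2 first.
  - lra.
  - exact: cg.
  lra.
have PhiB : (\int[mu]_(x in `[a, b]) (g n x)%:E = (Phi b)%:E - (Phi a)%:E)%E.
  apply: continuous_FTC2 => //.
  - exact: continuous_subspaceT.
  - have cPhi x : a <= x <= b -> {for x, continuous Phi}.
      by move=> /dPhi[dP _]; apply: differentiable_continuous; exact/derivable1_diffP.
    split.
    + by move=> x; rewrite in_itv/= => /andP[ax xb]; apply: (dPhi x _).1; rewrite !ltW.
    + by apply: cvg_at_right_filter; apply: cPhi; rewrite lexx ltW.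
    + by apply: cvg_at_left_filter; apply: cPhi; rewrite lexx ltW.
  - by move=> x; rewrite in_itv/= => /andP[ax xb]; apply: (dPhi x _).2; rewrite !ltW.
have dB x : a <= x <= b -> derive1 (f \- Phi) x = derive1 f x - g n x.
  move=> xab; rewrite !derive1E deriveB; [|exact: df|by case: (dPhi x xab)].
  by rewrite -!derive1E (dPhi x xab).2.
have mg : measurable_fun `[a, b] (g n).
  by have /integrableP[/measurable_EFinP] := Ig n.
have key : (`|(f b - Phi b) - (f a - Phi a)|%:E <=
            \int[mu]_(z in `[a, b]) `|(derive1 f z - g n z)%:E|)%E.
  apply: (le_trans (@le_integral_derive1 (f \- Phi) a b (ltW ab) _ _)).
  - by move=> x xab; apply: derivableB; [exact: df|case: (dPhi x xab)].
  - apply: (eq_measurable_fun (derive1 f \- g n)).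
      by move=> x; rewrite inE/= in_itv/= => xab; rewrite dB.
    exact: measurable_funB.
  - rewrite le_eqVlt; apply/orP; left; apply/eqP.
    by apply: eq_integral => x; rewrite inE/= in_itv/= => xab; rewrite dB.
have key2 : (`|fine L - (Phi b - Phi a)|%:E <=
            \int[mu]_(z in `[a, b]) `|(derive1 f z - g n z)%:E|)%E.
  rewrite -abse_EFin !EFinB fineK// -PhiB /L -integralB//.
  apply: le_trans (le_abse_integral mu mI _) _.
    by apply: emeasurable_funB; exact/measurable_EFinP.
  by [].
have := le_lt_trans key Hn; have := le_lt_trans key2 Hn.
rewrite !lte_fin => h1 h2.
rewrite (_ : (f b - f a) - fine L = ((f b - Phi b) - (f a - Phi a)) - (fine L - (Phi b - Phi a))); last by ring.
rewrite lee_fin (le_trans (ler_normB _ _))//; lra.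
Qed.

End derivative_integral.

(** * Lebesgue measure on column vectors *)

Section transfer.
Local Open Scope ereal_scope.
Context d1 d2 (X : measurableType d1) (Y : measurableType d2) (R : realType).
Variables (phi : X -> Y) (mphi : measurable_fun setT phi).
Variables (mu : {measure set X -> \bar R}) (nu : {measure set Y -> \bar R}).
Let mphi_mixin := isMeasurableFun.Build _ _ _ _ _ mphi.
Let mphi_pack : {mfun X >-> Y} := HB.pack phi mphi_mixin.

Lemma ge0_integral_transfer (c : R) (f : Y -> \bar R) : (0 <= c)%R ->
  (forall A, measurable A -> mu (phi @^-1` A) = c%:E * nu A) ->
  measurable_fun setT f -> (forall y, 0 <= f y) ->
  \int[mu]_x f (phi x) = c%:E * \int[nu]_y f y.
Proof.
move=> c0 H mf f0.
have := @ge0_integral_mscale _ _ _ nu _ measurableT (NngNum c0) f mf (fun y _ => f0 y).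
rewrite /= => <-.
have -> : \int[mu]_x f (phi x) = \int[pushforward mu phi]_y f y.
  by rewrite ge0_integral_pushforward//.
by apply: (@eq_measure_integral _ _ _ _ (mscale (NngNum c0) nu)
  (pushforward mu mphi_pack)) => A mA _; exact: H.
Qed.

Lemma ge0_integral_transfer1 (f : Y -> \bar R) :
  (forall A, measurable A -> mu (phi @^-1` A) = nu A) ->
  measurable_fun setT f -> (forall y, 0 <= f y) ->
  \int[mu]_x f (phi x) = \int[nu]_y f y.
Proof.
move=> H mf f0; rewrite -[RHS]mul1e.
by apply: ge0_integral_transfer => // A mA; rewrite mul1e H.
Qed.

End transfer.

Section matrix_measurability.
Context {R : realType} d (T : measurableType d).
Implicit Types (D : set T).

Lemma measurable_addmx m n (f g : T -> 'M[R]_(m, n)) :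
  measurable_fun setT f -> measurable_fun setT g ->
  measurable_fun setT (fun t => f t + g t).
Proof.
move=> /(measurable_fun_mxP _ measurableT) mf /(measurable_fun_mxP _ measurableT) mg.
apply/measurable_fun_mxP => // i j.
by under eq_fun do rewrite mxE; exact: measurable_funD.
Qed.

Lemma measurable_oppmx m n (f : T -> 'M[R]_(m, n)) :
  measurable_fun setT f -> measurable_fun setT (fun t => - f t).
Proof.
move=> /(measurable_fun_mxP _ measurableT) mf.
apply/measurable_fun_mxP => // i j.
by under eq_fun do rewrite mxE; exact: measurableT_comp.
Qed.

Lemma measurable_scalemx m n (s : T -> R) (f : T -> 'M[R]_(m, n)) :
  measurable_fun setT s -> measurable_fun setT f ->
  measurable_fun setT (fun t => s t *: f t).
Proof.
move=> ms /(measurable_fun_mxP _ measurableT) mf.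
apply/measurable_fun_mxP => // i j.
by under eq_fun do rewrite mxE; exact: measurable_funM.
Qed.

Lemma measurable_mulmx m n p (A : 'M[R]_(m, n)) (f : T -> 'M[R]_(n, p)) :
  measurable_fun setT f -> measurable_fun setT (fun t => A *m f t).
Proof.
move=> /(measurable_fun_mxP _ measurableT) mf.
apply/measurable_fun_mxP => // i j.
under eq_fun do rewrite mxE.
by apply: measurable_sum => k; apply: measurable_funM.
Qed.

End matrix_measurability.

Section translation.
Context {R : realType}.
Local Open Scope ereal_scope.

Lemma lebesgue_measure_translate (a : R) (A : set R) : measurable A ->
  lebesgue_measure ((fun x => x + a)%R @^-1` A) = lebesgue_measure A.
Proof.
pose phi : R -> R := fun x => (x + a)%R.
have mphi : measurable_fun (setT : set (measurableTypeR R))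
    (phi : measurableTypeR R -> measurableTypeR R) by exact: measurable_funD.
pose m := isMeasurableFun.Build _ _ _ _ _ mphi.
pose F : {mfun (measurableTypeR R) >-> (measurableTypeR R)} := HB.pack phi m.
move=> mA; apply/esym.
apply: (@lebesgue_measure_unique _ (pushforward lebesgue_measure F)) => //.
move=> _ [[u v] _ <-] /=; rewrite /pushforward.
have -> : F @^-1` `]u, v] = `](u - a)%R, (v - a)%R]%classic.
  by apply/seteqP; split => x /=; rewrite !in_itv/= /phi ltrBlDr lerBrDr.
rewrite !lebesgue_measure_itv/= !lte_fin ltrD2r; case: ifP => // _.
by rewrite -!EFinD; congr EFin; rewrite opprB addrA addrNK.
Qed.

Lemma ge0_integral_translate1 (a : R) (f : R -> \bar R) :
  measurable_fun setT f -> (forall x, 0 <= f x) ->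
  \int[lebesgue_measure]_x f (x + a)%R = \int[lebesgue_measure]_x f x.
Proof.
move=> mf f0.
have mphi : measurable_fun (setT : set (measurableTypeR R))
    (+%R^~ a : measurableTypeR R -> measurableTypeR R) by exact: measurable_funD.
apply: (ge0_integral_transfer1 mphi) => // A mA.
exact: lebesgue_measure_translate.
Qed.

Lemma ge0_integral_cons n (f : 'cV[R]_n.+1 -> \bar R) :
  measurable_fun setT f -> (forall x, 0 <= f x) ->
  \int[lebesgue_vec n.+1]_x f x =
  \int[lebesgue_measure]_s \int[lebesgue_vec n]_z f (cons_vec (s, z)).
Proof.
move=> mf f0.
have mc : measurable_fun (setT : set (measurableTypeR R * 'cV[R]_n)) (@cons_vec R n).
  exact: measurable_cons_vec.
have mfc := measurableT_comp mf mc.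
have F := @fubini_tonelli1 _ _ _ _ R (@lebesgue_measure R) (lebesgue_vec n)
  (fun p => f (cons_vec p)) mfc (fun p => f0 _).
rewrite -[RHS]F.
by apply/esym; apply: (ge0_integral_transfer1 mc).
Qed.

Lemma ge0_integral_translate n (v : 'cV[R]_n) (f : 'cV[R]_n -> \bar R) :
  measurable_fun setT f -> (forall x, 0 <= f x) ->
  \int[lebesgue_vec n]_x f (x + v)%R = \int[lebesgue_vec n]_x f x.
Proof.
elim: n v f => [|n IH] v f mf f0.
  by apply: eq_integral => x _; congr f; apply/matrixP => -[].
have mfv w : measurable_fun setT (fun x : 'cV[R]_n.+1 => f (x + w)%R).
  apply: measurableT_comp => //; apply: measurable_addmx => //.
transitivity (\int[lebesgue_measure]_s \int[lebesgue_vec n]_z f (cons_vec (s, z) + v)%R).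
  by apply: ge0_integral_cons.
transitivity (\int[lebesgue_measure]_s \int[lebesgue_vec n]_z f (cons_vec (s, z))); last first.
  by apply/esym; apply: ge0_integral_cons.
pose w := dsubmx (v : 'cV[R]_(1 + n)).
have E s z : (cons_vec (s, z) + v)%R = cons_vec ((s + v ord0 ord0)%R, (z + w)%R).
  apply/matrixP => i j; rewrite mxE [j]ord1.
  case: (unliftP ord0 i) => [k ->|->]; last by rewrite !cons_vec0.
  by rewrite !cons_vecS /= !mxE; congr (_ + v _ _)%R; exact: val_inj.
under eq_integral do under eq_integral do rewrite E.
have mfc (s : R) : measurable_fun setT (fun z : 'cV[R]_n => f (cons_vec (s, z))).
  by apply: measurableT_comp => //; apply: (measurableT_comp (@measurable_cons_vec R n)).
under eq_integral do rewrite (IH w (fun z => f (cons_vec (_, z))))//.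
rewrite (ge0_integral_translate1 (v ord0 ord0) (f := fun s => \int[lebesgue_vec n]_z f (cons_vec (s, z))))//.
  apply: (measurable_fun_fubini_tonelli_F (fun p => f (cons_vec p))) => //.
  exact: measurableT_comp (@measurable_cons_vec R n).
by move=> s; exact: integral_ge0.
Qed.

Lemma lebesgue_vec_translate n (v : 'cV[R]_n) A : measurable A ->
  lebesgue_vec n ((fun x => x + v)%R @^-1` A) = lebesgue_vec n A.
Proof.
move=> mA.
have mB : measurable ((fun x : 'cV[R]_n => x + v)%R @^-1` A).
  rewrite -[X in measurable X]setTI.
  by apply: (measurable_addmx (g := cst v)).
rewrite -[in LHS](setIT (_ @^-1` _)) -[in RHS](setIT A) -!integral_indic//.
apply: (ge0_integral_translate v (f := fun x => (\1_A x)%:E)).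
  by apply/measurable_EFinP; exact: measurable_indic.
by move=> y; rewrite lee_fin.
Qed.

End translation.

(** * Uniqueness of translation invariant measures and changes of variables *)

Section uniqueness.
Context {R : realType} d (Y : measurableType d).
Variable m : {sigma_finite_measure set Y -> \bar R}.
Local Open Scope ereal_scope.

(* Uniqueness of Haar measure, by applying Tonelli to [1_E(x) 1_F(phi y + x)]. *)
Lemma lebesgue_vec_uniq n (phi : Y -> 'cV[R]_n) (E F : set 'cV[R]_n) :
  measurable_fun setT phi ->
  (forall (v : 'cV[R]_n) A, measurable A ->
    m (phi @^-1` ((fun x => x + v)%R @^-1` A)) = m (phi @^-1` A)) ->
  measurable E -> measurable F -> (forall x, E x -> E (- x)%R) ->
  lebesgue_vec n E * m (phi @^-1` F) = lebesgue_vec n F * m (phi @^-1` E).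
Proof.
move=> mphi inv mE mF symE.
have pre (A : set 'cV[R]_n) : measurable A -> measurable (phi @^-1` A).
  by move=> mA; rewrite -[X in measurable X]setTI; exact: mphi.
have tr (v : 'cV[R]_n) A : measurable A -> measurable ((fun x => x + v)%R @^-1` A).
  move=> mA; rewrite -[X in measurable X]setTI.
  by apply: (measurable_addmx (g := cst v)).
have mind dd (T : measurableType dd) (h : T -> 'cV[R]_n) A : measurable A ->
    measurable_fun setT h -> measurable_fun setT (fun t => \1_A (h t) : R).
  by move=> mA mh; apply: (measurableT_comp _ mh); exact: measurable_indic.
have cstind dd (T : measurableType dd) (nu : {measure set T -> \bar R}) (c : R) A :
    measurable A -> (0 <= c)%R ->
    \int[nu]_t (c * \1_A t)%:E = c%:E * nu A.
  move=> mA c0; under eq_integral do rewrite EFinM.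
  rewrite ge0_integralZl//.
  - by rewrite integral_indic// setIT.
  - by apply/measurable_EFinP; exact: measurable_indic.
pose J (p : 'cV[R]_n * Y) := ((\1_E p.1 * \1_F (phi p.2 + p.1)%R)%R)%:E : \bar R.
pose K (p : 'cV[R]_n * Y) := ((\1_E (p.1 - phi p.2)%R * \1_F p.1)%R)%:E : \bar R.
have mphi2 : measurable_fun (setT : set ('cV[R]_n * Y)) (fun p => phi p.2).
  by apply: measurableT_comp.
have mJ : measurable_fun setT J.
  apply/measurable_EFinP/measurable_funM; first exact: mind.
  by apply: mind => //; exact: measurable_addmx.
have mK : measurable_fun setT K.
  apply/measurable_EFinP/measurable_funM; last exact: mind.
  by apply: mind => //; apply: measurable_addmx => //; exact: measurable_oppmx.
have EJ : lebesgue_vec n E * m (phi @^-1` F) =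
    \int[lebesgue_vec n]_x \int[m]_y J (x, y).
  transitivity (\int[lebesgue_vec n]_x ((\1_E x)%:E * m (phi @^-1` F))).
    rewrite ge0_integralZr//; last by apply/measurable_EFinP; exact: measurable_indic.
    by rewrite integral_indic// setIT.
  apply: eq_integral => x _.
  rewrite -(inv x F mF) -(cstind _ _ m _ _ (pre _ (tr x F mF)))//.
have EK : lebesgue_vec n F * m (phi @^-1` E) =
    \int[lebesgue_vec n]_x \int[m]_y K (x, y).
  transitivity (\int[lebesgue_vec n]_x ((\1_F x)%:E * m (phi @^-1` E))).
    rewrite ge0_integralZr//; last by apply/measurable_EFinP; exact: measurable_indic.
    by rewrite integral_indic// setIT.
  apply: eq_integral => x _.
  rewrite -(inv (- x)%R E mE) -(cstind _ _ m _ _ (pre _ (tr _ E mE)))//.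
  apply: eq_integral => y _; rewrite /K mulrC; congr (_ * _)%:E.
  rewrite !indicE; congr (nat_of_bool _)%:R.
  apply/idP/idP; rewrite !inE /= => /symE.
    by rewrite opprD opprK addrC.
  by rewrite opprB addrC.
have J0 p : 0 <= J p by rewrite lee_fin mulr_ge0.
have K0 p : 0 <= K p by rewrite lee_fin mulr_ge0.
have FJ := @fubini_tonelli _ _ _ _ R (lebesgue_vec n) m J mJ J0.
have FK := @fubini_tonelli _ _ _ _ R (lebesgue_vec n) m K mK K0.
apply: (etrans EJ); apply: (etrans FJ); apply/esym.
apply: (etrans EK); apply: (etrans FK); apply/esym.
apply: eq_integral => y _.
rewrite -(ge0_integral_translate (phi y) (f := fun x => K (x, y))); last 2 first.
- by apply: (measurableT_comp mK); exact: measurable_pair2.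
- by move=> x; exact: K0.
by apply: eq_integral => x _; rewrite /K /= addrK addrC.
Qed.

(** Uniqueness reduces a change of variables to one measurement: the scalar [c] has to be checked on
    a single symmetric set of positive finite measure. Cubes serve for dilations and the Euclidean
    ball for orthogonal maps, so no determinant is computed. *)
Lemma lebesgue_vec_transfer n (phi : Y -> 'cV[R]_n) (E : set 'cV[R]_n) (c : R)
    (f : 'cV[R]_n -> \bar R) :
  measurable_fun setT phi ->
  (forall (v : 'cV[R]_n) A, measurable A ->
    m (phi @^-1` ((fun x => x + v)%R @^-1` A)) = m (phi @^-1` A)) ->
  measurable E -> (forall x, E x -> E (- x)%R) ->
  0 < lebesgue_vec n E < +oo -> (0 <= c)%R ->
  m (phi @^-1` E) = c%:E * lebesgue_vec n E ->
  measurable_fun setT f -> (forall x, 0 <= f x) ->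
  \int[m]_y f (phi y) = c%:E * \int[lebesgue_vec n]_x f x.
Proof.
move=> mphi inv mE symE /andP[E0 Eoo] c0 mEc mf f0.
apply: ge0_integral_transfer => // F mF.
have := lebesgue_vec_uniq mphi inv mE mF symE.
rewrite mEc muleA [RHS]muleC => h.
have : (lebesgue_vec n E)%E \is a fin_num by rewrite ge0_fin_numE.
move: h E0; case: (lebesgue_vec n E) => // r h; rewrite lte_fin => r0 _.
transitivity (r^-1%:E * (r%:E * m (phi @^-1` F))).
  by rewrite muleA -EFinM mulVf ?gt_eqF// mul1e.
rewrite h (muleA (r^-1%:E) r%:E) -(EFinM r^-1 r) mulVf ?gt_eqF// mul1e.
exact: muleC.
Qed.

End uniqueness.

Section cubes.
Context {R : realType}.
Local Open Scope ereal_scope.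

Definition cube n (r : R) : set 'cV[R]_n := [set x | forall i, `[(- r)%R, r]%classic (x i ord0)].

Lemma cubeP n r (x : 'cV[R]_n) : cube r x <-> forall i, (`|x i ord0| <= r)%R.
Proof. by split => h i; have := h i; rewrite /= in_itv/= ler_norml. Qed.

Lemma measurable_cube n r : measurable (@cube n r).
Proof.
rewrite (_ : cube _ = \bigcap_(i in [set: 'I_n])
    ((fun v : 'cV[R]_n => v i ord0) @^-1` `[(- r)%R, r]%classic)); last first.
  by apply/seteqP; split => v Av i; [move=> _|]; exact: Av.
apply: fin_bigcap_measurable => // i _.
by rewrite -[X in measurable X]setTI; exact: measurable_coord.
Qed.

Lemma lebesgue_vec_cube n (r : R) : (0 <= r)%R ->
  lebesgue_vec n (@cube n r) = ((2 * r) ^+ n)%:E.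
Proof.
move=> r0; rewrite (@lebesgue_vec_box _ _ (fun=> `[(- r)%R, r]%classic))//.
rewrite (eq_bigr (fun=> (2 * r)%:E)); last first.
  move=> i _; rewrite lebesgue_measure_itv/= lte_fin; case: ltP => h.
    by rewrite -EFinD; congr EFin; ring.
  by have -> : r = 0%R; [lra|rewrite mulr0].
by rewrite -[in RHS](card_ord n) -prodr_const prodEFin.
Qed.

Lemma cube_sym n r (x : 'cV[R]_n) : cube r x -> cube r (- x)%R.
Proof.
by move=> /cubeP cx; apply/cubeP => i; rewrite mxE normrN.
Qed.

End cubes.

Section euclidean_norm.
Context {R : realType}.

Lemma norm2_ge0 n (x : 'cV[R]_n) : 0 <= norm2 x.
Proof. exact: sqrtr_ge0. Qed.

Lemma norm2_sqr n (x : 'cV[R]_n) : norm2 x ^+ 2 = \sum_i x i ord0 ^+ 2.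
Proof. by rewrite sqr_sqrtr// sumr_ge0// => i _; exact: sqr_ge0. Qed.

Lemma norm2_sqrE n (x : 'cV[R]_n) : norm2 x ^+ 2 = (x^T *m x) ord0 ord0.
Proof. by rewrite norm2_sqr mxE; apply: eq_bigr => i _; rewrite mxE. Qed.

Lemma norm2_le n (x : 'cV[R]_n) (r : R) : 0 <= r ->
  (norm2 x <= r) = (\sum_i x i ord0 ^+ 2 <= r ^+ 2).
Proof. by move=> r0; rewrite -norm2_sqr ler_pXn2r ?nnegrE ?norm2_ge0. Qed.

Lemma norm2N n (x : 'cV[R]_n) : norm2 (- x) = norm2 x.
Proof. by rewrite /norm2; congr Num.sqrt; apply: eq_bigr => i _; rewrite mxE sqrrN. Qed.

Lemma norm2Z n (a : R) (x : 'cV[R]_n) : norm2 (a *: x) = `|a| * norm2 x.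
Proof.
rewrite /norm2 -sqrtr_sqr -sqrtrM ?sqr_ge0//; congr Num.sqrt.
by rewrite mulr_sumr; apply: eq_bigr => i _; rewrite mxE exprMn.
Qed.

Lemma norm2_coord n (x : 'cV[R]_n) i : `|x i ord0| <= norm2 x.
Proof.
rewrite -(ler_pXn2r (n := 2))// ?nnegrE ?norm2_ge0//.
rewrite real_normK ?num_real// norm2_sqr (bigD1 i)//= lerDl.
by apply: sumr_ge0 => j _; exact: sqr_ge0.
Qed.

Lemma measurable_norm2 n : measurable_fun setT (@norm2 R n).
Proof.
apply: (measurableT_comp (continuous_measurable_fun (@sqrt_continuous R))).
by apply: measurable_sum => i; apply: measurable_funX; exact: measurable_coord.
Qed.

Definition dot n (x y : 'cV[R]_n) : R := \sum_i x i ord0 * y i ord0.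

Lemma dotE n (x y : 'cV[R]_n) : dot x y = (x^T *m y) ord0 ord0.
Proof. by rewrite mxE; apply: eq_bigr => i _; rewrite mxE. Qed.

Lemma dotxx n (x : 'cV[R]_n) : dot x x = norm2 x ^+ 2.
Proof. by rewrite norm2_sqr; apply: eq_bigr => i _; rewrite expr2. Qed.

Lemma dot_mulmx n m (A : 'M[R]_(n, m)) x y : dot x (A *m y) = dot (A^T *m x) y.
Proof. by rewrite !dotE trmx_mul trmxK mulmxA. Qed.

Lemma dot_sqr_le n (x y : 'cV[R]_n) : dot x y ^+ 2 <= norm2 x ^+ 2 * norm2 y ^+ 2.
Proof.
have [y0|y0] := eqVneq (norm2 y ^+ 2) 0.
  rewrite y0 mulr0.
  have yi i : y i ord0 = 0.
    apply/eqP; rewrite -sqrf_eq0; apply/eqP/le_anti/andP; split; last exact: sqr_ge0.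
    rewrite -[leRHS]y0 norm2_sqr (bigD1 i)//= lerDl.
    by apply: sumr_ge0 => j _; exact: sqr_ge0.
  by rewrite /dot big1 ?expr0n// => i _; rewrite yi mulr0.
have ygt0 : 0 < norm2 y ^+ 2 by rewrite lt_neqAle eq_sym y0 sqr_ge0.
pose t := dot x y / norm2 y ^+ 2.
have : 0 <= \sum_i (x i ord0 - t * y i ord0) ^+ 2.
  by apply: sumr_ge0 => i _; exact: sqr_ge0.
have -> : \sum_i (x i ord0 - t * y i ord0) ^+ 2 =
    norm2 x ^+ 2 - 2 * t * dot x y + t ^+ 2 * norm2 y ^+ 2.
  rewrite !norm2_sqr /dot !mulr_sumr -sumrN -!big_split/=.
  by apply: eq_bigr => i _; ring.
have -> : norm2 x ^+ 2 - 2 * t * dot x y + t ^+ 2 * norm2 y ^+ 2 =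
    norm2 x ^+ 2 - dot x y ^+ 2 / norm2 y ^+ 2.
  rewrite /t; move: (norm2 x ^+ 2) (dot x y) (norm2 y ^+ 2) y0 => a b c c0.
  by field; exact: c0.
by rewrite subr_ge0 ler_pdivrMr.
Qed.

Lemma norm2D n (x y : 'cV[R]_n) : norm2 (x + y) <= norm2 x + norm2 y.
Proof.
have h0 : 0 <= norm2 x + norm2 y by rewrite addr_ge0// norm2_ge0.
rewrite -(ler_pXn2r (n := 2)) ?nnegrE ?norm2_ge0// sqrrD.
have -> : norm2 (x + y) ^+ 2 = norm2 x ^+ 2 + dot x y *+ 2 + norm2 y ^+ 2.
  rewrite !norm2_sqr /dot -mulr_natl mulr_sumr -!big_split/=.
  by apply: eq_bigr => i _; rewrite mxE; ring.
rewrite lerD2r lerD2l lerMn2r/=.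
rewrite (le_trans (ler_norm _))// -(ler_pXn2r (n := 2)) ?nnegrE ?mulr_ge0 ?norm2_ge0//.
by rewrite real_normK ?num_real// exprMn dot_sqr_le.
Qed.

Lemma norm2_orth n (A : 'M[R]_n) x : orthogonal_mx A -> norm2 (A *m x) = norm2 x.
Proof.
move=> oA; apply/eqP; rewrite -(eqrXn2 (n := 2)) ?norm2_ge0// !norm2_sqrE.
by rewrite trmx_mul -mulmxA (mulmxA A^T) oA mul1mx.
Qed.

Definition euclidean_ball n (r : R) : set 'cV[R]_n := [set x | norm2 x <= r].

Lemma measurable_euclidean_ball n r : measurable (@euclidean_ball n r).
Proof.
rewrite -[X in measurable X]setTI.
have -> : euclidean_ball r = (@norm2 R n) @^-1` `]-oo, r].
  by apply/seteqP; split => x /=; rewrite in_itv.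
exact: measurable_norm2.
Qed.

End euclidean_norm.

Section change_of_variables.
Context {R : realType}.
Local Open Scope ereal_scope.

Lemma cube1_fin n : 0 < lebesgue_vec n (cube 1%R : set 'cV[R]_n) < +oo.
Proof. by rewrite lebesgue_vec_cube//= ltry lte_fin exprn_gt0// mulr1. Qed.

Lemma euclidean_ball_fin n (r : R) : lebesgue_vec n (euclidean_ball r : set 'cV[R]_n) < +oo.
Proof.
have [r0|r0] := leP 0%R r.
  rewrite (@le_lt_trans _ _ (lebesgue_vec n (cube r : set 'cV[R]_n)))//.
    apply: le_measure; rewrite ?inE; [exact: measurable_euclidean_ball|exact: measurable_cube|].
    by move=> x /= xr; apply/cubeP => i; exact: le_trans (norm2_coord x i) xr.
  by rewrite lebesgue_vec_cube// ltry.
rewrite (_ : euclidean_ball r = set0) ?measure0//.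
by apply/seteqP; split => // x /= h; have := norm2_ge0 x; rewrite leNgt (le_lt_trans h r0).
Qed.

Lemma euclidean_ball_gt0 n (r : R) : (0 < r)%R ->
  0 < lebesgue_vec n (euclidean_ball r : set 'cV[R]_n).
Proof.
(* The cube of half-side [s] lies in the ball because n s^2 <= r^2; dividing by n + 1 also covers
   dimension zero. *)
move=> r0; pose s := (r / n.+1%:R)%R.
have s0 : (0 < s)%R by rewrite divr_gt0.
rewrite (@lt_le_trans _ _ (lebesgue_vec n (cube s : set 'cV[R]_n)))//.
  by rewrite lebesgue_vec_cube ?ltW// lte_fin exprn_gt0// mulr_gt0.
apply: le_measure; rewrite ?inE; [exact: measurable_cube|exact: measurable_euclidean_ball|].
move=> x /cubeP cx; rewrite /euclidean_ball/= norm2_le; last exact: ltW.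
apply: (@le_trans _ _ (\sum_(i < n) s ^+ 2)%R).
  apply: ler_sum => i _; have := cx i => h.
  by rewrite -(real_normK (num_real _)) ler_pXn2r// nnegrE ltW.
rewrite sumr_const card_ord -mulr_natl /s exprMn exprVn mulrCA.
rewrite ger_pMr ?exprn_gt0// ler_pdivrMr ?exprn_gt0// mul1r -natrX ler_nat.
by rewrite -mulnn mulSn (leq_trans (leqnSn n))// leq_addr.
Qed.

Lemma ge0_integral_scale n (s : R) (f : 'cV[R]_n -> \bar R) : (0 < s)%R ->
  measurable_fun setT f -> (forall x, 0 <= f x) ->
  \int[lebesgue_vec n]_x f (s *: x)%R = (s ^- n)%:E * \int[lebesgue_vec n]_x f x.
Proof.
move=> s0 mf f0; have s0' : s != 0%R by rewrite gt_eqF.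
apply: (@lebesgue_vec_transfer _ _ _ (lebesgue_vec n) _ _ (cube 1%R)) => //.
- exact: (measurable_scalemx (s := cst s)).
- move=> v A mA; rewrite -[RHS](lebesgue_vec_translate (s^-1 *: v)%R); last first.
    rewrite -[X in measurable X]setTI.
    by apply: (measurable_scalemx (s := cst s) (f := id)).
  congr (lebesgue_vec n _); apply/seteqP; split => x /=;
  by rewrite scalerDr scalerA mulfV// scale1r.
- exact: measurable_cube.
- exact: cube_sym.
- exact: cube1_fin.
- by rewrite invr_ge0 exprn_ge0// ltW.
- rewrite (_ : _ @^-1` _ = cube s^-1%R).
    by rewrite !lebesgue_vec_cube ?invr_ge0 ?ltW// -EFinM mulr1 exprMn exprVn mulrC.
  apply/seteqP; split => x /cubeP h; apply/cubeP => i; have := h i;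
  by rewrite mxE normrM (gtr0_norm s0) -ler_pdivlMl// mulr1.
Qed.

Lemma ge0_integral_orth n (A : 'M[R]_n) (f : 'cV[R]_n -> \bar R) : orthogonal_mx A ->
  measurable_fun setT f -> (forall x, 0 <= f x) ->
  \int[lebesgue_vec n]_x f (A *m x)%R = \int[lebesgue_vec n]_x f x.
Proof.
move=> oA mf f0; rewrite -[RHS]mul1e.
have AAT : A *m A^T = 1%:M by apply: mulmx1C.
have mA : measurable_fun setT (mulmx A : 'cV[R]_n -> 'cV[R]_n) by exact: measurable_mulmx.
apply: (@lebesgue_vec_transfer _ _ _ (lebesgue_vec n) _ _ (euclidean_ball 1%R)) => //.
- move=> v B mB; rewrite -[RHS](lebesgue_vec_translate (A^T *m v)%R); last first.
    by rewrite -[X in measurable X]setTI; exact: mA.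
  congr (lebesgue_vec n _); apply/seteqP; split => x /=;
  by rewrite mulmxDr mulmxA AAT mul1mx.
- exact: measurable_euclidean_ball.
- by move=> x; rewrite /euclidean_ball/= norm2N.
- by rewrite euclidean_ball_gt0//= euclidean_ball_fin.
- rewrite mul1e (_ : _ @^-1` _ = euclidean_ball 1%R)//.
  by apply/seteqP; split => x; rewrite /euclidean_ball/= norm2_orth.
Qed.

Lemma measurable_col_mx k m :
  measurable_fun (setT : set ('cV[R]_k * 'cV[R]_m)) (fun p => col_mx p.1 p.2).
Proof.
apply/measurable_fun_mxP => // i j; case: (split_ordP i) => a ->.
  by under eq_fun do rewrite col_mxEu; exact: (measurableT_comp (measurable_coord a j)).
by under eq_fun do rewrite col_mxEd; exact: (measurableT_comp (measurable_coord a j)).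
Qed.

(** [lebesgue_vec] is built by peeling off the first coordinate, hence the induction on the height
    of the upper block, from which one coordinate is removed at a time. *)
Lemma ge0_integral_col_mx k m (f : 'cV[R]_(k + m) -> \bar R) :
  measurable_fun setT f -> (forall x, 0 <= f x) ->
  \int[lebesgue_vec k]_y \int[lebesgue_vec m]_z f (col_mx y z) =
  \int[lebesgue_vec (k + m)]_x f x.
Proof.
elim: k f => [|k IH] f mf f0.
  rewrite [lebesgue_vec 0]/= integral_dirac//; last first.
    apply: (measurable_fun_fubini_tonelli_F (fun p => f (col_mx p.1 p.2))) => //.
    exact: (measurableT_comp mf (@measurable_col_mx 0 m)).
  rewrite diracT mul1e; apply: eq_integral => z _.
  congr f; apply/colP => i.
  by case: (split_ordP i) => -[a ha] // ->; rewrite col_mxEd; congr (z _ _); exact: val_inj.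
have mcm : measurable_fun setT (fun p : 'cV[R]_k.+1 * 'cV[R]_m => f (col_mx p.1 p.2)).
  exact: (measurableT_comp mf (@measurable_col_mx k.+1 m)).
transitivity (\int[lebesgue_measure]_s \int[lebesgue_vec k]_y \int[lebesgue_vec m]_z
    f (col_mx (cons_vec (s, y)) z)).
  apply: ge0_integral_cons.
    exact: (measurable_fun_fubini_tonelli_F (fun p => f (col_mx p.1 p.2))).
  by move=> x; exact: integral_ge0.
transitivity (\int[lebesgue_measure]_s \int[lebesgue_vec (k + m)]_x
    f (cons_vec (s, x) : 'cV[R]_(k.+1 + m))); last first.
  by apply/esym; apply: ge0_integral_cons.
apply: eq_integral => s _.
have mfs : measurable_fun setT (fun x => f (cons_vec (s, x) : 'cV[R]_(k.+1 + m))).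
  apply: (measurableT_comp mf); apply: (measurableT_comp (@measurable_cons_vec R (k + m))).
  exact: measurable_pair1.
apply: etrans (IH _ mfs (fun x => f0 _)).
apply: eq_integral => y _; apply: eq_integral => z _; congr f.
apply/colP => i; case: (unliftP ord0 i) => [l ->|->]; last first.
  rewrite cons_vec0 (_ : ord0 = lshift m (ord0 : 'I_k.+1)); last exact: val_inj.
  by rewrite col_mxEu cons_vec0.
rewrite cons_vecS; case: (split_ordP l) => a ->.
  rewrite (_ : lift ord0 _ = lshift m (lift ord0 a)); last exact: val_inj.
  by rewrite !col_mxEu cons_vecS.
rewrite (_ : lift ord0 _ = rshift k.+1 a); last exact: val_inj.
by rewrite !col_mxEd.
Qed.

Lemma hblock_mulE n k m (km : (k + m)%N = n) (W1 : 'M[R]_(n, k)) (W2 : 'M[R]_(n, m)) (y : 'cV[R]_k) (z : 'cV[R]_m) :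
  (W1 *m y + W2 *m z = hblock_mx km W1 W2 *m castmx (km, erefl) (col_mx y z))%R.
Proof.
by case: _ / km W1 W2 => W1 W2; rewrite /hblock_mx !castmx_id mul_row_col.
Qed.

(** Tonelli in rotated coordinates: orthogonal invariance followed by the block splitting. It turns
    integrals over the whole space into integrals over slices. *)
Lemma ge0_integral_hblock n k m (km : (k + m)%N = n) (W1 : 'M[R]_(n, k))
    (W2 : 'M[R]_(n, m)) (f : 'cV[R]_n -> \bar R) :
  orthogonal_mx (hblock_mx km W1 W2) ->
  measurable_fun setT f -> (forall x, 0 <= f x) ->
  \int[lebesgue_vec k]_y \int[lebesgue_vec m]_z f (W1 *m y + W2 *m z)%R =
  \int[lebesgue_vec n]_x f x.
Proof.
move=> oW mf f0.
under eq_integral do under eq_integral do rewrite (hblock_mulE km).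
rewrite -(ge0_integral_orth oW)//.
case: _ / km W1 W2 oW f mf f0 => W1 W2 oW f mf f0.
have mg : measurable_fun setT (fun x : 'cV[R]_(k + m) => f (hblock_mx erefl W1 W2 *m x)).
  by apply: (measurableT_comp mf); exact: measurable_mulmx.
rewrite -(ge0_integral_col_mx mg)//.
Qed.

End change_of_variables.

(** * Cauchy-Schwarz, integrals depending on a parameter, signed translation *)

Section square_integral.
Context d (T : measurableType d) {R : realType}.
Variable mu : {measure set T -> \bar R}.
Local Open Scope ereal_scope.

(** Cauchy-Schwarz against a weight of mass [c], by integrating 2 t |phi| <= phi^2 + t^2 and
    optimising [t]. The lower bound [a] stands in for the integral of |phi|, which may be
    infinite. *)
Lemma sqr_le_integral (D : set T) (phi w : T -> R) (a c : R) : measurable D ->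
  measurable_fun D phi -> measurable_fun D w -> (forall x, D x -> 0 <= w x)%R ->
  (0 < c)%R -> \int[mu]_(x in D) (w x)%:E = c%:E -> (0 <= a)%R ->
  a%:E <= \int[mu]_(x in D) (`|phi x| * w x)%:E ->
  (a ^+ 2)%:E <= c%:E * \int[mu]_(x in D) (phi x ^+ 2 * w x)%:E.
Proof.
move=> mD mphi mw w0 c0 Iw a0 aI.
have I0 : 0 <= \int[mu]_(x in D) (phi x ^+ 2 * w x)%:E.
  by apply: integral_ge0 => x Dx; rewrite lee_fin mulr_ge0 ?sqr_ge0 ?w0.
have mp2 : measurable_fun D (fun x => (phi x ^+ 2 * w x)%:E).
  by apply/measurable_EFinP/measurable_funM => //; exact: measurable_funX.
have [Ioo|] := ltP (\int[mu]_(x in D) (phi x ^+ 2 * w x)%:E) +oo; last first.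
  by rewrite leye_eq => /eqP ->; rewrite gt0_muley ?leey// lte_fin.
move: Ioo I0.
case Eb : (\int[mu]_(x in D) (phi x ^+ 2 * w x)%:E) => [b| |]// _; rewrite lee_fin => b0.
have key t : (0 <= t -> 2 * t * a <= b + t ^+ 2 * c)%R.
  move=> t0; rewrite -lee_fin (EFinM (2 * t) a) (EFinD b) (EFinM (t ^+ 2) c) -Eb -Iw.
  rewrite (@le_trans _ _ ((2 * t)%:E * \int[mu]_(x in D) (`|phi x| * w x)%:E))//.
    by apply: lee_wpmul2l => //; rewrite lee_fin mulr_ge0.
  have mabs : measurable_fun D (fun x => (`|phi x| * w x)%:E).
    by apply/measurable_EFinP/measurable_funM => //; exact: measurableT_comp.
  rewrite -ge0_integralZl//; last 2 first.
  - by move=> x Dx; rewrite lee_fin mulr_ge0 ?w0.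
  - by rewrite lee_fin mulr_ge0.
  rewrite -ge0_integralZl//; last 2 first.
  - exact/measurable_EFinP.
  - by rewrite lee_fin sqr_ge0.
  rewrite -ge0_integralD//; last 3 first.
  - by move=> x Dx; rewrite lee_fin mulr_ge0 ?sqr_ge0 ?w0.
  - by move=> x Dx; rewrite -EFinM lee_fin mulr_ge0 ?sqr_ge0 ?w0.
  - by apply: measurable_funeM; exact/measurable_EFinP.
  apply: ge0_le_integral => //.
  - by move=> x Dx; rewrite -EFinM lee_fin !mulr_ge0 ?w0.
  - by apply: measurable_funeM.
  - by apply: emeasurable_funD => //; apply: measurable_funeM; exact/measurable_EFinP.
  - move=> x Dx; rewrite -!EFinM -EFinD lee_fin mulrA -mulrDl ler_wpM2r ?w0//.
    rewrite -(real_normK (num_real (phi x))) -subr_ge0.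
    have -> : (`|phi x| ^+ 2 + t ^+ 2 - 2 * t * `|phi x| = (`|phi x| - t) ^+ 2)%R by ring.
    exact: sqr_ge0.
rewrite -EFinM lee_fin.
(* The choice t = a / c maximises 2 t a - t^2 c. *)
have := key (a / c)%R (divr_ge0 a0 (ltW c0)).
rewrite -(ler_pM2r c0).
have -> : (2 * (a / c) * a * c = 2 * a ^+ 2)%R by field; rewrite gt_eqF.
have -> : ((b + (a / c) ^+ 2 * c) * c = b * c + a ^+ 2)%R by field; rewrite gt_eqF.
lra.
Qed.

(** An infinite or undefined integral has the real default value 0, whose absolute value is still
    below that of the extended integral, so the previous bound applies in every case. *)
Lemma sqr_Rintegral_le (D : set T) (phi w : T -> R) (c : R) : measurable D ->
  measurable_fun D phi -> measurable_fun D w -> (forall x, D x -> 0 <= w x)%R ->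
  (0 < c)%R -> \int[mu]_(x in D) (w x)%:E = c%:E ->
  ((\int[mu]_(x in D) (phi x * w x)) ^+ 2)%:E <=
    c%:E * \int[mu]_(x in D) (phi x ^+ 2 * w x)%:E.
Proof.
move=> mD mphi mw w0 c0 Iw; rewrite -(real_normK (num_real (Rintegral _ _ _))).
apply: sqr_le_integral => //.
have := @le_abse_integral _ _ _ mu D (fun x => (phi x * w x)%:E) mD.
have -> : \int[mu]_(x in D) `|(phi x * w x)%:E| = \int[mu]_(x in D) (`|phi x| * w x)%:E.
  by apply: eq_integral => x; rewrite inE => Dx; rewrite abse_EFin normrM (ger0_norm (w0 _ Dx)).
move=> H; apply: le_trans (H _); last exact/measurable_EFinP/measurable_funM.
rewrite /Rintegral; case: (\int[mu]_(x in D) _) => //=; rewrite ?normr0; exact: leey.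
Qed.

End square_integral.

Section parameter_measurability.
Context d1 d2 (T1 : measurableType d1) (T2 : measurableType d2) {R : realType}.
Variable mu : {sigma_finite_measure set T2 -> \bar R}.

(** Tonelli makes the integrals of the positive and negative parts measurable, and [fine] is
    measurable, so slices with an infinite integral do no harm. *)
Lemma measurable_Rintegral_fubini (phi : T1 * T2 -> R) :
  measurable_fun setT phi ->
  measurable_fun setT (fun x => \int[mu]_y phi (x, y)).
Proof.
move=> mphi; apply: (@measurableT_comp _ _ _ _ _ _ (@fine R)) => //.
under eq_fun do rewrite integralE.
have mE : measurable_fun setT (EFin \o phi) by exact/measurable_EFinP.
apply: emeasurable_funB.
  rewrite [X in measurable_fun _ X](_ : _ = fubini_F mu (EFin \o phi)^\+%E)//; last first.
    by apply/funext => x; apply: eq_integral => y _; rewrite !funeposE.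
  by apply: measurable_fun_fubini_tonelli_F => //; exact: measurable_funepos.
rewrite [X in measurable_fun _ X](_ : _ = fubini_F mu (EFin \o phi)^\-%E)//; last first.
  by apply/funext => x; apply: eq_integral => y _; rewrite !funenegE.
by apply: measurable_fun_fubini_tonelli_F => //; exact: measurable_funeneg.
Qed.

End parameter_measurability.

Section translation_signed.
Context {R : realType} (n : nat).

Lemma integral_translate (v : 'cV[R]_n) (f : 'cV[R]_n -> \bar R) :
  measurable_fun setT f ->
  (\int[lebesgue_vec n]_x f (x + v)%R = \int[lebesgue_vec n]_x f x)%E.
Proof.
move=> mf; rewrite integralE [RHS]integralE.
congr (_ - _)%E.
  transitivity (\int[lebesgue_vec n]_x f^\+ (x + v)%R)%E.
    by apply: eq_integral => x _; rewrite !funeposE.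
  by apply: ge0_integral_translate => //; exact: measurable_funepos.
transitivity (\int[lebesgue_vec n]_x f^\- (x + v)%R)%E.
  by apply: eq_integral => x _; rewrite !funenegE.
by apply: ge0_integral_translate => //; exact: measurable_funeneg.
Qed.

Lemma Rintegral_translate (v : 'cV[R]_n) (f : 'cV[R]_n -> R) :
  measurable_fun setT f ->
  \int[lebesgue_vec n]_x f (x + v) = \int[lebesgue_vec n]_x f x.
Proof.
move=> mf; rewrite /Rintegral; congr fine.
by apply: (integral_translate v (f := EFin \o f)); exact/measurable_EFinP.
Qed.

Lemma integrable_translate (v : 'cV[R]_n) (f : 'cV[R]_n -> \bar R) :
  (lebesgue_vec n).-integrable setT f ->
  (lebesgue_vec n).-integrable setT (fun x => f (x + v)).
Proof.
move=> /integrableP[mf If]; apply/integrableP; split.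
  by apply: measurableT_comp => //; exact: measurable_addmx.
rewrite (ge0_integral_translate v (f := fun x => `|f x|%E))//.
exact: measurableT_comp.
Qed.

End translation_signed.

(** * Derivatives along curves and a polynomial bump *)

Section derivative_lemmas.
Context {R : realType}.

(** A quadratic remainder bound handles the points where a positive part switches on, without gluing
    one-sided derivatives. *)
Lemma is_derive1_quadratic (g : R -> R) (s l C : R) :
  (forall h, `|g (h + s) - g s - l * h| <= C * h ^+ 2) -> is_derive s 1 g l.
Proof.
move=> H.
have cv : (fun h : R => h^-1 *: (g (h *: (1 : R) + s) - g s)) @ 0^' --> l.
  apply/cvgrPdist_lt => e e0; near=> h.
  have h0 : h != 0 by near: h; exact: nbhs_dnbhs_neq.
  have hn0 : 0 < `|h| by rewrite normr_gt0.
  have -> : l - h^-1 *: (g (h *: (1 : R) + s) - g s) =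
      - (h^-1 * (g (h + s) - g s - l * h)).
    by rewrite /GRing.scale/= mulr1; field.
  rewrite normrN normrM normfV mulrC ltr_pdivrMr//.
  apply: (le_lt_trans (H h)).
  rewrite -real_normK ?num_real// expr2 mulrA ltr_pM2r//.
  have C1 : C * `|h| <= (`|C| + 1) * `|h|.
    by rewrite ler_wpM2r// (le_trans (ler_norm _))// lerDl.
  apply: (le_lt_trans C1); rewrite mulrC -ltr_pdivlMr; last by rewrite ltr_wpDl.
  near: h; apply: dnbhs0_lt; rewrite divr_gt0// ltr_wpDl//.
have d : derivable g s 1 by apply/cvg_ex; exists l.
by apply: DeriveDef => //; apply/cvg_lim.
Unshelve. all: by end_near. Qed.

Lemma is_derive_sqr_pos (s : R) :
  is_derive s 1 (fun s => Num.max 0 s ^+ 2) (2 * Num.max 0 s).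
Proof.
apply: (@is_derive1_quadratic _ _ _ 1) => h; rewrite mul1r ler_norml.
have hs := sqr_ge0 (h + s).
by case: (leP 0 (h + s)) => h1; case: (leP 0 s) => h2; apply/andP; split; nra.
Qed.

Lemma is_derive_cstB (g : R -> R) (c s l : R) :
  is_derive s 1 g l -> is_derive s 1 (fun t => c - g t) (- l).
Proof.
move=> dg; rewrite (_ : (fun t => c - g t) = (cst c : R -> R) - g)//.
have := @is_deriveB _ _ _ (cst c : R -> R) g s 1 0 l (is_derive_cst _ _ _) dg.
by rewrite sub0r.
Qed.

Lemma is_derive_line n (f : 'cV[R]_n -> R) (p v : 'cV[R]_n) (a s : R) :
  derivable f (p + (s * a) *: v) v ->
  is_derive s 1 (fun s => f (p + (s * a) *: v)) (a * 'D_v f (p + (s * a) *: v)).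
Proof.
move=> df.
have E t : (fun h : R => h^-1 *: (f (p + (h *: (1 : R) + t) *: v) - f (p + t *: v))) =
    (fun h => h^-1 *: (f (h *: v + (p + t *: v)) - f (p + t *: v))).
  apply/funext => h; congr (_ *: (f _ - _)).
  have -> : h *: (1 : R) = h by exact: mulr1.
  by rewrite scalerDl addrCA.
have d0 : is_derive (s * a) (1 : R) (fun t => f (p + t *: v)) ('D_v f (p + (s * a) *: v)).
  apply: DeriveDef; first by rewrite /derivable E.
  by rewrite /derive E.
have d1 : is_derive s (1 : R) (fun s => s * a) a.
  apply: (@is_derive1_quadratic _ _ _ 0) => h.
  by rewrite mul0r (_ : _ - _ = 0) ?normr0//; ring.
have := @is_derive1_comp _ (fun t => f (p + t *: v)) (fun s => s * a) s _ _ d0 d1.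
by rewrite mulrC.
Qed.

Variables (n : nat) (delta : R).

(** An unnormalised bump supported in the ball of radius [delta]. Squaring the positive part makes
    it C^1, which suffices, and keeps its gradient explicit: at [u] it is [- dmollifier u *: u]. *)
Definition mollifier (u : 'cV[R]_n) : R := Num.max 0 (delta ^+ 2 - norm2 u ^+ 2) ^+ 2.

Definition dmollifier (u : 'cV[R]_n) : R := 4 * Num.max 0 (delta ^+ 2 - norm2 u ^+ 2).

Lemma is_derive_mollifier_path (g g' : R -> 'cV[R]_n) (w : 'cV[R]_n) (t : R) :
  (forall i, is_derive t 1 (fun t => g t i ord0) (g' t i ord0)) ->
  is_derive t 1 (fun t => mollifier (w - g t)) (dmollifier (w - g t) * dot (w - g t) (g' t)).
Proof.
move=> dg.
pose q (i : 'I_n) (t : R) := (w i ord0 - g t i ord0) ^+ 2.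
have dq i : is_derive t 1 (q i) (- 2 * (w i ord0 - g t i ord0) * g' t i ord0).
  have d0 : is_derive t 1 (fun t => w i ord0 - g t i ord0) (- g' t i ord0).
    exact: is_derive_cstB.
  have -> : q i = (fun t => w i ord0 - g t i ord0) ^+ 2 by apply/funext.
  apply: (is_derive_eq (is_deriveX 2 d0)).
  by rewrite /GRing.scale/= /GRing.scale/= expr1 -mulr_natl; ring.
have dQ : is_derive t 1 (\sum_(i < n) q i) (\sum_(i < n) - 2 * (w i ord0 - g t i ord0) * g' t i ord0).
  exact: is_derive_sum.
have dP : is_derive t 1 (fun t => delta ^+ 2 - (\sum_(i < n) q i) t)
    (- \sum_(i < n) - 2 * (w i ord0 - g t i ord0) * g' t i ord0).
  exact: is_derive_cstB.
have E t' : delta ^+ 2 - (\sum_(i < n) q i) t' = delta ^+ 2 - norm2 (w - g t') ^+ 2.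
  by rewrite norm2_sqr fct_sumE; congr (_ - _); apply: eq_bigr => i _; rewrite /q !mxE.
have := @is_derive1_comp _ (fun s => Num.max 0 s ^+ 2) _ t _ _ (is_derive_sqr_pos _) dP.
rewrite (_ : _ \o _ = (fun t => mollifier (w - g t))); last first.
  by apply/funext => t'; rewrite /= E.
move=> H; apply: (is_derive_eq H).
rewrite E /dmollifier -sumrN /dot !mulr_sumr; apply: eq_bigr => i _.
by rewrite !mxE; ring.
Qed.

End derivative_lemmas.

Section fubini_domains.
Context d1 d2 (T1 : measurableType d1) (T2 : measurableType d2) {R : realType}.
Variables (m1 : {sigma_finite_measure set T1 -> \bar R}).
Variables (m2 : {sigma_finite_measure set T2 -> \bar R}).
Local Open Scope ereal_scope.

Lemma fubini_tonelli_domains (A : set T1) (B : set T2) (f : T1 * T2 -> \bar R) :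
  measurable A -> measurable B -> measurable_fun (A `*` B) f ->
  (forall p, 0 <= f p) ->
  \int[m1]_(x in A) \int[m2]_(y in B) f (x, y) =
  \int[m2]_(y in B) \int[m1]_(x in A) f (x, y).
Proof.
move=> mA mB mf f0.
pose g := f \_ (A `*` B).
have mg : measurable_fun setT g.
  by apply/(measurable_restrictT _ _).1 => //; exact: measurableX.
have g0 p : 0 <= g p by rewrite /g /patch; case: ifP.
have gA x : A x -> (fun y => g (x, y)) = (fun y => f (x, y)) \_ B.
  move=> Ax; apply/funext => y; rewrite /g /patch; congr (if _ then _ else _).
  by apply/idP/idP; rewrite !inE /= => // -[].
have gB y : B y -> (fun x => g (x, y)) = (fun x => f (x, y)) \_ A.
  move=> By; apply/funext => x; rewrite /g /patch; congr (if _ then _ else _).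
  by apply/idP/idP; rewrite !inE /= => // -[].
have nA x : ~ A x -> \int[m2]_y g (x, y) = 0.
  move=> nAx; apply: integral0_eq => y _; rewrite /g patchN// notin_setE.
  by case.
have nB y : ~ B y -> \int[m1]_x g (x, y) = 0.
  move=> nBy; apply: integral0_eq => x _; rewrite /g patchN// notin_setE.
  by case.
have := fubini_tonelli (m1 := m1) (m2 := m2) g mg g0.
have -> : \int[m1]_x \int[m2]_y g (x, y) = \int[m1]_(x in A) \int[m2]_(y in B) f (x, y).
  rewrite [RHS]integral_mkcond; apply: eq_integral => x _; rewrite /patch.
  case: ifPn; rewrite ?inE ?notin_setE => Ax; last exact: nA.
  by rewrite gA// -integral_mkcond.
move=> ->.
rewrite [RHS]integral_mkcond; apply: eq_integral => y _; rewrite /patch.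
case: ifPn; rewrite ?inE ?notin_setE => By; last exact: nB.
by rewrite gB// -integral_mkcond.
Qed.

Lemma measurable_fubini_domain (B : set T2) (f : T1 * T2 -> \bar R) :
  measurable B -> measurable_fun (setT `*` B) f -> (forall p, 0 <= f p) ->
  measurable_fun setT (fun x => \int[m2]_(y in B) f (x, y)).
Proof.
move=> mB mf f0.
pose g := f \_ (setT `*` B).
have mg : measurable_fun setT g.
  by apply/(measurable_restrictT _ _).1 => //; exact: measurableX.
have g0 p : 0 <= g p by rewrite /g /patch; case: ifP.
rewrite (_ : (fun x => _) = fubini_F m2 g); first exact: measurable_fun_fubini_tonelli_F.
apply/funext => x; rewrite integral_mkcond; apply: eq_integral => y _.
rewrite /g /patch; congr (if _ then _ else _).
by apply/idP/idP; rewrite !inE /= => // -[].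
Qed.

End fubini_domains.

(** * Mollification *)

Section mollification.
Context {R : realType} (n : nat).
Variables (X S : set 'cV[R]_n) (rho f : 'cV[R]_n -> R) (D : 'I_n -> 'cV[R]_n -> R).
Variables (delta K M : R).
Hypothesis mS : measurable S.
Hypothesis mrho : measurable_fun setT rho.
Hypothesis rho0 : forall x, 0 <= rho x.
Hypothesis mf : measurable_fun setT f.
Hypothesis fM : forall x, `|f x| <= M.
Hypothesis mD : forall i, measurable_fun setT (D i).
Hypothesis dfD : forall x i, X x -> is_derive x (delta_mx i ord0) f (D i x).
Hypothesis delta0 : 0 < delta.
Hypothesis K0 : 0 <= K.
Hypothesis SX : forall x v, S x -> norm2 v <= delta -> X (x + v).
Hypothesis SK : forall x v, S x -> norm2 v <= delta -> rho x <= K * rho (x + v).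

Local Notation mu := (lebesgue_vec n).

Lemma measurable_shift (v : 'cV[R]_n) (g : 'cV[R]_n -> R) :
  measurable_fun setT g -> measurable_fun setT (fun x : 'cV[R]_n => g (x + v)%R).
Proof. by move=> mg; apply: (measurableT_comp mg); exact: measurable_addmx. Qed.

(** [SK] moves the weight from [x] to [x + v] at the price of [K]; translation invariance then
    removes [v]. *)
Lemma weighted_translate_le (psi : 'cV[R]_n -> R) (v : 'cV[R]_n) :
  measurable_fun setT psi -> (forall x, 0 <= psi x)%R -> (norm2 v <= delta)%R ->
  (\int[mu]_(x in S) (rho x * psi (x + v)%R)%:E <= K%:E * \int[mu]_x (rho x * psi x)%:E)%E.
Proof.
move=> mpsi psi0 vd.
have mrp : measurable_fun setT (fun x => (rho x * psi x)%:E).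
  by apply/measurable_EFinP; exact: measurable_funM.
have rp0 x : (0 <= (rho x * psi x)%:E)%E by rewrite lee_fin mulr_ge0.
rewrite -(ge0_integral_translate v mrp rp0).
have mrpv : measurable_fun setT (fun x : 'cV[R]_n => (rho (x + v)%R * psi (x + v)%R)%:E).
  by apply/measurable_EFinP/measurable_funM; exact: measurable_shift.
have K0E : (0 <= K%:E)%E by rewrite lee_fin.
rewrite -(ge0_integralZl mu measurableT mrpv _ K0E); last first.
  by move=> x _; rewrite lee_fin mulr_ge0.
apply: (@le_trans _ _ (\int[mu]_(x in S) (K%:E * (rho (x + v)%R * psi (x + v)%R)%:E))%E).
  apply: ge0_le_integral => //.
  - by move=> x Sx; rewrite lee_fin mulr_ge0.
  - apply/measurable_EFinP; apply: measurable_funTS; apply: measurable_funM => //.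
    exact: measurable_shift.
  - by apply: measurable_funTS; apply: measurable_funeM.
  - by move=> x Sx; rewrite -EFinM lee_fin mulrA ler_wpM2r// SK.
apply: ge0_subset_integral => //; first exact: measurable_funeM.
by move=> x _; rewrite mule_ge0// lee_fin// mulr_ge0.
Qed.

Lemma norm2_mono (x y : 'cV[R]_n) :
  (forall i, `|x i ord0| <= `|y i ord0|)%R -> (norm2 x <= norm2 y)%R.
Proof.
move=> h; rewrite norm2_le ?norm2_ge0// norm2_sqr; apply: ler_sum => i _.
by rewrite -(real_normK (num_real (x i ord0))) -(real_normK (num_real (y i ord0))) ler_pXn2r ?nnegrE.
Qed.

(** The vertices of a staircase from 0 to [u]. Each leg is parallel to an axis, the only directions
    in which [f] is known to be differentiable. *)
Definition truncv (u : 'cV[R]_n) (i : nat) : 'cV[R]_n :=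
  \col_(l < n) (if (l < i)%N then u l ord0 else 0%R).

Lemma truncvS u (i : 'I_n) :
  truncv u i.+1 = (truncv u i + u i ord0 *: delta_mx i ord0)%R.
Proof.
apply/colP => l; rewrite !mxE eqxx andbT ltnS leq_eqVlt.
have [->|li] := eqVneq l i; first by rewrite eqxx ltnn/= add0r mulr1.
by rewrite -val_eqE in li; rewrite (negbTE li)/= mulr0 addr0.
Qed.

(** Every point of a leg is dominated by [u] coordinate by coordinate. The staircase therefore stays
    in the ball of radius |u|, and started in [S] it stays in [X]. *)
Lemma norm2_truncv u (i : 'I_n) (s : R) : (0 <= s <= 1)%R ->
  (norm2 (truncv u i + (s * u i ord0) *: delta_mx i ord0) <= norm2 u)%R.
Proof.
move=> /andP[s0 s1]; apply: norm2_mono => l; rewrite !mxE eqxx andbT.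
have [->|li] := eqVneq l i.
  by rewrite ltnn add0r mulr1 normrM ger0_norm// ler_piMl.
by rewrite mulr0 addr0; case: ifP => // _; rewrite normr0.
Qed.

(** Along one leg [f] is differentiable at every parameter, with derivative [u i ord0] times [D i],
    so [le_integral_derive1] applies; Cauchy-Schwarz on the unit interval and |u_i| <= delta give
    the square. *)
Lemma coordinate_increment_le (u : 'cV[R]_n) (i : 'I_n) x : (norm2 u <= delta)%R -> S x ->
  (((f (x + truncv u i.+1)%R - f (x + truncv u i)%R) ^+ 2)%:E <=
  (delta ^+ 2)%:E * \int[lebesgue_measure]_(s in `[0%R, 1%R])
     (D i (x + (truncv u i + (s * u i ord0) *: delta_mx i ord0))%R ^+ 2)%:E)%E.
Proof.
move=> ud Sx.
pose e : 'cV[R]_n := delta_mx i ord0; pose a := u i ord0.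
pose phi (s : R) : R := f ((x + truncv u i) + (s * a) *: e)%R.
pose g (s : R) := D i (x + (truncv u i + (s * a) *: e))%R.
have dphi (s : R) : (0 <= s <= 1)%R -> is_derive s 1%R phi (a * g s)%R.
  move=> s01.
  have Xs : X ((x + truncv u i) + (s * a) *: e).
    by rewrite -addrA; apply: SX => //; exact: le_trans (norm2_truncv u i s01) ud.
  have df := dfD i Xs.
  have := @is_derive_line _ _ f (x + truncv u i)%R e a s (@ex_derive _ _ _ _ _ _ _ df).
  by rewrite (@derive_val _ _ _ _ _ _ _ df) /g addrA.
have mg : measurable_fun setT g.
  apply: (measurableT_comp (mD i)); apply: measurable_addmx => //.
  apply: measurable_addmx => //; apply: (measurable_scalemx (f := cst e)) => //.
  exact: measurable_funM.
have mag : measurable_fun (`[0%R, 1%R]%classic : set R) (fun s => a * g s)%R.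
  by apply: measurable_funTS; exact: measurable_funM.
have d1 (s : R) : (0 <= s <= 1)%R -> derive1 phi s = (a * g s)%R.
  by move=> /dphi ds; rewrite derive1E (@derive_val _ _ _ _ _ _ _ ds).
have mdphi : measurable_fun (`[0%R, 1%R]%classic : set R) (derive1 phi).
  by apply: eq_measurable_fun mag => s; rewrite inE/= in_itv/= => /d1 ->.
have H := @le_integral_derive1 R phi 0%R 1%R ler01
  (fun s h => @ex_derive _ _ _ _ _ _ _ (dphi s h)) mdphi.
have phi1 : phi 1%R = f (x + truncv u i.+1)%R.
  by rewrite /phi mul1r truncvS addrA.
have phi0 : phi 0%R = f (x + truncv u i)%R by rewrite /phi mul0r scale0r addr0.
have I1 : (\int[lebesgue_measure]_(s in `[0%R, 1%R]) ((fun=> 1%R) s)%:E = (1%R : R)%:E)%E.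
  by rewrite integral_cst//= lebesgue_measure_itv/= lte_fin ltr01 mul1e -EFinD subr0.
have HH : ((`|phi 1 - phi 0|%R)%:E <=
    \int[lebesgue_measure]_(s in `[0%R, 1%R]) (`|(a * g s)%R| * (fun=> 1%R) s)%:E)%E.
  apply: le_trans H _; rewrite le_eqVlt; apply/orP; left; apply/eqP.
  by apply: eq_integral => s; rewrite inE/= in_itv/= => /d1 ->; rewrite mulr1.
have mI : measurable (`[0%R, 1%R]%classic : set R) by [].
have := @sqr_le_integral _ _ R (@lebesgue_measure R) _ (fun s => a * g s)%R (fun=> 1%R)
  (`|phi 1 - phi 0|)%R 1%R mI mag (measurable_cst _) (fun _ _ => ler01) ltr01 I1 (normr_ge0 _) HH.
rewrite mul1e real_normK ?num_real// phi1 phi0 => /le_trans; apply.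
have m2 : measurable_fun (`[0%R, 1%R]%classic : set R) (fun s => (g s ^+ 2)%:E).
  by apply/measurable_EFinP; apply: measurable_funTS; exact: measurable_funX.
have d20 : (0 <= (delta ^+ 2)%:E)%E by rewrite lee_fin sqr_ge0.
rewrite -(@ge0_integralZl _ _ R (@lebesgue_measure R) _ (measurable_itv _) _ m2 _ _ d20); last by move=> s _; rewrite lee_fin sqr_ge0.
apply: ge0_le_integral => //.
- by move=> s _; rewrite lee_fin mulr1 sqr_ge0.
- by apply/measurable_EFinP; apply: measurable_funM => //; exact: measurable_funX.
- by apply: measurable_funeM.
- move=> s _; rewrite -EFinM lee_fin mulr1 exprMn ler_wpM2r ?sqr_ge0//.
  rewrite -(real_normK (num_real a)) ler_pXn2r ?nnegrE//; last exact: ltW.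
  exact: le_trans (norm2_coord u i) ud.
Qed.

Lemma truncv0 u : truncv u 0 = 0.
Proof. by apply/colP => l; rewrite !mxE ltn0. Qed.

Lemma truncvn u : truncv u n = u.
Proof. by apply/colP => l; rewrite !mxE ltn_ord. Qed.

(** Telescoping along the staircase and Cauchy-Schwarz against the all-ones vector, the source of
    the factor [n]. *)
Lemma increment_sqr_le (u x : 'cV[R]_n) :
  (f (x + u) - f x) ^+ 2 <=
  n%:R * \sum_(i < n) (f (x + truncv u i.+1) - f (x + truncv u i)) ^+ 2.
Proof.
pose inc : 'cV[R]_n := \col_i (f (x + truncv u i.+1) - f (x + truncv u i)).
have -> : f (x + u) - f x = dot (const_mx 1) inc.
  rewrite -{1}(truncvn u) -{2}[x]addr0 -(truncv0 u).
  rewrite -(telescope_sumr (fun i => f (x + truncv u i)) (leq0n n)) big_mkord.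
  by apply: eq_bigr => i _; rewrite !mxE mul1r.
apply: le_trans (dot_sqr_le _ _) _; rewrite !norm2_sqr.
rewrite [X in X * _](_ : _ = n%:R); last first.
  rewrite (eq_bigr (fun=> 1)); first by rewrite sumr_const card_ord.
  by move=> i _; rewrite mxE expr1n.
by rewrite ler_wpM2l//; apply: ler_sum => i _; rewrite mxE.
Qed.

(** For a fixed parameter the point on the leg is a translate of [x] by a vector of norm at most
    [delta]. After exchanging the two integrals, each parameter costs the factor [K]. *)
Lemma weighted_increment_le (u : 'cV[R]_n) (i : 'I_n) : norm2 u <= delta ->
  (\int[mu]_(x in S) (rho x * (f (x + truncv u i.+1)%R - f (x + truncv u i)%R) ^+ 2)%:E <=
   (delta ^+ 2 * K)%:E * \int[mu]_x (rho x * D i x ^+ 2)%:E)%E.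
Proof.
move=> ud.
pose v (s : R) := truncv u i + (s * u i ord0) *: delta_mx i ord0.
have mI := @measurable_itv R `[0, 1].
have mxv : measurable_fun (setT : set ('cV[R]_n * measurableTypeR R))
    (fun p => p.1 + v p.2).
  apply: measurable_addmx => //; apply: measurable_addmx => //.
  apply: (measurable_scalemx (f := cst (delta_mx i ord0 : 'cV[R]_n))) => //.
  exact: measurable_funM.
have mDv : measurable_fun (setT : set ('cV[R]_n * measurableTypeR R))
    (fun p => (rho p.1 * D i (p.1 + v p.2) ^+ 2)%:E).
  apply/measurable_EFinP; apply: measurable_funM; first exact: measurableT_comp.
  by apply: measurable_funX; apply: measurableT_comp mxv.
have DE0 (p : 'cV[R]_n * measurableTypeR R) : (0 <= (rho p.1 * D i (p.1 + v p.2)%R ^+ 2)%:E)%E.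
  by rewrite lee_fin mulr_ge0 ?sqr_ge0.
have d20 : (0 <= (delta ^+ 2)%:E)%E by rewrite lee_fin sqr_ge0.
have mFS : measurable_fun setT (fun x => \int[lebesgue_measure]_(s in `[0%R, 1%R])
    (rho x * D i (x + v s)%R ^+ 2)%:E)%E.
  apply: (@measurable_fubini_domain _ _ _ _ R (@lebesgue_measure R) _
    (fun p => (rho p.1 * D i (p.1 + v p.2) ^+ 2)%:E)) => //.
  exact: measurable_funTS.
have minc : measurable_fun setT (fun x => rho x * (f (x + truncv u i.+1) - f (x + truncv u i)) ^+ 2).
  apply: measurable_funM => //; apply: measurable_funX.
  by apply: measurable_funB; exact: measurable_shift.
apply: (@le_trans _ _ (\int[mu]_(x in S) ((delta ^+ 2)%:E * \int[lebesgue_measure]_(s in `[0%R, 1%R])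
     (rho x * D i (x + v s)%R ^+ 2)%:E))%E).
  apply: ge0_le_integral => //.
  - by move=> x _; rewrite lee_fin mulr_ge0 ?sqr_ge0.
  - by apply/measurable_EFinP; exact: measurable_funTS.
  - by apply: measurable_funTS; exact: measurable_funeM.
  - move=> x Sx.
    have mDx : measurable_fun (`[0, 1]%classic : set (measurableTypeR R))
        (fun s => (D i (x + v s) ^+ 2)%:E).
      apply/measurable_EFinP; apply: measurable_funTS; apply: measurable_funX.
      apply: (measurableT_comp (mD i)).
      exact: (measurableT_comp mxv (pair1_measurable x)).
    have r0 : (0 <= (rho x)%:E)%E by rewrite lee_fin.
    under eq_integral do rewrite EFinM.
    rewrite (@ge0_integralZl _ _ R (@lebesgue_measure R) _ mI _ mDx _ _ r0); last first.
      by move=> s _; rewrite lee_fin sqr_ge0.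
    rewrite muleCA EFinM; apply: lee_wpmul2l => //.
    exact: coordinate_increment_le.
rewrite ge0_integralZl//; last 2 first.
- exact: measurable_funTS.
- by move=> x _; apply: integral_ge0 => s _; exact: (DE0 (x, s)).
rewrite (EFinM (delta ^+ 2)) -muleA; apply: lee_wpmul2l => //.
rewrite (@fubini_tonelli_domains _ _ _ _ R mu (@lebesgue_measure R) S `[0, 1]
    (fun p => (rho p.1 * D i (p.1 + v p.2)%R ^+ 2)%:E))//; last exact: measurable_funTS.
apply: (@le_trans _ _ (\int[lebesgue_measure]_(s in `[0%R, 1%R])
   cst (K%:E * \int[mu]_x (rho x * D i x ^+ 2)%:E) s)%E); last first.
  by rewrite integral_cst//= lebesgue_measure_itv/= lte_fin ltr01 -EFinD subr0 mule1.
apply: ge0_le_integral => //.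
- by move=> s _; apply: integral_ge0 => x _; exact: (DE0 (x, s)).
- apply: measurable_funTS.
  apply: (@measurable_fubini_domain _ _ (measurableTypeR R) _ R mu S
    (fun p => (rho p.2 * D i (p.2 + v p.1)%R ^+ 2)%:E)) => //; last first.
    by move=> [s x]; exact: (DE0 (x, s)).
  by apply: measurable_funTS; exact: (measurableT_comp mDv (@measurable_swap _ _ _ _)).
- move=> s; rewrite /= in_itv/= => s01.
  apply: (@weighted_translate_le (fun x => D i x ^+ 2)).
  + exact: measurable_funX.
  + by move=> x; exact: sqr_ge0.
  + exact: le_trans (norm2_truncv u i s01) ud.
Qed.

Lemma translation_sqr_le (u : 'cV[R]_n) : norm2 u <= delta ->
  (\int[mu]_(x in S) (rho x * (f (x + u)%R - f x) ^+ 2)%:E <=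
   (n%:R * delta ^+ 2 * K)%:E * \sum_(i < n) \int[mu]_x (rho x * D i x ^+ 2)%:E)%E.
Proof.
move=> ud.
have minc i : measurable_fun setT (fun x => rho x * (f (x + truncv u i.+1) - f (x + truncv u i)) ^+ 2).
  apply: measurable_funM => //; apply: measurable_funX.
  by apply: measurable_funB; exact: measurable_shift.
have inc0 i x : (0 <= (rho x * (f (x + truncv u i.+1)%R - f (x + truncv u i)%R) ^+ 2)%:E)%E.
  by rewrite lee_fin mulr_ge0 ?sqr_ge0.
have n0 : (0 <= (n%:R : R)%:E)%E by rewrite lee_fin.
apply: (@le_trans _ _ (\int[mu]_(x in S) ((n%:R)%:E * \sum_(i < n)
   (rho x * (f (x + truncv u i.+1)%R - f (x + truncv u i)%R) ^+ 2)%:E))%E).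
  apply: ge0_le_integral => //.
  - by move=> x _; rewrite lee_fin mulr_ge0 ?sqr_ge0.
  - apply/measurable_EFinP; apply: measurable_funTS; apply: measurable_funM => //.
    by apply: measurable_funX; apply: measurable_funB => //; exact: measurable_shift.
  - apply: measurable_funTS; apply: measurable_funeM; apply: emeasurable_sum => i.
    by apply/measurable_EFinP; exact: minc.
  - move=> x _; rewrite sumEFin -EFinM lee_fin -mulr_sumr [leRHS]mulrCA ler_wpM2l//.
    exact: increment_sqr_le.
rewrite ge0_integralZl//; last 2 first.
- apply: measurable_funTS; apply: emeasurable_sum => i.
  by apply/measurable_EFinP; exact: minc.
- by move=> x _; apply: sume_ge0.
rewrite -mulrA (EFinM n%:R) -muleA; apply: lee_wpmul2l => //.
rewrite ge0_integral_sum//; last first.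
  by move=> i; apply/measurable_EFinP; apply: measurable_funTS; exact: minc.
rewrite ge0_sume_distrr; last first.
  by move=> i _; apply: integral_ge0 => x _; rewrite lee_fin mulr_ge0 ?sqr_ge0.
by apply: lee_sum => i _; exact: weighted_increment_le.
Qed.

Local Notation eta := (@mollifier R n delta).

Lemma bump_ge0 u : 0 <= eta u.
Proof. exact: sqr_ge0. Qed.

Lemma bump_eq0 u : delta <= norm2 u -> eta u = 0.
Proof.
move=> du; rewrite /mollifier max_l ?expr0n// subr_le0.
by rewrite ler_pXn2r ?nnegrE ?norm2_ge0// ltW.
Qed.

Lemma bump_le u : eta u <= delta ^+ 4.
Proof.
rewrite (_ : 4%N = (2 * 2)%N)// exprM ler_pXn2r ?nnegrE ?sqr_ge0//.
  by rewrite ge_max sqr_ge0/= lerBlDr lerDl sqr_ge0.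
by rewrite le_max lexx.
Qed.

Lemma measurable_max0 : measurable_fun setT (fun u : 'cV[R]_n => Num.max 0 (delta ^+ 2 - norm2 u ^+ 2)).
Proof.
apply: measurable_maxr => //; apply: measurable_funB => //.
by apply: measurable_funX; exact: measurable_norm2.
Qed.

Lemma measurable_bump : measurable_fun setT eta.
Proof. by apply: measurable_funX; exact: measurable_max0. Qed.

Lemma measurable_dbump : measurable_fun setT (@dmollifier R n delta).
Proof. by apply: measurable_funM => //; exact: measurable_max0. Qed.

Lemma integrable_bounded_support (g : 'cV[R]_n -> R) (B r : R) :
  measurable_fun setT g -> (forall u, `|g u| <= B) ->
  (forall u, r < norm2 u -> g u = 0) -> mu.-integrable setT (EFin \o g).
Proof.
move=> mg gB gr; apply/integrableP; split; first exact/measurable_EFinP.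
have mb := @measurable_euclidean_ball R n r.
rewrite (@le_lt_trans _ _ (\int[mu]_(x in euclidean_ball r) (cst B%:E) x)%E)//; last first.
  rewrite integral_cst// lte_mul_pinfty// ?euclidean_ball_fin// lee_fin.
  exact: le_trans (normr_ge0 _) (gB 0).
rewrite [leRHS]integral_mkcond; apply: ge0_le_integral => //.
- by apply: measurableT_comp => //; exact/measurable_EFinP.
- by apply/(measurable_restrictT _ _).1 => //; exact: measurable_cst.
- move=> u _; rewrite /= /patch; case: ifPn => [_|]; first by rewrite lee_fin.
  by rewrite notin_setE /euclidean_ball/= => /negP; rewrite -ltNge => /gr ->; rewrite normr0.
Qed.

Lemma integrable_bump : mu.-integrable setT (EFin \o eta).
Proof.
apply: (@integrable_bounded_support _ (delta ^+ 4) delta).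
- exact: measurable_bump.
- by move=> u; rewrite ger0_norm ?bump_ge0// bump_le.
- by move=> u /ltW; exact: bump_eq0.
Qed.

Definition bump_mass : R := \int[mu]_u eta u.

Lemma integral_bump : (\int[mu]_u (eta u)%:E = bump_mass%:E)%E.
Proof. by rewrite /bump_mass /Rintegral fineK//; exact: integrable_fin_num integrable_bump. Qed.

Lemma bump_mass_gt0 : 0 < bump_mass.
Proof.
rewrite -lte_fin -integral_bump.
(* On the ball of radius delta / 2 the difference delta^2 - |u|^2 is at least 3/4 delta^2, hence
   above delta^2 / 2. *)
pose b := (delta ^+ 2 / 2) ^+ 2.
have b0 : 0 < b by rewrite exprn_gt0// divr_gt0// exprn_gt0.
have d20 : 0 < delta / 2 by rewrite divr_gt0.
have mb := @measurable_euclidean_ball R n (delta / 2).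
have meta : measurable_fun setT (fun u => (eta u)%:E).
  by apply/measurable_EFinP; exact: measurable_bump.
have eta0 u : (0 <= (eta u)%:E)%E by rewrite lee_fin bump_ge0.
apply: (@lt_le_trans _ _ (\int[mu]_(x in euclidean_ball (delta / 2)) (cst b%:E) x)%E).
  rewrite integral_cst//.
  by rewrite mule_gt0 ?lte_fin// euclidean_ball_gt0.
apply: (@le_trans _ _ (\int[mu]_(u in euclidean_ball (delta / 2)) (eta u)%:E)%E).
  apply: ge0_le_integral => //.
  - by move=> x _; rewrite lee_fin ltW.
  - exact: measurable_funTS.
  - move=> u /= ud; rewrite lee_fin /b ler_pXn2r ?nnegrE ?le_max ?lexx//; last first.
      by rewrite divr_ge0// sqr_ge0.
    apply/orP; right.
    have : norm2 u ^+ 2 <= (delta / 2) ^+ 2.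
      by rewrite ler_pXn2r ?nnegrE ?norm2_ge0// ltW.
    have := sqr_ge0 delta; rewrite exprMn; lra.
by apply: ge0_subset_integral.
Qed.

Definition moll (g : 'cV[R]_n -> R) (x : 'cV[R]_n) : R :=
  bump_mass^-1 * \int[mu]_u (g (x + u) * eta u).

Lemma measurable_shift2 (g : 'cV[R]_n -> R) : measurable_fun setT g ->
  measurable_fun setT (fun p : 'cV[R]_n * 'cV[R]_n => g (p.1 + p.2)).
Proof. by move=> mg; apply: (measurableT_comp mg); exact: measurable_addmx. Qed.

Lemma measurable_moll g : measurable_fun setT g -> measurable_fun setT (moll g).
Proof.
move=> mg; apply: measurable_funM => //.
apply: (@measurable_Rintegral_fubini _ _ _ _ R mu
  (fun p : 'cV[R]_n * 'cV[R]_n => g (p.1 + p.2) * eta p.2)).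
apply: measurable_funM; first exact: measurable_shift2.
exact: measurableT_comp measurable_bump _.
Qed.

(** Jensen's inequality for the probability density [eta / bump_mass]. *)
Lemma moll_sqr_le (g : 'cV[R]_n -> R) x : measurable_fun setT g ->
  ((moll g x ^+ 2)%:E <= \int[mu]_u (bump_mass^-1 * (g (x + u)%R ^+ 2 * eta u))%:E)%E.
Proof.
move=> mg.
have mgx : measurable_fun setT (fun u => g (x + u)).
  by apply: (measurableT_comp mg); exact: measurable_addmx.
have c0 := bump_mass_gt0.
have ci0 : (0 <= (bump_mass^-1)%:E)%E by rewrite lee_fin invr_ge0 ltW.
have m2 : measurable_fun setT (fun u => (g (x + u) ^+ 2 * eta u)%:E).
  by apply/measurable_EFinP; apply: measurable_funM; [exact: measurable_funX|exact: measurable_bump].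
under eq_integral do rewrite EFinM.
rewrite (ge0_integralZl mu measurableT m2 _ ci0); last first.
  by move=> u _; rewrite lee_fin mulr_ge0 ?sqr_ge0 ?bump_ge0.
rewrite /moll exprMn expr2 -mulrA (EFinM bump_mass^-1); apply: lee_wpmul2l => //.
have H := sqr_Rintegral_le measurableT mgx measurable_bump (fun u _ => bump_ge0 u) c0 integral_bump.
apply: (@le_trans _ _ ((bump_mass^-1)%:E * (bump_mass%:E *
   \int[mu]_u (g (x + u)%R ^+ 2 * eta u)%:E))%E).
  by rewrite EFinM; apply: lee_wpmul2l.
by rewrite muleA -(EFinM bump_mass^-1) mulVf ?gt_eqF// mul1e.
Qed.

(** An average over the normalised bump cannot exceed a bound valid for each shift in its support.
    It serves both the contraction property and the error estimate of the mollification. *)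
Lemma bump_average_le (Psi : 'cV[R]_n * 'cV[R]_n -> R) (C : \bar R) :
  measurable_fun setT Psi -> (forall p, 0 <= Psi p) -> (0 <= C)%E ->
  (forall u, norm2 u <= delta -> (\int[mu]_(x in S) (Psi (x, u))%:E <= C)%E) ->
  (\int[mu]_(x in S) \int[mu]_u (bump_mass^-1 * (Psi (x, u) * eta u))%:E <= C)%E.
Proof.
move=> mP P0 C0 HC.
have c0 := bump_mass_gt0.
have ci0 : 0 <= bump_mass^-1 by rewrite invr_ge0 ltW.
have mPe : measurable_fun setT (fun p => (bump_mass^-1 * (Psi p * eta p.2))%:E).
  apply/measurable_EFinP; apply: measurable_funM => //; apply: measurable_funM => //.
  exact: measurableT_comp measurable_bump _.
have Pe0 p : (0 <= (bump_mass^-1 * (Psi p * eta p.2))%:E)%E.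
  by rewrite lee_fin; apply: mulr_ge0 => //; apply: mulr_ge0 => //; exact: bump_ge0.
rewrite (@fubini_tonelli_domains _ _ _ _ R mu mu S setT
  (fun p => (bump_mass^-1 * (Psi p * eta p.2))%:E))//; last exact: measurable_funTS.
have mce : measurable_fun setT (fun u => (bump_mass^-1 * eta u)%:E).
  by apply/measurable_EFinP; apply: measurable_funM => //; exact: measurable_bump.
apply: (@le_trans _ _ (\int[mu]_u ((bump_mass^-1 * eta u)%:E * C))%E); last first.
  rewrite ge0_integralZr//; last first.
    by move=> u _; rewrite lee_fin mulr_ge0 ?bump_ge0.
  have meta : measurable_fun setT (fun u => (eta u)%:E).
    by apply/measurable_EFinP; exact: measurable_bump.
  have ci0E : (0 <= (bump_mass^-1)%:E)%E by rewrite lee_fin.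
  under eq_integral do rewrite EFinM.
  rewrite (ge0_integralZl mu measurableT meta _ ci0E); last first.
    by move=> u _; rewrite lee_fin bump_ge0.
  by rewrite integral_bump -(EFinM bump_mass^-1) mulVf ?gt_eqF// mul1e.
apply: ge0_le_integral => //.
- by move=> u _; apply: integral_ge0 => x _; exact: (Pe0 (x, u)).
- apply: (@measurable_fubini_domain _ _ _ _ R mu S
    (fun p => (bump_mass^-1 * (Psi (p.2, p.1) * eta p.1))%:E)) => //.
  apply: measurable_funTS.
  exact: (measurableT_comp mPe (@measurable_swap _ _ _ _)).
- by apply: emeasurable_funM.
- move=> u _.
  have mPu : measurable_fun S (fun x => (Psi (x, u))%:E).
    apply: measurable_funTS; apply/measurable_EFinP.
    exact: (measurableT_comp mP (pair2_measurable u)).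
  have ceu : (0 <= (bump_mass^-1 * eta u)%:E)%E by rewrite lee_fin mulr_ge0 ?bump_ge0.
  have -> : (\int[mu]_(x in S) (bump_mass^-1 * (Psi (x, u) * eta (x, u).2))%:E =
      \int[mu]_(x in S) ((bump_mass^-1 * eta u)%:E * (Psi (x, u))%:E))%E.
    by apply: eq_integral => x _; rewrite -EFinM [Psi _ * _]mulrC mulrA.
  rewrite (ge0_integralZl mu mS mPu _ ceu); last by move=> x _; rewrite lee_fin.
  have [du|ud] := leP delta (norm2 u); first by rewrite bump_eq0// mulr0 !mul0e.
  by apply: lee_wpmul2l => //; apply: HC; exact: ltW.
Qed.

Lemma moll_contraction (g : 'cV[R]_n -> R) : measurable_fun setT g ->
  (\int[mu]_(x in S) (rho x * moll g x ^+ 2)%:E <=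
   K%:E * \int[mu]_x (rho x * g x ^+ 2)%:E)%E.
Proof.
move=> mg.
have mg2 : measurable_fun setT (fun x => g x ^+ 2) by exact: measurable_funX.
have Kint0 : (0 <= K%:E * \int[mu]_x (rho x * g x ^+ 2)%:E)%E.
  rewrite mule_ge0 ?lee_fin//; apply: integral_ge0 => x _.
  by rewrite lee_fin mulr_ge0 ?sqr_ge0.
pose Psi (p : 'cV[R]_n * 'cV[R]_n) := rho p.1 * g (p.1 + p.2) ^+ 2.
have mPsi : measurable_fun setT Psi.
  apply: measurable_funM; first exact: measurableT_comp.
  exact: (measurable_shift2 mg2).
have Psi0 p : 0 <= Psi p by rewrite mulr_ge0 ?sqr_ge0.
apply: le_trans (bump_average_le mPsi Psi0 Kint0 _); last first.
  move=> u ud; apply: (@weighted_translate_le (fun x => g x ^+ 2)) => //.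
  by move=> x; exact: sqr_ge0.
have c0 := bump_mass_gt0.
have ci0 : 0 <= bump_mass^-1 by rewrite invr_ge0 ltW.
have mPe : measurable_fun setT (fun p => (bump_mass^-1 * (Psi p * eta p.2))%:E).
  apply/measurable_EFinP; apply: measurable_funM => //; apply: measurable_funM => //.
  exact: measurableT_comp measurable_bump _.
have Pe0 p : (0 <= (bump_mass^-1 * (Psi p * eta p.2))%:E)%E.
  by rewrite lee_fin; apply: mulr_ge0 => //; apply: mulr_ge0 => //; exact: bump_ge0.
apply: ge0_le_integral => //.
- by move=> x _; rewrite lee_fin mulr_ge0 ?sqr_ge0.
- apply: measurable_funTS; apply/measurable_EFinP; apply: measurable_funM => //.
  by apply: measurable_funX; exact: measurable_moll.
- apply: measurable_funTS.
  apply: (@measurable_fubini_domain _ _ _ _ R mu setT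
    (fun p => (bump_mass^-1 * (Psi p * eta p.2))%:E)) => //.
  exact: measurable_funTS.
- move=> x _.
  have mge : measurable_fun setT (fun u => (bump_mass^-1 * (g (x + u) ^+ 2 * eta u))%:E).
    apply/measurable_EFinP; apply: measurable_funM => //; apply: measurable_funM.
      apply: measurable_funX; apply: (measurableT_comp mg); exact: measurable_addmx.
    exact: measurable_bump.
  have r0 : (0 <= (rho x)%:E)%E by rewrite lee_fin.
  have -> : (\int[mu]_u (bump_mass^-1 * (Psi (x, u) * eta u))%:E =
      \int[mu]_u ((rho x)%:E * (bump_mass^-1 * (g (x + u)%R ^+ 2 * eta u))%:E))%E.
    by apply: eq_integral => u _; rewrite -EFinM /Psi/=; congr EFin; ring.
  rewrite (ge0_integralZl mu measurableT mge _ r0); last first.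
    move=> u _; rewrite lee_fin; apply: mulr_ge0 => //.
    by apply: mulr_ge0; [exact: sqr_ge0|exact: bump_ge0].
  by rewrite EFinM; apply: lee_wpmul2l => //; exact: moll_sqr_le.
Qed.

Lemma integrable_bounded_bump (g : 'cV[R]_n -> R) (B : R) :
  measurable_fun setT g -> (forall u, `|g u| <= B) ->
  mu.-integrable setT (fun u => (g u * eta u)%:E).
Proof.
move=> mg gB; apply: (@integrable_bounded_support _ (B * delta ^+ 4) delta).
- by apply: measurable_funM => //; exact: measurable_bump.
- move=> u; rewrite normrM ler_pM// ger0_norm ?bump_ge0//; exact: bump_le.
- by move=> u /ltW du; rewrite bump_eq0// mulr0.
Qed.

(** [f x - moll f x] is the bump average of [f x - f (x + u)], so Jensen's inequality reduces the
    claim to [translation_sqr_le]. Boundedness of [f] gives the integrability needed to split the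
    average. *)
Lemma moll_error_le :
  (\int[mu]_(x in S) (rho x * (f x - moll f x) ^+ 2)%:E <=
   (n%:R * delta ^+ 2 * K)%:E * \sum_(i < n) \int[mu]_x (rho x * D i x ^+ 2)%:E)%E.
Proof.
set C := (X in (_ <= X)%E).
have C0 : (0 <= C)%E.
  rewrite mule_ge0//; first by rewrite lee_fin !mulr_ge0// ltW.
  apply: sume_ge0 => i _; apply: integral_ge0 => x _.
  by rewrite lee_fin mulr_ge0 ?sqr_ge0.
pose Psi (p : 'cV[R]_n * 'cV[R]_n) := rho p.1 * (f (p.1 + p.2) - f p.1) ^+ 2.
have mPsi : measurable_fun setT Psi.
  apply: measurable_funM; first exact: measurableT_comp.
  apply: measurable_funX; apply: measurable_funB; first exact: measurable_shift2.
  exact: measurableT_comp.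
have Psi0 p : 0 <= Psi p by rewrite mulr_ge0 ?sqr_ge0.
apply: le_trans (bump_average_le mPsi Psi0 C0 _); last first.
  by move=> u ud; exact: translation_sqr_le.
have c0 := bump_mass_gt0.
have ci0 : 0 <= bump_mass^-1 by rewrite invr_ge0 ltW.
have mPe : measurable_fun setT (fun p => (bump_mass^-1 * (Psi p * eta p.2))%:E).
  apply/measurable_EFinP; apply: measurable_funM => //; apply: measurable_funM => //.
  exact: measurableT_comp measurable_bump _.
have Pe0 p : (0 <= (bump_mass^-1 * (Psi p * eta p.2))%:E)%E.
  by rewrite lee_fin; apply: mulr_ge0 => //; apply: mulr_ge0 => //; exact: bump_ge0.
apply: ge0_le_integral => //.
- by move=> x _; rewrite lee_fin mulr_ge0 ?sqr_ge0.
- apply: measurable_funTS; apply/measurable_EFinP; apply: measurable_funM => //.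
  by apply: measurable_funX; apply: measurable_funB => //; exact: measurable_moll.
- apply: measurable_funTS.
  apply: (@measurable_fubini_domain _ _ _ _ R mu setT
    (fun p => (bump_mass^-1 * (Psi p * eta p.2))%:E)) => //.
  exact: measurable_funTS.
- move=> x _.
  have mfx : measurable_fun setT (fun u => f (x + u)).
    by apply: (measurableT_comp mf); exact: measurable_addmx.
  have mphi : measurable_fun setT (fun u => f (x + u) - f x) by exact: measurable_funB.
  have mge : measurable_fun setT (fun u => (bump_mass^-1 * ((f (x + u) - f x) ^+ 2 * eta u))%:E).
    apply/measurable_EFinP; apply: measurable_funM => //; apply: measurable_funM.
      exact: measurable_funX.
    exact: measurable_bump.
  have r0 : (0 <= (rho x)%:E)%E by rewrite lee_fin.
  have -> : (\int[mu]_u (bump_mass^-1 * (Psi (x, u) * eta u))%:E =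
      \int[mu]_u ((rho x)%:E * (bump_mass^-1 * ((f (x + u)%R - f x)^+ 2 * eta u))%:E))%E.
    by apply: eq_integral => u _; rewrite -EFinM /Psi/=; congr EFin; ring.
  rewrite (ge0_integralZl mu measurableT mge _ r0); last first.
    move=> u _; rewrite lee_fin; apply: mulr_ge0 => //.
    by apply: mulr_ge0; [exact: sqr_ge0|exact: bump_ge0].
  rewrite EFinM; apply: lee_wpmul2l => //.
  have If : mu.-integrable setT (fun u => (f (x + u)%R * eta u)%:E).
    by apply: (@integrable_bounded_bump _ M) => // u; exact: fM.
  have Ic : mu.-integrable setT (fun u => (f x * eta u)%:E).
    by apply: (@integrable_bounded_bump (cst (f x)) `|f x|).
  have -> : f x - moll f x = - (bump_mass^-1 * \int[mu]_u ((f (x + u) - f x) * eta u)).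
    under eq_Rintegral do rewrite mulrBl.
    rewrite RintegralB// RintegralZl//; last exact: integrable_bump.
    by rewrite -/bump_mass mulrBr mulrCA mulVf ?gt_eqF// mulr1 opprB.
  have m2 : measurable_fun setT (fun u => ((f (x + u) - f x) ^+ 2 * eta u)%:E).
    apply/measurable_EFinP; apply: measurable_funM; last exact: measurable_bump.
    exact: measurable_funX.
  have ci0E : (0 <= (bump_mass^-1)%:E)%E by rewrite lee_fin.
  under eq_integral do rewrite EFinM.
  rewrite (ge0_integralZl mu measurableT m2 _ ci0E); last first.
    by move=> u _; rewrite lee_fin mulr_ge0 ?sqr_ge0 ?bump_ge0.
  rewrite sqrrN exprMn expr2 -mulrA (EFinM bump_mass^-1); apply: lee_wpmul2l => //.
  have H := sqr_Rintegral_le measurableT mphi measurable_bump (fun u _ => bump_ge0 u) c0 integral_bump.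
  apply: (@le_trans _ _ ((bump_mass^-1)%:E * (bump_mass%:E *
     \int[mu]_u ((f (x + u)%R - f x) ^+ 2 * eta u)%:E))%E).
    by rewrite EFinM; apply: lee_wpmul2l.
  by rewrite muleA -(EFinM bump_mass^-1) mulVf ?gt_eqF// mul1e.
Qed.

Section partial_derivative.
Variable i : 'I_n.
Hypothesis ID : (\int[mu]_x (rho x * D i x ^+ 2)%:E < +oo)%E.
Variable x : 'cV[R]_n.
Hypotheses (Sx : S x) (rhox : 0 < rho x).

(** [D i] is known to be square integrable against [rho] only. Within distance [delta] of a point of
    [S] the density is at least [rho x / K], which together with |D| <= D^2 + 1 yields local
    integrability. *)
Lemma integrable_partial_bump : mu.-integrable setT (fun u => (D i (x + u)%R * eta u)%:E).
Proof.
have mDx : measurable_fun setT (fun u => D i (x + u)).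
  by apply: (measurableT_comp (mD i)); exact: measurable_addmx.
have mrx : measurable_fun setT (fun u => rho (x + u)).
  by apply: (measurableT_comp mrho); exact: measurable_addmx.
have Irho : mu.-integrable setT (fun u => (rho (x + u)%R * D i (x + u)%R ^+ 2)%:E).
  have I0 : mu.-integrable setT (fun u => (rho u * D i u ^+ 2)%:E).
    apply/integrableP; split.
      by apply/measurable_EFinP/measurable_funM => //; exact: measurable_funX.
    rewrite (eq_integral (fun u => (rho u * D i u ^+ 2)%:E))// => u _.
    by rewrite abse_EFin ger0_norm// mulr_ge0 ?sqr_ge0.
  have := integrable_translate x I0.
  by under eq_fun do rewrite addrC.
(* delta^4 bounds the bump, and [K / rho x] bounds the inverse of [rho (x + u)] on its support. *)
pose C := K * delta ^+ 4 / rho x.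
have IC := integrableZl measurableT C Irho.
have Ib := integrable_bump.
apply: (le_integrable measurableT _ _ (integrableD measurableT IC Ib)).
  by apply/measurable_EFinP; apply: measurable_funM => //; exact: measurable_bump.
move=> u _.
change ((`|D i (x + u) * eta u|)%:E <=
  (`|C * (rho (x + u) * D i (x + u) ^+ 2) + eta u|)%:E)%E.
rewrite lee_fin.
have e0 := bump_ge0 u.
have rD0 : 0 <= rho (x + u) * D i (x + u) ^+ 2 by rewrite mulr_ge0 ?sqr_ge0.
have C0 : 0 <= C by rewrite /C !mulr_ge0// ?invr_ge0 ltW// exprn_gt0.
rewrite [leRHS]ger0_norm; last by apply: addr_ge0 => //; exact: mulr_ge0.
rewrite normrM (ger0_norm e0).
have a1 : `|D i (x + u)| <= D i (x + u) ^+ 2 + 1.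
  rewrite -(real_normK (num_real (D i (x + u)))).
  by have := sqr_ge0 (`|D i (x + u)| - 1); have := sqr_ge0 `|D i (x + u)|; nra.
apply: (le_trans (ler_wpM2r e0 a1)); rewrite mulrDl mul1r lerD2r.
have [du|ud] := leP delta (norm2 u).
  by rewrite bump_eq0// mulr0; exact: mulr_ge0.
have : rho x <= K * rho (x + u) by apply: SK => //; exact: ltW.
have -> : C * (rho (x + u) * D i (x + u) ^+ 2) =
   D i (x + u) ^+ 2 * (delta ^+ 4 * ((K * rho (x + u)) / rho x)).
  by rewrite /C; field; rewrite gt_eqF.
move=> h; apply: ler_wpM2l; first exact: sqr_ge0.
apply: (le_trans (bump_le u)); rewrite -[leLHS]mulr1; apply: ler_wpM2l.
  by rewrite exprn_ge0// ltW.
by rewrite ler_pdivlMr// mul1r.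
Qed.

Local Notation e := (delta_mx i ord0 : 'cV[R]_n).
(** [H] is the candidate for the i-th partial derivative of [F], by the product rule; [dF] collects
    the part in which the derivative falls on the bump, with opposite sign. *)
Let F (w : 'cV[R]_n) := f w * eta (w - x).
Let dF (w : 'cV[R]_n) := f w * (@dmollifier R n delta (w - x) * (w - x) i ord0).
Let H (w : 'cV[R]_n) := D i w * eta (w - x) - dF w.

Lemma dmollifier_eq0 u : delta <= norm2 u -> @dmollifier R n delta u = 0.
Proof.
move=> du; rewrite /dmollifier max_l ?mulr0// subr_le0.
by rewrite ler_pXn2r ?nnegrE ?norm2_ge0// ltW.
Qed.

Lemma norm2_line (u : 'cV[R]_n) (h : R) :
  norm2 (u + h *: e) ^+ 2 = norm2 u ^+ 2 + 2 * h * u i ord0 + h ^+ 2.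
Proof.
rewrite !norm2_sqr (bigD1 i)//= [in RHS](bigD1 i)//=.
rewrite (eq_bigr (fun l : 'I_n => u l ord0 ^+ 2)); last first.
  by move=> l li; rewrite !mxE (negbTE li)/= mulr0 addr0.
by rewrite !mxE !eqxx mulr1; ring.
Qed.

(** The fundamental theorem used later asks for a derivative at every point of the line. In [X] this
    is the product rule. Off [X] nothing is known of [f] beyond the bound [M], but such a point is
    at distance at least [delta] from [x], where the bump vanishes to second order, so [F] has
    derivative 0. *)
Lemma is_derive_F_line (w : 'cV[R]_n) (s : R) :
  is_derive s 1 (fun s => F (w + s *: e)) (H (w + s *: e)).
Proof.
have [Xw|nXw] := pselect (X (w + s *: e)).
  have df := dfD i Xw.
  have d1 : is_derive s 1 (fun s => f (w + s *: e)) (D i (w + s *: e)).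
    have := @is_derive_line _ _ f w e 1 s.
    under eq_fun do rewrite mulr1.
    rewrite mulr1 mul1r (@derive_val _ _ _ _ _ _ _ df); apply.
    exact: (@ex_derive _ _ _ _ _ _ _ df).
  have d2 : is_derive s 1 (fun s => eta (w - (x - s *: e)))
      (@dmollifier R n delta (w - (x - s *: e)) * dot (w - (x - s *: e)) (- e)).
    apply: (@is_derive_mollifier_path _ _ delta (fun s => x - s *: e) (fun=> - e)) => l.
    apply: (@is_derive1_quadratic _ _ _ _ 0) => h; rewrite mul0r !mxE.
    by rewrite (_ : _ - _ = 0) ?normr0//; ring.
  have E t : w - (x - t *: e) = w + t *: e - x by rewrite opprB addrA addrAC.
  have := is_deriveM d1 d2.
  rewrite (_ : _ * _ = (fun s => F (w + s *: e))); last first.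
    by apply/funext => t; rewrite /F -E.
  move=> dd; apply: (is_derive_eq dd).
  rewrite E /H /dF /GRing.scale/=.
  have -> : dot (w + s *: e - x) (- e) = - (w + s *: e - x) i ord0.
    rewrite /dot (bigD1 i)//= big1 => [|l li].
      by rewrite [X in _ * X]mxE [X in _ * - X]mxE !eqxx mulrN1 addr0.
    by rewrite [X in _ * X]mxE [X in _ * - X]mxE (negbTE li) mulr0n oppr0 mulr0.
  by ring.
pose u := w + s *: e - x.
have du : delta <= norm2 u.
  rewrite leNgt; apply/negP => ud; apply: nXw.
  have := SX Sx (ltW ud); rewrite /u.
  by rewrite addrC subrK.
have Hs : H (w + s *: e) = 0.
  by rewrite /H /dF -/u bump_eq0// dmollifier_eq0// mul0r !mulr0 subrr.
(* Since |u| >= delta, the positive part at u + h e is at most |2 h u_i|; its square is 4 u_i^2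
   h^2. *)
rewrite Hs; apply: (@is_derive1_quadratic _ _ _ _ (M * (4 * u i ord0 ^+ 2))) => h.
have Fs : F (w + s *: e) = 0 by rewrite /F -/u bump_eq0// mulr0.
rewrite Fs mul0r !subr0 /F normrM.
have -> : w + (h + s) *: e - x = u + h *: e.
  by rewrite /u scalerDl addrA addrAC [RHS]addrAC; congr (_ - _); rewrite addrAC.
rewrite -mulrA; apply: ler_pM => //; rewrite ger0_norm ?bump_ge0//.
rewrite /mollifier norm2_line.
have du2 : delta ^+ 2 <= norm2 u ^+ 2 by rewrite ler_pXn2r ?nnegrE ?norm2_ge0// ltW.
set q := norm2 u ^+ 2 in du2 *; set a := u i ord0.
case: (leP 0 (delta ^+ 2 - (q + 2 * h * a + h ^+ 2))) => r; last first.
  by rewrite expr0n/= mulr_ge0 ?sqr_ge0// mulr_ge0// sqr_ge0.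
have r2 : delta ^+ 2 - (q + 2 * h * a + h ^+ 2) <= `|2 * h * a|.
  by have := ler_norm (- (2 * h * a)); rewrite normrN; have := sqr_ge0 h; lra.
have -> : 4 * a ^+ 2 * h ^+ 2 = `|2 * h * a| ^+ 2.
  by rewrite real_normK ?num_real//; ring.
by rewrite ler_pXn2r// nnegrE.
Qed.

Lemma dmollifier_ge0 u : 0 <= @dmollifier R n delta u.
Proof. by rewrite /dmollifier mulr_ge0// le_max lexx. Qed.

Lemma dmollifier_le u : @dmollifier R n delta u <= 4 * delta ^+ 2.
Proof.
rewrite /dmollifier ler_wpM2l// ge_max sqr_ge0/=.
by rewrite lerBlDr lerDl sqr_ge0.
Qed.

Let shiftN (g : 'cV[R]_n -> R) : measurable_fun setT g ->
  measurable_fun setT (fun w : 'cV[R]_n => g (w - x)).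
Proof. exact: measurable_shift. Qed.

Let mF : measurable_fun setT F.
Proof. by apply: measurable_funM => //; apply: shiftN; exact: measurable_bump. Qed.

Let integrable_shiftN (g : 'cV[R]_n -> R) :
  mu.-integrable setT (fun u => (g (x + u))%:E) -> measurable_fun setT g ->
  mu.-integrable setT (EFin \o g).
Proof.
move=> Ig mg; have := integrable_translate (- x) Ig.
by apply: eq_integrable => // w _; rewrite /= addrC subrK.
Qed.

Lemma integrable_mul_mollifier : mu.-integrable setT (fun w => (f w * eta (w - x))%:E).
Proof.
apply: (integrable_shiftN (g := F)) => //.
have : mu.-integrable setT (fun u => (f (x + u)%R * eta u)%:E).
  apply: (@integrable_bounded_bump _ M) => //.
  by apply: (measurableT_comp mf); exact: measurable_addmx.
by apply: eq_integrable => // u _; rewrite /F addrAC subrr add0r.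
Qed.

Let mdF : measurable_fun setT dF.
Proof.
apply: measurable_funM => //.
apply: (shiftN (g := fun u => dmollifier delta u * u i ord0)).
by apply: measurable_funM; [exact: measurable_dbump|exact: measurable_coord].
Qed.

Lemma integrable_mul_dmollifier :
  mu.-integrable setT (fun w => (f w * (@dmollifier R n delta (w - x) * (w - x) i ord0))%:E).
Proof.
apply: (integrable_shiftN (g := dF)) => //.
apply: (@integrable_bounded_support (fun u => dF (x + u)) (M * (4 * delta ^+ 2 * delta)) delta).
- by apply: (measurableT_comp mdF); exact: measurable_addmx.
- move=> u; rewrite /dF addrAC subrr add0r normrM ler_pM//.
  rewrite normrM (ger0_norm (dmollifier_ge0 _)).
  have [du|ud] := leP delta (norm2 u).
    by rewrite dmollifier_eq0// mul0r !mulr_ge0// ?sqr_ge0// ltW.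
  apply: ler_pM => //; [exact: dmollifier_ge0|exact: dmollifier_le|].
  by apply: le_trans (norm2_coord u i) _; exact: ltW.
- by move=> u /ltW du; rewrite /dF addrAC subrr add0r dmollifier_eq0// mul0r mulr0.
Qed.

Let integrable_DF : mu.-integrable setT (fun w => (D i w * eta (w - x))%:E).
Proof.
apply: (integrable_shiftN (g := fun w => D i w * eta (w - x))).
  have := integrable_partial_bump.
  by apply: eq_integrable => // u _; rewrite addrAC subrr add0r.
by apply: measurable_funM => //; apply: shiftN; exact: measurable_bump.
Qed.

Let mH : measurable_fun setT H.
Proof.
apply: measurable_funB => //.
by apply: measurable_funM => //; apply: shiftN; exact: measurable_bump.
Qed.

Let integrable_H : mu.-integrable setT (EFin \o H).
Proof.
have := integrableB measurableT integrable_DF integrable_mul_dmollifier.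
by apply: eq_integrable.
Qed.

(** [H (w + s *: e)] is integrated over [w] and over [s] in the unit interval. Integrating over [w]
    first gives the integral of [H] by translation invariance. Integrating over [s] first gives
    [F (w + e) - F w] for almost every [w], and these differences integrate to 0, again by
    translation invariance. *)
Let integral_H0 : (\int[mu]_w (H w)%:E = 0)%E.
Proof.
(* The indicator lets both variables run over their whole spaces, as Fubini on the product measure
   expects. *)
pose I : R -> R := \1_(`[0, 1]%classic).
have I0 s : 0 <= I s by rewrite /I.
have mI := @measurable_itv R `[0, 1].
have mIf : measurable_fun (setT : set (measurableTypeR R)) I.
  by rewrite /I; exact: measurable_indic.
have I1 : (\int[@lebesgue_measure R]_s (I s)%:E = 1)%E.
  have := integral_indic (@lebesgue_measure R) (measurableT : measurable (setT : set (measurableTypeR R))) mI.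
  rewrite setIT => ->; apply: (etrans (lebesgue_measure_itv `[0%R, 1%R])).
  by rewrite /= lte_fin ltr01 -EFinD subr0.
pose G (p : 'cV[R]_n * measurableTypeR R) : \bar R := (H (p.1 + p.2 *: e) * I p.2)%:E.
have mline : measurable_fun (setT : set ('cV[R]_n * measurableTypeR R)) (fun p => p.1 + p.2 *: e).
  apply: measurable_addmx => //.
  by apply: (measurable_scalemx (f := cst e)).
have mG : measurable_fun setT G.
  apply/measurable_EFinP; apply: measurable_funM.
    exact: (measurableT_comp mH mline).
  exact: (measurableT_comp mIf measurable_snd).
have Hfin : (\int[mu]_w `|(H w)%:E| < +oo)%E by have /integrableP[] := integrable_H.
have mHe : measurable_fun setT (EFin \o H) by exact/measurable_EFinP.
have IG : (mu \x (@lebesgue_measure R))%E.-integrable setT G.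
  apply: (@integrable21ltyP _ _ _ _ R mu (@lebesgue_measure R) G mG).2.
  rewrite (@le_lt_trans _ _ (\int[@lebesgue_measure R]_s
     ((I s)%:E * \int[mu]_w `|(H w)%:E|))%E)//.
    rewrite le_eqVlt; apply/orP; left; apply/eqP; apply: eq_integral => s _.
    have Is : (0 <= (I s)%:E)%E by rewrite lee_fin.
    have mHs : measurable_fun setT (fun w : 'cV[R]_n => `|(H (w + s *: e))%:E|%E).
      apply: measurableT_comp => //; apply/measurable_EFinP; exact: measurable_shift.
    have mHa : measurable_fun setT (fun w : 'cV[R]_n => `|(H w)%:E|%E).
      exact: measurableT_comp.
    rewrite -(ge0_integral_translate (s *: e) mHa)//.
    rewrite -(ge0_integralZl mu measurableT mHs _ Is)//.
    by apply: eq_integral => w _; rewrite /G/= normrM (ger0_norm (I0 s)) mulrC EFinM.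
  rewrite ge0_integralZr//; last 3 first.
  - exact/measurable_EFinP.
  - by move=> s _; rewrite lee_fin.
  - exact: integral_ge0.
  by rewrite I1 mul1e; exact: Hfin.
have FG := @Fubini _ _ _ _ R mu (@lebesgue_measure R) G IG.
have ae1 := ae_integrable1 IG.
have E1 : (\int[mu]_w \int[@lebesgue_measure R]_s G (w, s) =
    \int[mu]_w (F (w + e)%R - F w)%:E)%E.
  apply: ae_eq_integral => //.
  - exact: (@measurable_fubini_F _ _ _ _ R mu (@lebesgue_measure R) G IG).
  - apply/measurable_EFinP; apply: measurable_funB => //; exact: measurable_shift.
  - apply: filterS ae1 => w IGw _.
    have dline (s : R) : is_derive s 1 (fun s => F (w + s *: e)) (H (w + s *: e)).
      exact: is_derive_F_line.
    have d1 : derive1 (fun s => F (w + s *: e)) = (fun s => H (w + s *: e)).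
      by apply/funext => s; rewrite derive1E; exact: derive_val.
    have EG : (\int[@lebesgue_measure R]_s G (w, s) =
       \int[@lebesgue_measure R]_(s in `[0%R, 1%R]) (H (w + s *: e)%R)%:E)%E.
      rewrite [RHS]integral_mkcond; apply: eq_integral => s _.
      by rewrite /G/= /I indicE patchE; case: ifP => _; rewrite ?mulr1 ?mulr0.
    rewrite EG -[X in X - _](_ : F (w + 1 *: e) = _); last by rewrite scale1r.
    rewrite -[X in _ - X](_ : F (w + 0 *: e) = _); last by rewrite scale0r addr0.
    rewrite -(@integral_derive1 _ (fun s => F (w + s *: e)) 0 1 ltr01).
    + by rewrite d1.
    + by move=> s _; exact: ex_derive.
    + rewrite d1.
      have := @integrableS _ _ R (@lebesgue_measure R) setT `[0, 1] _ measurableT mI (@subsetT _ _) IGw.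
      apply: eq_integrable => // s; rewrite inE /G/= /I indicE => s01.
      by rewrite mem_set// mulr1.
have IF : mu.-integrable setT (EFin \o F) := integrable_mul_mollifier.
have E2 : (\int[mu]_w (F (w + e)%R - F w)%:E = 0)%E.
  under eq_integral do rewrite EFinB.
  rewrite integralB//; last exact: (integrable_translate e IF).
  rewrite (integral_translate e (f := EFin \o F)); last exact/measurable_EFinP.
  by rewrite subee//; apply: integrable_fin_num.
have E3 : (\int[@lebesgue_measure R]_s \int[mu]_w G (w, s) = \int[mu]_w (H w)%:E)%E.
  transitivity (\int[@lebesgue_measure R]_s ((I s)%:E * \int[mu]_w (H w)%:E))%E.
    apply: eq_integral => s _.
    rewrite -(integral_translate (s *: e) mHe) -integralZl//.
      by apply: eq_integral => w _; rewrite /G/= mulrC EFinM.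
    exact: (integrable_translate (s *: e) integrable_H).
  have /fineK <- : (\int[mu]_w (H w)%:E)%E \is a fin_num by exact: integrable_fin_num.
  rewrite integralZr//; last first.
    apply/integrableP; split; first exact/measurable_EFinP.
    under eq_integral do rewrite abse_EFin (ger0_norm (I0 _)).
    by rewrite I1 ltry.
  by rewrite I1 mul1e.
by rewrite -E3 -FG E1 E2.
Qed.

(** Integration by parts against the bump: the pointwise partial derivative acts as a weak
    derivative, although [f] need not be absolutely continuous along general curves. *)
Lemma integral_partial_bump :
  \int[mu]_w (D i w * eta (w - x)) =
  \int[mu]_w (f w * (@dmollifier R n delta (w - x) * (w - x) i ord0)).
Proof.
apply/eqP; rewrite -subr_eq0; apply/eqP.
rewrite -RintegralB//; last exact: integrable_mul_dmollifier.
by rewrite /Rintegral (_ : (\int[mu]_w _)%E = 0%E)//; exact: integral_H0.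
Qed.

End partial_derivative.

Lemma Rintegral_sum (I : Type) (r : seq I) (g : I -> 'cV[R]_n -> R) :
  (forall i, mu.-integrable setT (EFin \o g i)) ->
  \int[mu]_w (\sum_(i <- r) g i w) = \sum_(i <- r) \int[mu]_w g i w.
Proof.
move=> Ig; rewrite /Rintegral.
under eq_integral do rewrite -sumEFin.
rewrite (integral_sum measurableT Ig).
rewrite (eq_bigr (fun i => (fine (\int[mu]_w (g i w)%:E)%E)%:E)); first by rewrite sumEFin.
by move=> i _; rewrite fineK//; exact: (integrable_fin_num measurableT (Ig i)).
Qed.

Section paths.
Hypothesis ID : forall i, (\int[mu]_x (rho x * D i x ^+ 2)%:E < +oo)%E.

Definition moll_grad (x : 'cV[R]_n) : 'cV[R]_n := \col_i moll (D i) x.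

(** The dependence on [x] is moved into the bump, so that differentiation falls on a C^1 function
    instead of [g]. *)
Lemma moll_centered (g : 'cV[R]_n -> R) x : measurable_fun setT g ->
  moll g x = bump_mass^-1 * \int[mu]_w (g w * eta (w - x)).
Proof.
move=> mg; congr (_ * _).
rewrite -(Rintegral_translate x (f := fun w => g w * eta (w - x))).
  by apply: eq_Rintegral => u _; rewrite addrK addrC.
by apply: measurable_funM => //; apply: measurable_shift; exact: measurable_bump.
Qed.

(** Linearity of mollification. It lets the contraction estimate act on the components of the
    projected gradient rather than on all partial derivatives. *)
Lemma dot_moll_grad (a x : 'cV[R]_n) : S x -> 0 < rho x ->
  dot a (moll_grad x) = moll (fun w => \sum_i a i ord0 * D i w) x.
Proof.
move=> Sx rx; rewrite /dot.
under eq_bigr do rewrite mxE /moll mulrCA.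
rewrite -mulr_sumr; congr (_ * _).
have Ii i : mu.-integrable setT (fun u => (D i (x + u)%R * eta u)%:E).
  exact: integrable_partial_bump.
rewrite (eq_bigr (fun i => \int[mu]_u (a i ord0 * (D i (x + u) * eta u)))); last first.
  by move=> i _; rewrite RintegralZl//; exact: Ii.
rewrite -Rintegral_sum.
  apply: eq_Rintegral => u _; rewrite mulr_suml; apply: eq_bigr => i _.
  by rewrite mulrA.
by move=> i; exact: (integrableZl measurableT (a i ord0) (Ii i)).
Qed.

(** Differentiation under the integral sign, the bump carrying all dependence on the time, followed
    by integration by parts at the single time [t0]. The chain rule is thus obtained directly along
    the curve, without Frechet differentiability. *)
Lemma is_derive_moll_path (g g' : R -> 'cV[R]_n) (a b B t0 : R) :
  (forall t, a < t < b -> norm2 (g t) <= B /\ norm2 (g' t) <= B) ->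
  (forall t i, a < t < b -> is_derive t 1 (fun t => g t i ord0) (g' t i ord0)) ->
  a < t0 < b -> S (g t0) -> 0 < rho (g t0) ->
  is_derive t0 1 (fun t => moll f (g t)) (dot (g' t0) (moll_grad (g t0))).
Proof.
move=> gB dg t0ab Sg rg.
have B0 : 0 <= B by case: (gB t0 t0ab) => h _; exact: le_trans (norm2_ge0 _) h.
pose phi t w := f w * eta (w - g t).
pose dphi t w := f w * (@dmollifier R n delta (w - g t) * dot (w - g t) (g' t)).
have M0 : 0 <= M by exact: le_trans (normr_ge0 _) (fM 0).
have dphiE t w : a < t < b -> is_derive t 1 (phi^~ w) (dphi t w).
  move=> tab; have d1 := @is_derive_mollifier_path R n delta g g' w t (fun i => dg t i tab).
  rewrite (_ : phi^~ w = f w \*: (fun t => eta (w - g t)))//.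
  exact: (is_derive_eq (is_deriveZ (f w) d1)).
have far w t : a < t < b -> B + delta < norm2 w -> delta <= norm2 (w - g t).
  move=> /gB[gt _] wB; have := norm2D (w - g t) (g t); rewrite subrK; lra.
have d1E t w : a < t < b -> partial1of2 phi t w = dphi t w.
  by move=> /(dphiE t w) d; rewrite partial1of2E; exact: derive_val.
(* The factors bound [f], [dmollifier], [w - g t] on the support of the bump, and [g' t], in this
   order. *)
pose C := M * (4 * delta ^+ 2 * (delta * B)).
have C0 : 0 <= C by rewrite /C !mulr_ge0// ?sqr_ge0// ltW.
have dphiC t w : a < t < b -> `|dphi t w| <= C.
  move=> tab; rewrite /dphi /C normrM ler_pM// normrM.
  have [dw|wd] := leP delta (norm2 (w - g t)).
    by rewrite dmollifier_eq0// normr0 mul0r !mulr_ge0// ?sqr_ge0// ltW.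
  apply: ler_pM => //; first by rewrite ger0_norm ?dmollifier_ge0// dmollifier_le.
  have [_ g'B] := gB t tab.
  rewrite -(ler_pXn2r (n := 2))// ?nnegrE; last by apply: mulr_ge0 => //; exact: ltW.
  rewrite real_normK ?num_real// (le_trans (dot_sqr_le _ _))// exprMn.
  apply: ler_pM; rewrite ?sqr_ge0// ler_pXn2r ?nnegrE ?norm2_ge0//; exact: ltW.
have dphi0 t w : a < t < b -> B + delta < norm2 w -> dphi t w = 0.
  by move=> tab /(far w t tab) h; rewrite /dphi dmollifier_eq0// mul0r mulr0.
have mphi t : measurable_fun setT (phi t).
  by apply: measurable_funM => //; apply: measurable_shift; exact: measurable_bump.
(* While the curve stays in the ball of radius [B], every integrand is supported in the ball of
   radius [B + delta], so a constant on that ball dominates. *)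
pose G (w : 'cV[R]_n) : R := C * \1_(euclidean_ball (B + delta)) w.
have mG : measurable_fun setT G.
  by apply: measurable_funM => //; apply: measurable_indic; exact: measurable_euclidean_ball.
have IG : mu.-integrable setT (EFin \o G).
  apply: (@integrable_bounded_support _ C (B + delta)) => //.
  - move=> u; rewrite /G normrM (ger0_norm C0) ger0_norm// indicE.
    by rewrite -[leRHS]mulr1 ler_wpM2l// lern1 leq_b1.
  - move=> u; rewrite ltNge => /negP h; rewrite /G indicE memNset ?mulr0//.
have Iphi t : a < t < b -> mu.-integrable setT (EFin \o phi t).
  move=> tab; apply: (@integrable_bounded_support _ (M * delta ^+ 4) (B + delta)) => //.
    by move=> u; rewrite normrM ler_pM// ger0_norm ?bump_ge0// bump_le.
  by move=> u /(far u t tab) h; rewrite /phi bump_eq0// mulr0.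
have It0 : `]a, b[%classic t0 by rewrite /= in_itv.
have Hab t : `]a, b[%classic t -> a < t < b by rewrite /= in_itv.
have G0 w : 0 <= G w by rewrite mulr_ge0.
have GC t w : `]a, b[%classic t -> setT w -> `|partial1of2 phi t w| <= G w.
  move=> /Hab tab _; rewrite d1E// /G indicE.
  have [h|h] := leP (norm2 w) (B + delta).
    by rewrite mem_set// mulr1 dphiC.
  by rewrite dphi0// normr0 mulr_ge0.
have dI := @derivable_under_integral R _ _ mu phi setT measurableT t0 a b It0
  (fun t h => Iphi t (Hab t h)) (fun t w h _ => @ex_derive _ _ _ _ _ _ _ (dphiE t w (Hab t h)))
  G G0 IG GC.
have vI := @differentiation_under_integral R _ _ mu phi setT measurableT t0 a b It0
  (fun t h => Iphi t (Hab t h)) (fun t w h _ => @ex_derive _ _ _ _ _ _ _ (dphiE t w (Hab t h)))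
  G G0 IG GC.
have dPhi : is_derive t0 1 (fun t => \int[mu]_w phi t w) (\int[mu]_w dphi t0 w).
  apply: DeriveDef => //; rewrite -derive1E vI.
  by apply: eq_Rintegral => w _; rewrite d1E.
rewrite (_ : (fun t => moll f (g t)) = bump_mass^-1 \*: (fun t => \int[mu]_w phi t w)); last first.
  by apply/funext => t; rewrite moll_centered.
apply: (is_derive_eq (is_deriveZ bump_mass^-1 dPhi)).
rewrite /dot.
under [RHS]eq_bigr do rewrite mxE moll_centered// mulrCA.
rewrite -mulr_sumr; congr (_ * _).
under [RHS]eq_bigr do rewrite integral_partial_bump//.
have Id i := integrable_mul_dmollifier i (g t0).
rewrite [RHS](eq_bigr (fun i => \int[mu]_w (g' t0 i ord0 *
  (f w * (@dmollifier R n delta (w - g t0) * (w - g t0) i ord0))))); last first.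
  by move=> i _; rewrite RintegralZl//; exact: Id.
rewrite -Rintegral_sum.
  apply: eq_Rintegral => w _; rewrite /dphi /dot !mulr_sumr.
  by apply: eq_bigr => i _; ring.
by move=> i; exact: (integrableZl measurableT (g' t0 i ord0) (Id i)).
Qed.

End paths.

End mollification.

(** * Poincare inequalities on a slice *)

Section slices.
Context {R : realType} (m : nat).
Local Notation mu := (@lebesgue_vec R m).
Implicit Types (phi G : 'cV[R]_m -> R).

Lemma ge0_integral_affine (s : R) (v : 'cV[R]_m) (H : 'cV[R]_m -> \bar R) : 0 < s ->
  measurable_fun setT H -> (forall z, (0 <= H z)%E) ->
  (\int[mu]_z H (s *: z + v)%R = (s ^- m)%:E * \int[mu]_z H z)%E.
Proof.
move=> s0 mH H0.
have mHv : measurable_fun setT (fun z : 'cV[R]_m => H (z + v)).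
  by apply: (measurableT_comp mH); exact: measurable_addmx.
rewrite (ge0_integral_scale s0 mHv)//.
by rewrite (ge0_integral_translate v mH H0).
Qed.

(** For fixed [z'] and [t] the substitution z -> (1 - t) z + t z' has Jacobian (1 - t)^m, at least
    2^-m up to the midpoint; near t = 1 it would degenerate. *)
Lemma uniform_slice_half (K : set 'cV[R]_m) phi G (d : R) :
  measurable K -> measurable_fun setT phi -> measurable_fun setT G ->
  (forall z, 0 <= G z) -> 0 <= d ->
  (forall z z' t, K z -> K z' -> 0 <= t <= 1 -> K ((1 - t) *: z + t *: z')) ->
  (forall z z', K z -> K z' -> norm2 (z' - z) <= d) ->
  (forall z z', K z -> K z' ->
    (((phi (2^-1 *: z + 2^-1 *: z')%R - phi z) ^+ 2)%:E <=
     (2^-1)%:E * \int[@lebesgue_measure R]_(t in `[0%R, 2^-1%R])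
        (G ((1 - t) *: z + t *: z')%R * norm2 (z' - z)%R ^+ 2)%:E)%E) ->
  (\int[mu]_(z' in K) \int[mu]_(z in K) ((phi (2^-1 *: z + 2^-1 *: z')%R - phi z) ^+ 2)%:E <=
   (d ^+ 2 * 2 ^+ m)%:E * (mu K * \int[mu]_(z in K) (G z)%:E))%E.
Proof.
move=> mK mphi mG G0 d0 cK dK path.
have mI := @measurable_itv R `[0, 2^-1].
have mp z' : measurable_fun (setT : set ('cV[R]_m * measurableTypeR R))
    (fun p => (1 - p.2) *: p.1 + p.2 *: z').
  apply: measurable_addmx.
    by apply: measurable_scalemx => //; exact: measurable_funB.
  by apply: (measurable_scalemx (f := cst z')).
(* Convexity keeps the path in [K], so the cut-off loses nothing there, and it permits the
   substitution over the whole space. *)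
pose GK z := G z * \1_K z.
have mGK : measurable_fun setT GK.
  by apply: measurable_funM => //; exact: measurable_indic.
have GK0 z : 0 <= GK z by rewrite /GK mulr_ge0.
pose B := (\int[mu]_(z in K) (G z)%:E)%E.
have BE : B = (\int[mu]_z (GK z)%:E)%E.
  rewrite /B integral_mkcond; apply: eq_integral => z _.
  by rewrite patchE /GK indicE; case: ifP => _; rewrite ?mulr1 ?mulr0.
have B0 : (0 <= B)%E by apply: integral_ge0 => z _; rewrite lee_fin.
have c0 : 0 <= d ^+ 2 * 2 ^+ m by rewrite mulr_ge0 ?sqr_ge0 ?exprn_ge0.
have key z' : K z' ->
    (\int[mu]_(z in K) ((phi (2^-1 *: z + 2^-1 *: z')%R - phi z) ^+ 2)%:E <=
     (d ^+ 2 * 2 ^+ m)%:E * B)%E.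
  move=> Kz'.
  have mGp : measurable_fun (setT : set ('cV[R]_m * measurableTypeR R))
      (fun p => (GK ((1 - p.2) *: p.1 + p.2 *: z'))%:E).
    by apply/measurable_EFinP; exact: (measurableT_comp mGK (mp z')).
  have GKp0 (p : 'cV[R]_m * measurableTypeR R) : (0 <= (GK ((1 - p.2) *: p.1 + p.2 *: z')%R)%:E)%E.
    by rewrite lee_fin.
  have d20 : (0 <= (d ^+ 2)%:E)%E by rewrite lee_fin sqr_ge0.
  have mFz : measurable_fun setT (fun z : 'cV[R]_m => \int[@lebesgue_measure R]_(t in `[0%R, 2^-1%R])
      (GK ((1 - t) *: z + t *: z')%R)%:E)%E.
    apply: (@measurable_fubini_domain _ _ 'cV[R]_m (measurableTypeR R) R (@lebesgue_measure R) _
      (fun p => (GK ((1 - p.2) *: p.1 + p.2 *: z'))%:E)) => //.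
    exact: measurable_funTS.
  apply: (@le_trans _ _ (\int[mu]_(z in K) ((d ^+ 2)%:E *
      \int[@lebesgue_measure R]_(t in `[0%R, 2^-1%R]) (GK ((1 - t) *: z + t *: z')%R)%:E))%E).
    apply: ge0_le_integral => //.
    - by move=> z _; rewrite lee_fin sqr_ge0.
    - apply: measurable_funTS; apply/measurable_EFinP; apply: measurable_funX.
      apply: measurable_funB => //; apply: (measurableT_comp mphi).
      apply: measurable_addmx => //.
      by apply: (measurable_scalemx (s := cst 2^-1)).
    - by apply: measurable_funTS; exact: measurable_funeM.
    - move=> z Kz; apply: (le_trans (path z z' Kz Kz')).
      have mGz : measurable_fun (`[0, 2^-1]%classic : set (measurableTypeR R))
          (fun t => (GK ((1 - t) *: z + t *: z'))%:E).
        apply: measurable_funTS.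
        exact: (measurableT_comp mGp (pair1_measurable z)).
      rewrite -(@ge0_integralZl _ _ R (@lebesgue_measure R) _ mI _ mGz _ _ d20)//; last first.
        by move=> t _; rewrite lee_fin.
      apply: (@le_trans _ _ (\int[@lebesgue_measure R]_(t in `[0%R, 2^-1%R])
        (G ((1 - t) *: z + t *: z')%R * norm2 (z' - z)%R ^+ 2)%:E)%E).
        rewrite -[leRHS]mul1e; apply: lee_wpmul2r.
          by apply: integral_ge0 => t _; rewrite lee_fin mulr_ge0 ?sqr_ge0.
        by rewrite lee_fin invf_le1// ler1n.
      apply: ge0_le_integral => //.
      + by move=> t _; rewrite lee_fin mulr_ge0 ?sqr_ge0.
      + apply: measurable_funTS; apply/measurable_EFinP; apply: measurable_funM => //.
        exact: (measurableT_comp (measurableT_comp mG (mp z')) (pair1_measurable z)).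
      + exact: measurable_funeM.
      + move=> t; rewrite /= in_itv/= => /andP[t0 t1].
        have t01 : 0 <= t <= 1 by rewrite t0 (le_trans t1)// invf_le1// ler1n.
        rewrite -EFinM lee_fin /GK indicE mem_set ?mulr1; last exact: cK.
        rewrite mulrC; apply: ler_wpM2r => //.
        by rewrite ler_pXn2r ?nnegrE ?norm2_ge0//; exact: dK.
  rewrite (ge0_integralZl mu mK (measurable_funTS mFz) _ d20); last first.
    by move=> z _; apply: integral_ge0 => t _; exact: (GKp0 (z, t)).
  rewrite (EFinM (d ^+ 2)) -muleA; apply: lee_wpmul2l => //.
  rewrite (@fubini_tonelli_domains _ _ _ _ R mu (@lebesgue_measure R) K `[0, 2^-1]
    (fun p => (GK ((1 - p.2) *: p.1 + p.2 *: z')%R)%:E))//; last exact: measurable_funTS.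
  have m0 : (0 <= (2 ^+ m : R)%:E * B)%E by rewrite mule_ge0// lee_fin exprn_ge0.
  apply: (@le_trans _ _ (\int[@lebesgue_measure R]_(t in `[0%R, 2^-1%R])
      cst ((2 ^+ m)%:E * B) t)%E); last first.
    rewrite integral_cst//= lebesgue_measure_itv/= lte_fin invr_gt0 ltr0n/=.
    rewrite -EFinD subr0 -[leRHS]mule1; apply: lee_wpmul2l => //.
    by rewrite lee_fin invf_le1// ler1n.
  apply: ge0_le_integral => //.
  - by move=> t _; apply: integral_ge0 => z _; exact: (GKp0 (z, t)).
  - apply: measurable_funTS.
    apply: (@measurable_fubini_domain _ _ (measurableTypeR R) _ R mu K
      (fun p => (GK ((1 - p.1) *: p.2 + p.1 *: z')%R)%:E)) => //; last first.
      by move=> p; exact: (GKp0 (p.2, p.1)).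
    apply: measurable_funTS.
    exact: (measurableT_comp mGp (@measurable_swap _ _ _ _)).
  - move=> t; rewrite /= in_itv/= => /andP[t0 t1].
    have s2 : 2^-1 <= 1 - t by lra.
    have s0 : 0 < 1 - t by lra.
    have mGKe : measurable_fun setT (fun z => (GK z)%:E) by exact/measurable_EFinP.
    have mGKa : measurable_fun setT (fun z : 'cV[R]_m => (GK ((1 - t) *: z + t *: z'))%:E).
      exact: (measurableT_comp mGp (pair2_measurable (t : measurableTypeR R))).
    apply: (@le_trans _ _ (\int[mu]_z (GK ((1 - t) *: z + t *: z')%R)%:E)%E).
      by apply: ge0_subset_integral => // z _; rewrite lee_fin.
    rewrite (ge0_integral_affine (t *: z') s0 mGKe); last by move=> z; rewrite lee_fin.
    rewrite -BE; apply: lee_wpmul2r => //; rewrite lee_fin -exprVn.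
    apply: lerXn2r; rewrite ?nnegrE ?invr_ge0 ?(ltW s0)//.
    by rewrite -[leRHS]invrK lef_pV2// posrE invr_gt0.
rewrite [(mu K * _)%E]muleC muleA -/B -(integral_cst mu mK).
apply: ge0_le_integral => //.
- by move=> z' _; apply: integral_ge0 => z _; rewrite lee_fin sqr_ge0.
- apply: measurable_funTS.
  apply: (@measurable_fubini_domain _ _ _ _ R mu K
    (fun p : 'cV[R]_m * 'cV[R]_m => ((phi (2^-1 *: p.2 + 2^-1 *: p.1)%R - phi p.2) ^+ 2)%:E)) => //.
    apply: measurable_funTS; apply/measurable_EFinP; apply: measurable_funX.
    apply: measurable_funB; last exact: measurableT_comp.
    apply: (measurableT_comp mphi); apply: measurable_addmx.
      by apply: (measurable_scalemx (s := cst 2^-1)).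
    by apply: (measurable_scalemx (s := cst 2^-1)).
  by move=> p; rewrite lee_fin sqr_ge0.
Qed.

Lemma sqrD_le (a b : R) : (a + b) ^+ 2 <= 2 * (a ^+ 2 + b ^+ 2).
Proof. by have := sqr_ge0 (a - b); rewrite sqrrB sqrrD; lra. Qed.

(** The increment passes through the midpoint, which is symmetric in the two points, so both
    half-increments have the same double integral. One factor 2 comes from (a + b)^2 <= 2 (a^2 +
    b^2), the other from the two halves. *)
Lemma uniform_slice (K : set 'cV[R]_m) phi G (d : R) :
  measurable K -> measurable_fun setT phi -> measurable_fun setT G ->
  (forall z, 0 <= G z) -> 0 <= d ->
  (forall z z' t, K z -> K z' -> 0 <= t <= 1 -> K ((1 - t) *: z + t *: z')) ->
  (forall z z', K z -> K z' -> norm2 (z' - z) <= d) ->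
  (forall z z', K z -> K z' ->
    (((phi (2^-1 *: z + 2^-1 *: z')%R - phi z) ^+ 2)%:E <=
     (2^-1)%:E * \int[@lebesgue_measure R]_(t in `[0%R, 2^-1%R])
        (G ((1 - t) *: z + t *: z')%R * norm2 (z' - z)%R ^+ 2)%:E)%E) ->
  (\int[mu]_(z in K) \int[mu]_(z' in K) ((phi z' - phi z) ^+ 2)%:E <=
   (4 * (d ^+ 2 * 2 ^+ m))%:E * (mu K * \int[mu]_(z in K) (G z)%:E))%E.
Proof.
move=> mK mphi mG G0 d0 cK dK path.
have half := uniform_slice_half mK mphi mG G0 d0 cK dK path.
pose Phi (p : 'cV[R]_m * 'cV[R]_m) : \bar R :=
  ((phi (2^-1 *: p.1 + 2^-1 *: p.2)%R - phi p.1) ^+ 2)%:E.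
have mPhi : measurable_fun setT Phi.
  apply/measurable_EFinP; apply: measurable_funX.
  apply: measurable_funB; last exact: measurableT_comp.
  apply: (measurableT_comp mphi); apply: measurable_addmx.
    by apply: (measurable_scalemx (s := cst 2^-1)).
  by apply: (measurable_scalemx (s := cst 2^-1)).
have Phi0 p : (0 <= Phi p)%E by rewrite lee_fin sqr_ge0.
have mPhis : measurable_fun setT (fun p => Phi (p.2, p.1)).
  exact: (measurableT_comp mPhi (@measurable_swap _ _ _ _)).
pose I := (\int[mu]_(z' in K) \int[mu]_(z in K) Phi (z, z'))%E.
have I0 : (0 <= I)%E by do 2 (apply: integral_ge0 => ? _).
have IE : (I = \int[mu]_(z in K) \int[mu]_(z' in K) Phi (z, z'))%E.
  by rewrite (@fubini_tonelli_domains _ _ _ _ R mu mu K K Phi)//; exact: measurable_funTS.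
have m1 : measurable_fun setT (fun z => \int[mu]_(z' in K) Phi (z, z'))%E.
  apply: (@measurable_fubini_domain _ _ _ _ R mu K Phi) => //.
  exact: measurable_funTS.
have m2 : measurable_fun setT (fun z => \int[mu]_(z' in K) Phi (z', z))%E.
  apply: (@measurable_fubini_domain _ _ _ _ R mu K (fun p => Phi (p.2, p.1))) => //.
  exact: measurable_funTS.
have Phiz z : measurable_fun K (fun z' => Phi (z, z')).
  by apply: measurable_funTS; exact: (measurableT_comp mPhi (pair1_measurable z)).
have Phiz' z : measurable_fun K (fun z' => Phi (z', z)).
  by apply: measurable_funTS; exact: (measurableT_comp mPhi (pair2_measurable z)).
have two0 : (0 <= (2 : R)%:E)%E by rewrite lee_fin.
apply: (@le_trans _ _ (2%:E * (I + I))%E); last first.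
  rewrite (EFinM 4) (_ : (4 : R) = 2 * 2); last by ring.
  rewrite (EFinM 2) -!muleA; apply: lee_wpmul2l => //.
  have -> : (I + I = 2%:E * I)%E by rewrite -mule2n mule_natl.
  by apply: lee_wpmul2l.
rewrite {1}IE /I; clear half path IE cK dK.
rewrite -ge0_integralD//; last 4 first.
- by move=> z _; apply: integral_ge0.
- exact: measurable_funTS.
- by move=> z _; apply: integral_ge0.
- exact: measurable_funTS.
rewrite -(ge0_integralZl mu mK _ _ two0); last 2 first.
- by apply: emeasurable_funD; exact: measurable_funTS.
- by move=> z _; apply: adde_ge0; apply: integral_ge0.
have mB : measurable_fun setT (fun p : 'cV[R]_m * 'cV[R]_m => ((phi p.2 - phi p.1) ^+ 2)%:E).
  by apply/measurable_EFinP; apply: measurable_funX; apply: measurable_funB; exact: measurableT_comp.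
apply: ge0_le_integral => //.
- by move=> z _; apply: integral_ge0 => z' _; rewrite lee_fin sqr_ge0.
- apply: measurable_funTS.
  apply: (@measurable_fubini_domain _ _ _ _ R mu K
     (fun p : 'cV[R]_m * 'cV[R]_m => ((phi p.2 - phi p.1) ^+ 2)%:E)) => //.
    exact: measurable_funTS.
  by move=> p; rewrite lee_fin sqr_ge0.
- apply: measurable_funTS; apply: measurable_funeM.
  exact: emeasurable_funD.
- move=> z _.
  rewrite -ge0_integralD// -(ge0_integralZl mu mK _ _ two0); last 2 first.
  + by apply: emeasurable_funD.
  + by move=> z' _; rewrite adde_ge0.
  apply: ge0_le_integral => //.
  + by move=> z' _; rewrite lee_fin sqr_ge0.
  + by apply: measurable_funTS; exact: (measurableT_comp mB (pair1_measurable z)).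
  + by apply: measurable_funeM; exact: emeasurable_funD.
  + move=> z' _; rewrite /Phi /= -EFinD -EFinM lee_fin.
    rewrite [X in phi (X) - phi z']addrC.
    set a := phi (_ + _).
    have := sqrD_le (a - phi z) (phi z' - a).
    by rewrite -(sqrrN (a - phi z')) opprB; congr (_ <= _); congr (_ ^+ 2); ring.
Qed.

(** Rotating a pair of vectors is the orthogonal matrix with four scalar blocks acting on the
    stacked vector, a case of [ge0_integral_hblock]. *)
Lemma ge0_integral_rotation (t : R) (F : 'cV[R]_m * 'cV[R]_m -> \bar R) :
  measurable_fun setT F -> (forall p, (0 <= F p)%E) ->
  (\int[mu]_z \int[mu]_z' F (cos t *: z + sin t *: z', - sin t *: z + cos t *: z')%R =
   \int[mu]_z \int[mu]_z' F (z, z'))%E.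
Proof.
move=> mF F0.
pose W1 : 'M[R]_(m + m, m) := col_mx (cos t)%:M (- sin t)%:M.
pose W2 : 'M[R]_(m + m, m) := col_mx (sin t)%:M (cos t)%:M.
pose f (x : 'cV[R]_(m + m)) : \bar R := F (usubmx x, dsubmx x).
have mf : measurable_fun setT f.
  apply: (measurableT_comp mF); apply/measurable_fun_pair;
  apply/measurable_fun_mxP => // i j; under eq_fun do rewrite mxE; exact: measurable_coord.
have oW : orthogonal_mx (hblock_mx (erefl (m + m)%N) W1 W2).
  rewrite /orthogonal_mx /hblock_mx castmx_id tr_row_mx mul_col_row.
  rewrite /W1 /W2 !tr_col_mx !tr_scalar_mx !mul_row_col -!scalar_mxM -!raddfD/=.
  rewrite mulrNN -!expr2 cos2Dsin2 [sin t ^+ 2 + _]addrC cos2Dsin2.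
  rewrite mulNr mulrC addrN [sin t * cos t]mulrC mulrN addrN.
  by rewrite raddf0 -scalar_mx_block.
have := ge0_integral_hblock oW mf (fun x => F0 _).
rewrite -(ge0_integral_col_mx mf (fun x => F0 _)).
rewrite /f.
under eq_integral do under eq_integral do rewrite /W1 /W2 !mul_col_mx !mul_scalar_mx add_col_mx col_mxKu col_mxKd.
under [X in _ = X -> _]eq_integral do under eq_integral do rewrite col_mxKu col_mxKd.
by [].
Qed.

Lemma norm2_rotation (t : R) (z z' : 'cV[R]_m) :
  norm2 (cos t *: z + sin t *: z') ^+ 2 + norm2 (- sin t *: z + cos t *: z') ^+ 2 =
  norm2 z ^+ 2 + norm2 z' ^+ 2.
Proof.
rewrite !norm2_sqr -!big_split/=; apply: eq_bigr => i _; rewrite !mxE.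
have cs := cos2Dsin2 t.
rewrite (_ : _ + _ = (cos t ^+ 2 + sin t ^+ 2) * (z i ord0 ^+ 2 + z' i ord0 ^+ 2)); last by ring.
by rewrite cs mul1r.
Qed.

(** The velocity - sin t z + cos t z' is the second coordinate of the rotated pair whose first
    coordinate is the position. A weight in |z|^2 + |z'|^2 is invariant, so every time contributes
    the same integral. One factor pi / 2 comes from Cauchy-Schwarz in time, the other from the
    length of the time interval. The profile [k] is general so that it can include a cut-off. *)
Lemma gaussian_slice phi G (k : R -> R) :
  measurable_fun setT phi -> measurable_fun setT G -> measurable_fun setT k ->
  (forall z, 0 <= G z) -> (forall q, 0 <= k q) ->
  (forall z z', 0 < k (norm2 z ^+ 2 + norm2 z' ^+ 2) ->
    (((phi z' - phi z) ^+ 2)%:E <= (pi / 2)%:E *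
      \int[@lebesgue_measure R]_(t in `[0%R, (pi / 2)%R])
        (G (cos t *: z + sin t *: z')%R * norm2 (- sin t *: z + cos t *: z')%R ^+ 2)%:E)%E) ->
  (\int[mu]_z \int[mu]_z' (k (norm2 z ^+ 2 + norm2 z' ^+ 2)%R * (phi z' - phi z) ^+ 2)%:E <=
   ((pi / 2) ^+ 2)%:E *
     \int[mu]_z \int[mu]_z' (k (norm2 z ^+ 2 + norm2 z' ^+ 2)%R * (G z * norm2 z' ^+ 2))%:E)%E.
Proof.
move=> mphi mG mk G0 k0 path.
have p20 : 0 < pi / 2 :> R by rewrite divr_gt0// pi_gt0.
have p20E : (0 <= (pi / 2 : R)%:E)%E by rewrite lee_fin ltW.
pose Q (p : 'cV[R]_m * 'cV[R]_m) := norm2 p.1 ^+ 2 + norm2 p.2 ^+ 2.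
have mn2 : measurable_fun setT (fun z : 'cV[R]_m => norm2 z ^+ 2).
  by apply: measurable_funX; exact: measurable_norm2.
have mQ : measurable_fun setT Q.
  by apply: measurable_funD; exact: (measurableT_comp mn2).
pose Phi p : R := k (Q p) * (G p.1 * norm2 p.2 ^+ 2).
have mPhi : measurable_fun setT Phi.
  apply: measurable_funM; first exact: (measurableT_comp mk mQ).
  by apply: measurable_funM; [exact: (measurableT_comp mG)|exact: (measurableT_comp mn2)].
have Phi0 p : 0 <= Phi p by rewrite /Phi; apply: mulr_ge0 => //; apply: mulr_ge0 => //; exact: sqr_ge0.
pose rot (q : ('cV[R]_m * 'cV[R]_m) * measurableTypeR R) : 'cV[R]_m * 'cV[R]_m :=
  (cos q.2 *: q.1.1 + sin q.2 *: q.1.2, - sin q.2 *: q.1.1 + cos q.2 *: q.1.2).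
have mcos : measurable_fun setT (fun q : ('cV[R]_m * 'cV[R]_m) * measurableTypeR R => cos q.2 : R).
  by apply: (measurableT_comp (continuous_measurable_fun (@continuous_cos R))).
have msin : measurable_fun setT (fun q : ('cV[R]_m * 'cV[R]_m) * measurableTypeR R => sin q.2 : R).
  by apply: (measurableT_comp (continuous_measurable_fun (@continuous_sin R))).
have mz1 : measurable_fun setT (fun q : ('cV[R]_m * 'cV[R]_m) * measurableTypeR R => q.1.1).
  exact: (measurableT_comp measurable_fst measurable_fst).
have mz2 : measurable_fun setT (fun q : ('cV[R]_m * 'cV[R]_m) * measurableTypeR R => q.1.2).
  exact: (measurableT_comp measurable_snd measurable_fst).
have mrot : measurable_fun setT rot.
  apply/measurable_fun_pair; apply: measurable_addmx; apply: measurable_scalemx => //.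
  exact: measurableT_comp.
pose Psi q : \bar R := (Phi (rot q))%:E.
have mPsi : measurable_fun setT Psi.
  by apply/measurable_EFinP; exact: (measurableT_comp mPhi mrot).
have Psi0 q : (0 <= Psi q)%E by rewrite lee_fin.
have mI := @measurable_itv R `[0, pi / 2].
have mpz (z : 'cV[R]_m) : measurable_fun setT
    (fun p : 'cV[R]_m * measurableTypeR R => Psi ((z, p.1), p.2)).
  apply: (measurableT_comp mPsi); apply/measurable_fun_pair => //.
  by apply/measurable_fun_pair.
have mF1 : measurable_fun setT (fun p => \int[@lebesgue_measure R]_(t in `[0%R, (pi / 2)%R]) Psi (p, t))%E.
  apply: (@measurable_fubini_domain _ _ ('cV[R]_m * 'cV[R]_m)%type (measurableTypeR R) R
    (@lebesgue_measure R) _ Psi) => //.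
  exact: measurable_funTS.
have F10 p : (0 <= \int[@lebesgue_measure R]_(t in `[0%R, (pi / 2)%R]) Psi (p, t))%E.
  by apply: integral_ge0 => t _.
have mF2 : measurable_fun setT (fun p : 'cV[R]_m * measurableTypeR R =>
    \int[mu]_z' Psi ((p.1, z'), p.2))%E.
  apply: (@measurable_fubini_domain _ _ ('cV[R]_m * measurableTypeR R)%type _ R mu setT
    (fun q : ('cV[R]_m * measurableTypeR R) * 'cV[R]_m => Psi ((q.1.1, q.2), q.1.2))) => //.
  apply: measurable_funTS; apply: (measurableT_comp mPsi); apply/measurable_fun_pair.
    apply/measurable_fun_pair => //.
    exact: (measurableT_comp measurable_fst measurable_fst).
  exact: (measurableT_comp measurable_snd measurable_fst).
have F20 (p : 'cV[R]_m * measurableTypeR R) : (0 <= \int[mu]_z' Psi ((p.1, z'), p.2))%E.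
  by apply: integral_ge0.
pose L p : R := k (Q p) * (phi p.2 - phi p.1) ^+ 2.
have mL : measurable_fun setT L.
  apply: measurable_funM; first exact: (measurableT_comp mk mQ).
  by apply: measurable_funX; apply: measurable_funB; exact: (measurableT_comp mphi).
have L0 p : 0 <= L p by rewrite /L mulr_ge0 ?sqr_ge0.
have pt p : ((L p)%:E <= (pi / 2)%:E *
    \int[@lebesgue_measure R]_(t in `[0%R, (pi / 2)%R]) Psi (p, t))%E.
  have := k0 (Q p); rewrite le_eqVlt => /predU1P[kE|kp].
    by rewrite /L -kE mul0r mule_ge0.
  have kpE : (0 <= (k (Q p))%:E)%E by rewrite lee_fin ltW.
  rewrite /L EFinM.
  apply: (@le_trans _ _ ((k (Q p))%:E * ((pi / 2)%:E *
    \int[@lebesgue_measure R]_(t in `[0%R, (pi / 2)%R])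
    (G (cos t *: p.1 + sin t *: p.2)%R * norm2 (- sin t *: p.1 + cos t *: p.2)%R ^+ 2)%:E))%E).
    by apply: lee_wpmul2l => //; exact: path.
  rewrite muleCA; apply: lee_wpmul2l => //.
  have mt : measurable_fun (`[0, pi / 2]%classic : set (measurableTypeR R)) (fun t =>
      (G (cos t *: p.1 + sin t *: p.2)%R * norm2 (- sin t *: p.1 + cos t *: p.2)%R ^+ 2)%:E).
    apply: measurable_funTS; apply/measurable_EFinP; apply: measurable_funM.
      apply: (measurableT_comp mG).
      exact: (measurableT_comp measurable_fst (measurableT_comp mrot (pair1_measurable p))).
    apply: (measurableT_comp mn2).
    exact: (measurableT_comp measurable_snd (measurableT_comp mrot (pair1_measurable p))).
  rewrite -(@ge0_integralZl _ _ R (@lebesgue_measure R) _ mI _ mt _ _ kpE); last first.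
    by move=> t _; rewrite lee_fin mulr_ge0 ?sqr_ge0.
  rewrite le_eqVlt; apply/orP; left; apply/eqP; apply: eq_integral => t _.
  by rewrite /Psi /Phi /rot /= /Q /= norm2_rotation EFinM.
clear path.
have mLe : measurable_fun setT (fun p => (L p)%:E) by exact/measurable_EFinP.
pose F1 p := (\int[@lebesgue_measure R]_(t in `[0%R, (pi / 2)%R]) Psi (p, t))%E.
have mcF1 : measurable_fun setT (fun p => (pi / 2)%:E * F1 p)%E by exact: measurable_funeM.
have F1_0 p : (0 <= F1 p)%E by exact: F10.
have cF10 p : (0 <= (pi / 2)%:E * F1 p)%E by exact: mule_ge0.
apply: (@le_trans _ _ (\int[mu]_z \int[mu]_z' ((pi / 2)%:E * F1 (z, z')))%E).
  apply: ge0_le_integral => //.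
  - by move=> z _; apply: integral_ge0 => z' _; rewrite lee_fin; exact: (L0 (z, z')).
  - apply: (@measurable_fubini_domain _ _ _ _ R mu setT (fun p => (L p)%:E)) => //.
    exact: measurable_funTS.
  - apply: (@measurable_fubini_domain _ _ _ _ R mu setT (fun p => (pi / 2)%:E * F1 p)%E) => //.
    exact: measurable_funTS.
  - move=> z _; apply: ge0_le_integral => //.
    + by move=> z' _; rewrite lee_fin; exact: (L0 (z, z')).
    + exact: (measurableT_comp mLe (pair1_measurable z)).
    + exact: (measurableT_comp mcF1 (pair1_measurable z)).
    + by move=> z' _; exact: (pt (z, z')).
have E1 : (\int[mu]_z \int[mu]_z' ((pi / 2)%:E * F1 (z, z')) =
    (pi / 2)%:E * \int[mu]_z \int[mu]_z' F1 (z, z'))%E.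
  have mF1z : measurable_fun setT (fun z => \int[mu]_z' F1 (z, z'))%E.
    apply: (@measurable_fubini_domain _ _ _ _ R mu setT F1) => //.
    exact: measurable_funTS.
  rewrite -(ge0_integralZl mu measurableT mF1z _ p20E); last first.
    by move=> z _; apply: integral_ge0 => z' _; exact: F1_0.
  apply: eq_integral => z _.
  have mF1zz : measurable_fun setT (fun z' => F1 (z, z')).
    exact: (measurableT_comp mF1 (pair1_measurable z)).
  rewrite -(ge0_integralZl mu measurableT mF1zz _ p20E)// => z' _; exact: F1_0.
rewrite E1 (expr2 (pi / 2)) (EFinM (pi / 2) (pi / 2)) -muleA; apply: lee_wpmul2l => //.
have E2 : (\int[mu]_z \int[mu]_z' F1 (z, z') =
    \int[mu]_z \int[@lebesgue_measure R]_(t in `[0%R, (pi / 2)%R]) \int[mu]_z' Psi ((z, z'), t))%E.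
  apply: eq_integral => z _.
  apply: (@fubini_tonelli_domains _ _ 'cV[R]_m (measurableTypeR R) R mu (@lebesgue_measure R) setT `[0, pi / 2]
    (fun p : 'cV[R]_m * measurableTypeR R => Psi ((z, p.1), p.2))) => //.
  exact: measurable_funTS.
have E3 : (\int[mu]_z \int[@lebesgue_measure R]_(t in `[0%R, (pi / 2)%R]) \int[mu]_z' Psi ((z, z'), t) =
    \int[@lebesgue_measure R]_(t in `[0%R, (pi / 2)%R]) \int[mu]_z \int[mu]_z' Psi ((z, z'), t))%E.
  apply: (@fubini_tonelli_domains _ _ 'cV[R]_m (measurableTypeR R) R mu (@lebesgue_measure R) setT `[0, pi / 2]
    (fun p : 'cV[R]_m * measurableTypeR R => \int[mu]_z' Psi ((p.1, z'), p.2))%E) => //.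
  exact: measurable_funTS.
rewrite E2 E3.
have mPhie : measurable_fun setT (fun p => (Phi p)%:E) by exact/measurable_EFinP.
have Phie0 p : (0 <= (Phi p)%:E)%E by rewrite lee_fin.
rewrite (eq_integral (cst (\int[mu]_z \int[mu]_z' (Phi (z, z'))%:E)%E)); last first.
  by move=> t _; exact: (ge0_integral_rotation t mPhie Phie0).
rewrite integral_cst//= lebesgue_measure_itv/= lte_fin p20 -EFinD subr0.
by rewrite muleC.
Qed.

End slices.

(** * Path estimates within a slice, and triples of coordinates *)

Section paths.
Context {R : realType} (n : nat).

(** A chain rule with [A] in the role of the gradient, for curves bounded together with their
    velocity near [t0]. This is the form in which differentiation under the integral sign delivers
    it. *)
Definition path_differentiable (S : set 'cV[R]_n) (h : 'cV[R]_n -> R)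
    (A : 'cV[R]_n -> 'cV[R]_n) : Prop :=
  forall (g g' : R -> 'cV[R]_n) (a b B t0 : R),
    (forall t, a < t < b -> norm2 (g t) <= B /\ norm2 (g' t) <= B) ->
    (forall (t : R) i, a < t < b -> is_derive t 1 (fun t => g t i ord0) (g' t i ord0)) ->
    a < t0 < b -> S (g t0) ->
    is_derive t0 1 (fun t => h (g t)) (dot (g' t0) (A (g t0))).

Lemma dotC (x y : 'cV[R]_n) : dot x y = dot y x.
Proof. by apply: eq_bigr => i _; rewrite mulrC. Qed.

Variables (k m : nat) (W1 : 'M[R]_(n, k)) (W2 : 'M[R]_(n, m)).

Definition slice_pt (y : 'cV[R]_k) (z : 'cV[R]_m) : 'cV[R]_n := W1 *m y + W2 *m z.

(** The coefficients [al] and [be] cover both the segment and the rotation. The velocity lies in the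
    range of [W2], so [A] enters only through [W2^T *m A]: here the active directions leave the
    gradient. *)
Lemma path_sqr_le (S : set 'cV[R]_n) (h : 'cV[R]_n -> R) (A : 'cV[R]_n -> 'cV[R]_n)
    (al be al' be' : R -> R) (tau C : R) (y : 'cV[R]_k) (z z' : 'cV[R]_m) :
  path_differentiable S h A -> measurable_fun setT A -> 0 < tau ->
  (forall t : R, is_derive t 1 al (al' t)) -> (forall t : R, is_derive t 1 be (be' t)) ->
  (forall t, -1 < t < tau + 1 ->
    [/\ `|al t| <= C, `|be t| <= C, `|al' t| <= C & `|be' t| <= C]) ->
  measurable_fun (setT : set (measurableTypeR R)) al ->
  measurable_fun (setT : set (measurableTypeR R)) be ->
  measurable_fun (setT : set (measurableTypeR R)) al' ->
  measurable_fun (setT : set (measurableTypeR R)) be' ->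
  (forall t, 0 <= t <= tau -> S (slice_pt y (al t *: z + be t *: z'))) ->
  (((h (slice_pt y (al tau *: z + be tau *: z')%R) -
     h (slice_pt y (al 0 *: z + be 0 *: z')%R)) ^+ 2)%:E <=
   tau%:E * \int[@lebesgue_measure R]_(t in `[0%R, tau])
     (norm2 (W2^T *m A (slice_pt y (al t *: z + be t *: z')))%R ^+ 2 *
      norm2 (al' t *: z + be' t *: z')%R ^+ 2)%:E)%E.
Proof.
move=> pd mA tau0 dal dbe bnd mal mbe mal' mbe' inS.
pose g t := slice_pt y (al t *: z + be t *: z').
pose g' t := W2 *m (al' t *: z + be' t *: z').
have gE t : g t = W1 *m y + (al t *: (W2 *m z) + be t *: (W2 *m z')).
  by rewrite /g /slice_pt mulmxDr -!scalemxAr.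
have g'E t : g' t = al' t *: (W2 *m z) + be' t *: (W2 *m z').
  by rewrite /g' mulmxDr -!scalemxAr.
pose B := norm2 (W1 *m y) + (C * norm2 (W2 *m z) + C * norm2 (W2 *m z')).
have gB t : -1 < t < tau + 1 -> norm2 (g t) <= B /\ norm2 (g' t) <= B.
  move=> /bnd[b1 b2 b3 b4]; rewrite gE g'E; split.
    apply: le_trans (norm2D _ _) _; rewrite lerD2l.
    by apply: le_trans (norm2D _ _) _; rewrite !norm2Z lerD// ler_wpM2r ?norm2_ge0.
  apply: le_trans (norm2D _ _) _; rewrite !norm2Z /B.
  rewrite -[leLHS]add0r lerD ?norm2_ge0// lerD// ler_wpM2r ?norm2_ge0//.
have dg (t : R) i : -1 < t < tau + 1 -> is_derive t 1 (fun t => g t i ord0) (g' t i ord0).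
  move=> _.
  pose c0 := (W1 *m y) i ord0; pose c1 := (W2 *m z) i ord0; pose c2 := (W2 *m z') i ord0.
  have -> : (fun t => g t i ord0) = (cst c0 : R -> R) + (c1 \*: al + c2 \*: be).
    apply/funext => s; rewrite gE [LHS]mxE [X in _ + X]mxE [X in _ + (X + _)]mxE.
    by rewrite [X in _ + (_ + X)]mxE [al s * _]mulrC [be s * _]mulrC.
  have d1 := is_deriveZ c1 (dal t); have d2 := is_deriveZ c2 (dbe t).
  have := is_deriveD (is_derive_cst c0 t 1) (is_deriveD d1 d2).
  move=> d3; apply: (is_derive_eq d3).
  rewrite add0r g'E [RHS]mxE [X in _ = X + _]mxE [X in _ = _ + X]mxE.
  by congr (_ + _); exact: mulrC.
(* The open interval surrounds [0, tau], so the derivatives at the end points are two-sided. *)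
have t01 t : 0 <= t <= tau -> -1 < t < tau + 1.
  by move=> /andP[? ?]; apply/andP; split; lra.
have dphi (t : R) : 0 <= t <= tau -> is_derive t 1 (fun t => h (g t)) (dot (g' t) (A (g t))).
  by move=> t0; apply: (pd g g' (-1) (tau + 1) B) => //; [exact: t01|exact: inS].
pose dp t := dot (g' t) (A (g t)).
have mg : measurable_fun (setT : set (measurableTypeR R)) g.
  apply: measurable_addmx => //; apply: measurable_mulmx.
  by apply: measurable_addmx; apply: measurable_scalemx.
have mg' : measurable_fun (setT : set (measurableTypeR R)) g'.
  apply: measurable_mulmx.
  by apply: measurable_addmx; apply: measurable_scalemx.
have mAg := measurableT_comp mA mg.
have mdp : measurable_fun (setT : set (measurableTypeR R)) dp.
  apply: measurable_sum => i; apply: measurable_funM.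
    exact: (measurableT_comp (measurable_coord i ord0) mg').
  exact: (measurableT_comp (measurable_coord i ord0) mAg).
have d1 t : 0 <= t <= tau -> derive1 (fun t => h (g t)) t = dp t.
  by move=> t0; have d := dphi t t0; rewrite derive1E; exact: derive_val.
have mI := @measurable_itv R `[0, tau].
have mdphi : measurable_fun (`[0, tau]%classic : set (measurableTypeR R)) (derive1 (fun t => h (g t))).
  apply: (@eq_measurable_fun _ _ _ _ _ dp); last exact: measurable_funTS.
  by move=> t; rewrite inE/= in_itv/= => /d1 ->.
have H := @le_integral_derive1 R (fun t => h (g t)) 0 tau (ltW tau0)
  (fun t t0 => @ex_derive _ _ _ _ _ _ _ (dphi t t0)) mdphi.
have I1 : (\int[@lebesgue_measure R]_(t in `[0%R, tau]) ((fun=> 1%R) t)%:E = tau%:E)%E.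
  by rewrite integral_cst//= lebesgue_measure_itv/= lte_fin tau0 mul1e -EFinD subr0.
have HH : ((`|h (g tau) - h (g 0)|%R)%:E <=
    \int[@lebesgue_measure R]_(t in `[0%R, tau]) (`|dp t| * (fun=> 1%R) t)%:E)%E.
  apply: (le_trans H); rewrite le_eqVlt; apply/orP; left; apply/eqP.
  by apply: eq_integral => t; rewrite inE/= in_itv/= => /d1 ->; rewrite mulr1.
have := @sqr_le_integral _ _ R (@lebesgue_measure R) _ dp (fun=> 1%R)
  (`|h (g tau) - h (g 0)|) tau mI (measurable_funTS mdp) (measurable_cst _)
  (fun _ _ => ler01) tau0 I1 (normr_ge0 _) HH.
rewrite real_normK ?num_real// => /le_trans; apply.
apply: lee_wpmul2l; first by rewrite lee_fin ltW.
apply: ge0_le_integral => //.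
- by move=> t _; rewrite lee_fin mulr1 sqr_ge0.
- apply: measurable_funTS; apply/measurable_EFinP; apply: measurable_funM => //.
  exact: measurable_funX.
- apply: measurable_funTS; apply/measurable_EFinP; apply: measurable_funM.
    apply: measurable_funX; apply: (measurableT_comp (@measurable_norm2 _ _)).
    exact: measurable_mulmx.
  apply: measurable_funX; apply: (measurableT_comp (@measurable_norm2 _ _)).
  by apply: measurable_addmx; apply: measurable_scalemx.
- move=> t _; rewrite lee_fin mulr1 /dp /g' dotC dot_mulmx.
  exact: dot_sqr_le.
Qed.

End paths.

Section triples.
Context {R : realType} (k m : nat).
Local Notation triple := (('cV[R]_k * 'cV[R]_m) * 'cV[R]_m)%type.
Local Notation nu := (@lebesgue_vec R (k + (m + m))).

(** Triples (y, z, z') are read off one long vector, so that their integrals are taken against a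
    single Lebesgue measure, to which Fatou's lemma applies at once. *)
Definition tri (x : 'cV[R]_(k + (m + m))) : triple :=
  ((usubmx x, usubmx (dsubmx x)), dsubmx (dsubmx x)).

Lemma measurable_tri : measurable_fun setT tri.
Proof.
apply/measurable_fun_pair; [apply/measurable_fun_pair|];
apply/measurable_fun_mxP => // i j.
- by under eq_fun do rewrite mxE; exact: measurable_coord.
- by under eq_fun do rewrite !mxE; exact: measurable_coord.
- by under eq_fun do rewrite !mxE; exact: measurable_coord.
Qed.

Local Open Scope ereal_scope.

Lemma ge0_integral_tri (F : triple -> \bar R) : measurable_fun setT F ->
  (forall p, 0 <= F p) ->
  \int[nu]_x F (tri x) =
  \int[lebesgue_vec k]_y \int[lebesgue_vec m]_z \int[lebesgue_vec m]_z' F ((y, z), z').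
Proof.
move=> mF F0.
have mFt := measurableT_comp mF measurable_tri.
have <- := ge0_integral_col_mx mFt (fun x => F0 _).
apply: eq_integral => y _.
have mFy : measurable_fun setT (fun x : 'cV[R]_(m + m) => F ((y, usubmx x), dsubmx x)).
  apply: (measurableT_comp mF); apply/measurable_fun_pair.
    apply/measurable_fun_pair => //; apply/measurable_fun_mxP => // i j.
    by under eq_fun do rewrite mxE; exact: measurable_coord.
  apply/measurable_fun_mxP => // i j.
  by under eq_fun do rewrite mxE; exact: measurable_coord.
have E1 := ge0_integral_col_mx mFy (fun x => F0 _).
have -> : \int[lebesgue_vec (m + m)]_x (F \o tri) (col_mx y x) =
    \int[lebesgue_vec (m + m)]_x F ((y, usubmx x), dsubmx x).
  by apply: eq_integral => x _; rewrite /tri/= col_mxKu col_mxKd.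
rewrite -E1; apply: eq_integral => z _; apply: eq_integral => z' _.
by rewrite col_mxKu col_mxKd.
Qed.

End triples.

(** * Energy of pairs of points on a common slice *)

Section slice_weights.
Context {R : realType} (n k m : nat) (km : (k + m)%N = n).
Variables (W1 : 'M[R]_(n, k)) (W2 : 'M[R]_(n, m)).
Hypothesis oW : orthogonal_mx (hblock_mx km W1 W2).
Variable rho : 'cV[R]_n -> R.
Hypothesis mrho : measurable_fun setT rho.
Hypothesis rho0 : forall x, 0 <= rho x.
Local Notation triple := (('cV[R]_k * 'cV[R]_m) * 'cV[R]_m)%type.
Local Notation pt := (slice_pt W1 W2).
Local Notation nu := (@lebesgue_vec R (k + (m + m))).
Local Notation ad := (active_density rho W1 W2).

Lemma measurable_slice_pt d (T : measurableType d) (f : T -> 'cV[R]_k) (g : T -> 'cV[R]_m) :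
  measurable_fun setT f -> measurable_fun setT g ->
  measurable_fun setT (fun t => pt (f t) (g t)).
Proof. by move=> mf mg; apply: measurable_addmx; exact: measurable_mulmx. Qed.

Lemma active_density_ge0 y : 0 <= ad y.
Proof. by apply: Rintegral_ge0 => z _. Qed.

Lemma measurable_active_density : measurable_fun setT ad.
Proof.
apply: (@measurable_Rintegral_fubini _ _ _ _ R (lebesgue_vec m)
  (fun p : 'cV[R]_k * 'cV[R]_m => rho (pt p.1 p.2))).
by apply: (measurableT_comp mrho); exact: measurable_slice_pt.
Qed.

Let mrz y : measurable_fun setT (fun z => (rho (pt y z))%:E).
Proof. by apply/measurable_EFinP; apply: (measurableT_comp mrho); exact: measurable_slice_pt. Qed.

(* The bound includes the junk case of an infinite slice integral, where
   [active_density] is [0]. *)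
Lemma slice_mass_le y :
  (((ad y)^-1)%:E * \int[lebesgue_vec m]_z (rho (pt y z))%:E <= 1)%E.
Proof.
have : (0 <= \int[lebesgue_vec m]_z (rho (pt y z))%:E)%E.
  by apply: integral_ge0 => z _; rewrite lee_fin.
rewrite /active_density /Rintegral -/(pt y _).
case: (\int[_]_z _)%E => [r|_|//] /=; last by rewrite invr0 mul0e.
rewrite lee_fin -EFinM lee_fin => r0.
have [->|rn] := eqVneq r 0; first by rewrite mulr0.
by rewrite mulVf.
Qed.

(** The joint density of [y] and two conditionally independent copies of the inactive variable given
    [y]; it is 0 where [active_density] vanishes, by the convention for the inverse of 0. *)
Definition slice_weight (p : triple) : R :=
  rho (pt p.1.1 p.1.2) * rho (pt p.1.1 p.2) / ad p.1.1.

Lemma slice_weight_ge0 p : 0 <= slice_weight p.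
Proof. by rewrite /slice_weight !mulr_ge0// invr_ge0 active_density_ge0. Qed.

Let mp11 : measurable_fun setT (fun p : triple => p.1.1).
Proof. exact: (measurableT_comp measurable_fst measurable_fst). Qed.

Let mp12 : measurable_fun setT (fun p : triple => p.1.2).
Proof. exact: (measurableT_comp measurable_snd measurable_fst). Qed.

Lemma measurable_slice_weight : measurable_fun setT slice_weight.
Proof.
apply: measurable_funM.
  by apply: measurable_funM; apply: (measurableT_comp mrho); exact: measurable_slice_pt.
(* The inverse agrees with the power -1 on nonnegative reals, zero included, and powers are
   measurable. *)
rewrite (_ : (fun p => _) = (fun p : triple => ad p.1.1 `^ (-1))); last first.
  by apply/funext => p; rewrite powR_inv1// active_density_ge0.
apply: (measurableT_comp (measurable_powR _)).
exact: (measurableT_comp measurable_active_density mp11).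
Qed.

(** Integrating out [z'] leaves [rho] times a conditional mass, which [slice_mass_le] bounds by
    one. *)
Lemma slice_margin1_le (psi : 'cV[R]_n -> R) : measurable_fun setT psi ->
  (forall x, 0 <= psi x) ->
  (\int[nu]_x (slice_weight (tri x) * psi (pt (tri x).1.1 (tri x).1.2))%:E <=
   \int[lebesgue_vec n]_x (rho x * psi x)%:E)%E.
Proof.
move=> mpsi psi0.
pose F (p : triple) : \bar R := (slice_weight p * psi (pt p.1.1 p.1.2))%:E.
have mF : measurable_fun setT F.
  apply/measurable_EFinP; apply: measurable_funM; first exact: measurable_slice_weight.
  by apply: (measurableT_comp mpsi); exact: measurable_slice_pt.
have F0 p : (0 <= F p)%E by rewrite lee_fin mulr_ge0// slice_weight_ge0.
rewrite (ge0_integral_tri mF F0).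
have mrp : measurable_fun setT (fun x => (rho x * psi x)%:E).
  by apply/measurable_EFinP; exact: measurable_funM.
have rp0 x : (0 <= (rho x * psi x)%:E)%E by rewrite lee_fin mulr_ge0.
rewrite -(ge0_integral_hblock oW mrp rp0).
have mI1 : measurable_fun setT (fun p => \int[lebesgue_vec m]_z' F (p, z'))%E.
  by apply: (@measurable_fubini_domain _ _ _ _ R (lebesgue_vec m) setT F) => //; exact: measurable_funTS.
have I10 p : (0 <= \int[lebesgue_vec m]_z' F (p, z'))%E by apply: integral_ge0.
have mI2 : measurable_fun setT (fun p : 'cV[R]_k * 'cV[R]_m => (rho (pt p.1 p.2) * psi (pt p.1 p.2))%:E).
  by apply: (measurableT_comp mrp); exact: measurable_slice_pt.
apply: ge0_le_integral => //.
- by move=> y _; apply: integral_ge0.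
- apply: (@measurable_fubini_domain _ _ _ _ R (lebesgue_vec m) setT
    (fun p => \int[lebesgue_vec m]_z' F (p, z'))%E) => //.
  exact: measurable_funTS.
- apply: (@measurable_fubini_domain _ _ _ _ R (lebesgue_vec m) setT
    (fun p : 'cV[R]_k * 'cV[R]_m => (rho (pt p.1 p.2) * psi (pt p.1 p.2))%:E)) => //.
    exact: measurable_funTS.
- move=> y _; apply: ge0_le_integral => //.
  + exact: (measurableT_comp mI1 (pair1_measurable y)).
  + exact: (measurableT_comp mI2 (pair1_measurable y)).
  + move=> z _.
    have c0 : (0 <= (rho (pt y z) * psi (pt y z) / ad y)%:E)%E.
      by rewrite lee_fin !mulr_ge0// invr_ge0 active_density_ge0.
    have -> : (\int[lebesgue_vec m]_z' F (y, z, z') =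
        \int[lebesgue_vec m]_z' ((rho (pt y z) * psi (pt y z) / ad y)%:E * (rho (pt y z'))%:E))%E.
      by apply: eq_integral => z' _; rewrite -EFinM /F /slice_weight/=; congr EFin; ring.
    rewrite (ge0_integralZl _ measurableT (mrz y) _ c0); last by move=> z' _; rewrite lee_fin.
    rewrite EFinM -muleA -[leRHS]mule1; apply: lee_wpmul2l => //.
    exact: slice_mass_le.
Qed.

Lemma slice_margin2_le (psi : 'cV[R]_n -> R) : measurable_fun setT psi ->
  (forall x, 0 <= psi x) ->
  (\int[nu]_x (slice_weight (tri x) * psi (pt (tri x).1.1 (tri x).2))%:E <=
   \int[lebesgue_vec n]_x (rho x * psi x)%:E)%E.
Proof.
move=> mpsi psi0; apply: le_trans (slice_margin1_le mpsi psi0).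
pose F (p : triple) : \bar R := (slice_weight p * psi (pt p.1.1 p.1.2))%:E.
pose F' (p : triple) : \bar R := (slice_weight p * psi (pt p.1.1 p.2))%:E.
have mF : measurable_fun setT F.
  apply/measurable_EFinP; apply: measurable_funM; first exact: measurable_slice_weight.
  by apply: (measurableT_comp mpsi); exact: measurable_slice_pt.
have mF' : measurable_fun setT F'.
  apply/measurable_EFinP; apply: measurable_funM; first exact: measurable_slice_weight.
  by apply: (measurableT_comp mpsi); exact: measurable_slice_pt.
have F0 p : (0 <= F p)%E by rewrite lee_fin mulr_ge0// slice_weight_ge0.
have F'0 p : (0 <= F' p)%E by rewrite lee_fin mulr_ge0// slice_weight_ge0.
rewrite (ge0_integral_tri mF F0) (ge0_integral_tri mF' F'0).
rewrite le_eqVlt; apply/orP; left; apply/eqP; apply: eq_integral => y _.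
have mFy : measurable_fun setT (fun p : 'cV[R]_m * 'cV[R]_m => F' (y, p.1, p.2)).
  by apply: (measurableT_comp mF'); apply/measurable_fun_pair => //; apply/measurable_fun_pair.
apply: (etrans (@fubini_tonelli_domains _ _ _ _ R (lebesgue_vec m) (lebesgue_vec m) setT setT
  (fun p : 'cV[R]_m * 'cV[R]_m => F' (y, p.1, p.2)) measurableT measurableT
  (measurable_funTS mFy) (fun p => F'0 _))).
apply: eq_integral => z _; apply: eq_integral => z' _.
by rewrite /F /F' /slice_weight/= [rho (pt y z) * _]mulrC.
Qed.

(** The Poincare inequality passes from the mollification [h] to [f] by splitting the increment of
    [f] into the increment of [h] and the errors [f - h] at the two ends. An error depends on one
    point only, so the marginal bounds reduce it to [moll_error_le]. The 3 comes from squaring three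
    terms, the 6 from the two ends. *)
Lemma slice_energy_region_le (X S : set 'cV[R]_n) (T : set triple) (f : 'cV[R]_n -> R)
    (D : 'I_n -> 'cV[R]_n -> R) (delta K M Cp : R) :
  measurable S -> measurable T ->
  measurable_fun setT f -> (forall x, `|f x| <= M) ->
  (forall i, measurable_fun setT (D i)) ->
  (forall x i, X x -> is_derive x (delta_mx i ord0) f (D i x)) ->
  0 < delta -> 0 <= K -> 0 <= Cp ->
  (forall x v, S x -> norm2 v <= delta -> X (x + v)) ->
  (forall x v, S x -> norm2 v <= delta -> rho x <= K * rho (x + v)) ->
  (forall x, S x -> 0 < rho x) ->
  (forall i, (\int[lebesgue_vec n]_x (rho x * D i x ^+ 2)%:E < +oo)%E) ->
  (forall p, T p -> S (pt p.1.1 p.1.2) /\ S (pt p.1.1 p.2)) ->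
  (forall (h : 'cV[R]_n -> R) (A : 'cV[R]_n -> 'cV[R]_n),
    measurable_fun setT h -> measurable_fun setT A -> path_differentiable S h A ->
    (\int[nu]_x (slice_weight (tri x) * \1_T (tri x) *
        (h (pt (tri x).1.1 (tri x).2) - h (pt (tri x).1.1 (tri x).1.2)) ^+ 2)%:E <=
     Cp%:E * \int[lebesgue_vec n]_(x in S) (rho x * norm2 (W2^T *m A x)%R ^+ 2)%:E)%E) ->
  (\int[nu]_x (slice_weight (tri x) * \1_T (tri x) *
      (f (pt (tri x).1.1 (tri x).2) - f (pt (tri x).1.1 (tri x).1.2)) ^+ 2)%:E <=
   (3 * Cp * K)%:E * \int[lebesgue_vec n]_x
      (rho x * norm2 (W2^T *m (\col_i D i x))%R ^+ 2)%:E +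
   (6 * (n%:R * delta ^+ 2 * K))%:E *
      \sum_(i < n) \int[lebesgue_vec n]_x (rho x * D i x ^+ 2)%:E)%E.
Proof.
move=> mS mT mf fM mD dfD delta0 K0 Cp0 SX SK Srho ID TS HP.
pose h := moll delta f.
pose A := moll_grad D delta.
have mh : measurable_fun setT h by exact: measurable_moll.
have mA : measurable_fun setT A.
  apply/measurable_fun_mxP => // i j; under eq_fun do rewrite mxE.
  exact: measurable_moll.
have pd : path_differentiable S h A.
  move=> g g' a b B t0 gB dg t0ab Sg.
  exact: (@is_derive_moll_path R n X S rho f D delta K M mrho rho0 mf fM mD dfD delta0 K0 SX SK ID
    g g' a b B t0 gB dg t0ab Sg (Srho _ Sg)).
have H1 := HP h A mh mA pd.
have Err := @moll_error_le R n X S rho f D delta K M mS mrho rho0 mf fM mD dfD delta0 K0 SX SK.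
set E := (X in (_ <= _ + X)%E).
(* The contraction is applied to each component [q j] of the projected gradient, so that only the
   inactive part of the gradient appears on the right. *)
have grad_le : (\int[lebesgue_vec n]_(x in S) (rho x * norm2 (W2^T *m A x)%R ^+ 2)%:E <=
    K%:E * \int[lebesgue_vec n]_x (rho x * norm2 (W2^T *m (\col_i D i x))%R ^+ 2)%:E)%E.
  pose q (j : 'I_m) x := \sum_i W2 i j * D i x.
  have mq j : measurable_fun setT (q j).
    by apply: measurable_sum => i; exact: measurable_funM.
  have qE x : norm2 (W2^T *m (\col_i D i x)) ^+ 2 = \sum_j q j x ^+ 2.
    rewrite norm2_sqr; apply: eq_bigr => j _; congr (_ ^+ 2).
    by rewrite mxE; apply: eq_bigr => i _; rewrite !mxE.
  have AE x : S x -> norm2 (W2^T *m A x) ^+ 2 = \sum_j moll delta (q j) x ^+ 2.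
    move=> Sx; rewrite norm2_sqr; apply: eq_bigr => j _; congr (_ ^+ 2).
    rewrite mxE.
    have := @dot_moll_grad R n S rho D delta K mrho rho0 mD delta0 K0 SK ID
      (col j W2) x Sx (Srho _ Sx).
    rewrite /dot => H2.
    transitivity (\sum_i col j W2 i ord0 * moll_grad D delta x i ord0).
      by apply: eq_bigr => i _; rewrite !mxE.
    rewrite H2; congr (moll delta _ x); apply/funext => w; rewrite /q.
    by apply: eq_bigr => i _; rewrite mxE.
  have -> : (\int[lebesgue_vec n]_(x in S) (rho x * norm2 (W2^T *m A x)%R ^+ 2)%:E =
      \sum_j \int[lebesgue_vec n]_(x in S) (rho x * moll delta (q j) x ^+ 2)%:E)%E.
    rewrite -ge0_integral_sum//; last 2 first.
    - move=> j; apply: measurable_funTS; apply/measurable_EFinP; apply: measurable_funM => //.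
      by apply: measurable_funX; exact: measurable_moll.
    - by move=> j x _; rewrite lee_fin mulr_ge0 ?sqr_ge0.
    apply: eq_integral => x; rewrite inE => Sx.
    by rewrite AE// sumEFin mulr_sumr.
  have -> : (\int[lebesgue_vec n]_x (rho x * norm2 (W2^T *m (\col_i D i x))%R ^+ 2)%:E =
      \sum_j \int[lebesgue_vec n]_x (rho x * q j x ^+ 2)%:E)%E.
    rewrite -ge0_integral_sum//; last 2 first.
    - move=> j; apply/measurable_EFinP; apply: measurable_funM => //.
      exact: measurable_funX.
    - by move=> j x _; rewrite lee_fin mulr_ge0 ?sqr_ge0.
    by apply: eq_integral => x _; rewrite qE sumEFin mulr_sumr.
  rewrite ge0_sume_distrr; last first.
    by move=> j _; apply: integral_ge0 => x _; rewrite lee_fin mulr_ge0 ?sqr_ge0.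
  apply: lee_sum => j _.
  exact: (@moll_contraction R n S rho delta K mS mrho rho0 delta0 K0 SK).
pose psi x := \1_S x * (f x - h x) ^+ 2.
have mpsi : measurable_fun setT psi.
  apply: measurable_funM; first exact: measurable_indic.
  by apply: measurable_funX; exact: measurable_funB.
have psi0 x : 0 <= psi x by rewrite mulr_ge0 ?sqr_ge0.
have psiE : (\int[lebesgue_vec n]_x (rho x * psi x)%:E =
    \int[lebesgue_vec n]_(x in S) (rho x * (f x - h x) ^+ 2)%:E)%E.
  rewrite [RHS]integral_mkcond; apply: eq_integral => x _.
  by rewrite patchE /psi indicE; case: ifP => _; rewrite ?mul1r ?mul0r ?mulr0.
have m1 := slice_margin1_le mpsi psi0.
have m2 := slice_margin2_le mpsi psi0.
rewrite psiE in m1 m2.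
have mw : measurable_fun setT (fun x => slice_weight (@tri R k m x)).
  exact: (measurableT_comp measurable_slice_weight (@measurable_tri R k m)).
have mtp1 : measurable_fun setT (fun x => pt (@tri R k m x).1.1 (tri x).1.2).
  apply: measurable_slice_pt.
    exact: (measurableT_comp mp11 (@measurable_tri R k m)).
  exact: (measurableT_comp mp12 (@measurable_tri R k m)).
have mtp2 : measurable_fun setT (fun x => pt (@tri R k m x).1.1 (tri x).2).
  apply: measurable_slice_pt.
    exact: (measurableT_comp mp11 (@measurable_tri R k m)).
  exact: (measurableT_comp measurable_snd (@measurable_tri R k m)).
have mTt : measurable_fun setT (fun x => \1_T (@tri R k m x) : R).
  apply: (measurableT_comp _ (@measurable_tri R k m)).
  exact: measurable_indic.
pose a x : R := slice_weight (@tri R k m x) * psi (pt (tri x).1.1 (tri x).1.2).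
pose c x : R := slice_weight (@tri R k m x) * psi (pt (tri x).1.1 (tri x).2).
pose b x : R := slice_weight (@tri R k m x) * \1_T (tri x) *
        (h (pt (tri x).1.1 (tri x).2) - h (pt (tri x).1.1 (tri x).1.2)) ^+ 2.
have ma : measurable_fun setT (fun x => (a x)%:E).
  by apply/measurable_EFinP; apply: measurable_funM => //; exact: (measurableT_comp mpsi).
have mc : measurable_fun setT (fun x => (c x)%:E).
  by apply/measurable_EFinP; apply: measurable_funM => //; exact: (measurableT_comp mpsi).
have mb : measurable_fun setT (fun x => (b x)%:E).
  apply/measurable_EFinP; apply: measurable_funM; first exact: measurable_funM.
  by apply: measurable_funX; apply: measurable_funB; exact: (measurableT_comp mh).
have a0 x : (0 <= (a x)%:E)%E by rewrite lee_fin mulr_ge0// slice_weight_ge0.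
have c0 x : (0 <= (c x)%:E)%E by rewrite lee_fin mulr_ge0// slice_weight_ge0.
have b0 x : (0 <= (b x)%:E)%E.
  by rewrite lee_fin /b mulr_ge0 ?sqr_ge0// mulr_ge0// slice_weight_ge0.
have e1 := le_trans m1 Err.
have e2 := le_trans m2 Err.
have e3 : (\int[nu]_x (b x)%:E <= (Cp * K)%:E * \int[lebesgue_vec n]_x
      (rho x * norm2 (W2^T *m (\col_i D i x))%R ^+ 2)%:E)%E.
  by apply: (le_trans H1); rewrite (EFinM Cp K) -muleA; apply: lee_wpmul2l.
clear H1 Err HP m1 m2 grad_le pd.
have three0 : (0 <= (3 : R)%:E)%E by rewrite lee_fin.
have ab0 x : (0 <= (a x)%:E + (b x)%:E)%E := adde_ge0 (a0 x) (b0 x).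
have mab := emeasurable_funD ma mb.
have mabc := emeasurable_funD mab mc.
have abc0 x : (0 <= (a x)%:E + (b x)%:E + (c x)%:E)%E := adde_ge0 (ab0 x) (c0 x).
have m3abc := measurable_funeM (3%:E)%E mabc.
apply: (@le_trans _ _ (\int[nu]_x (3%:E * ((a x)%:E + (b x)%:E + (c x)%:E)))%E).
  apply: (@ge0_le_integral _ _ R nu setT measurableT _ _ _ _ m3abc).
  - by move=> x _; rewrite lee_fin mulr_ge0 ?sqr_ge0// mulr_ge0// slice_weight_ge0.
  - apply/measurable_EFinP; apply: measurable_funM; first exact: measurable_funM.
    by apply: measurable_funX; apply: measurable_funB; exact: (measurableT_comp mf).
  - move=> x _; rewrite -!EFinD -EFinM lee_fin /a /b /c.
    have w0 := slice_weight_ge0 (tri x).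
    have [Tx|nTx] := pselect (T (tri x)); last first.
      rewrite [\1_T _]indicE memNset// !mulr0 !mul0r addr0.
      by rewrite mulr_ge0// addr_ge0// mulr_ge0.
    have [S1 S2] := TS _ Tx.
    rewrite [\1_T _]indicE (mem_set Tx) !mulr1 /psi !indicE !mem_set// !mul1r.
    set f1 := f _; set f2 := f _; set h1 := h _; set h2 := h _.
    set wt := slice_weight _ in w0 *; clearbody wt f1 f2 h1 h2.
    (* For three pieces p, q, r: 3 (p^2 + q^2 + r^2) - (p + q + r)^2 = (p - q)^2 + (p - r)^2 + (q -
       r)^2. *)
    rewrite -subr_ge0 (_ : _ - _ = wt * (((f1 - h2) - (h2 - h1)) ^+ 2 +
      ((f1 - h2) + (f2 - h1)) ^+ 2 + ((h2 - h1) + (f2 - h1)) ^+ 2)); last by ring.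
    by rewrite mulr_ge0// !addr_ge0// sqr_ge0.
rewrite (ge0_integralZl nu measurableT mabc (fun x _ => abc0 x) three0).
have -> := ge0_integralD nu measurableT (fun x _ => ab0 x) mab (fun x _ => c0 x) mc.
have -> := ge0_integralD nu measurableT (fun x _ => a0 x) ma (fun x _ => b0 x) mb.
apply: (le_trans (lee_wpmul2l three0 (leeD (leeD e1 e3) e2))).
rewrite le_eqVlt; apply/orP; left; apply/eqP.
clear e1 e2 e3.
rewrite /E; set J := (\int[lebesgue_vec n]_x _)%E; set Sg := (\sum_(i < n) _)%E.
have Sg0 : (0 <= Sg)%E.
  by apply: sume_ge0 => i _; apply: integral_ge0 => x _; rewrite lee_fin mulr_ge0 ?sqr_ge0.
have J0 : (0 <= J)%E.
  by apply: integral_ge0 => x _; rewrite lee_fin mulr_ge0 ?sqr_ge0.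
set e := n%:R * delta ^+ 2 * K.
have ee0 : 0 <= e by rewrite mulr_ge0// mulr_ge0// sqr_ge0.
clearbody e.
rewrite addeAC -ge0_muleDl ?lee_fin// -EFinD.
rewrite ge0_muleDr ?mule_ge0 ?lee_fin ?addr_ge0 ?mulr_ge0//.
by rewrite !muleA -!EFinM addeC; congr (_ * _ + _ * _)%E; congr EFin; ring.
Qed.

End slice_weights.

(** * Removal of mollification, exhaustion and truncation by Fatou's lemma *)

Section convergence.
Context d (T : measurableType d) (R : realType) (mu : {measure set T -> \bar R}).

(** Fatou's lemma with a moving upper bound, which here absorbs the vanishing mollification
    error. *)
Lemma ge0_integral_le_of_cvg (F : nat -> T -> \bar R) (G : T -> \bar R) (a : nat -> \bar R)
    (A : \bar R) :
  (forall j, measurable_fun setT (F j)) -> (forall j x, (0 <= F j x)%E) ->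
  (forall x, F j x @[j --> \oo] --> G x) ->
  (forall j, (\int[mu]_x F j x <= a j)%E) -> a @ \oo --> A ->
  (\int[mu]_x G x <= A)%E.
Proof.
move=> mF F0 FG Fa aA.
have -> : (\int[mu]_x G x = \int[mu]_x limn_einf (F ^~ x))%E.
  by apply: eq_integral => x _; have [-> _] := cvg_limn_einf_sup (FG x).
apply: (le_trans (fatou mu measurableT mF (fun j x _ => F0 j x))).
have [<- _] := cvg_limn_einf_sup aA.
rewrite !limn_einf_lim; apply: lee_lim; [exact: is_cvg_einfs|exact: is_cvg_einfs|].
apply: nearW => j; apply: le_ereal_inf_tmp => _ [i /= ji <-].
by apply: ge_ereal_inf; exists (\int[mu]_x F i x)%E => //; exists i.
Qed.

End convergence.

Section soft_truncation.
Context {R : realType}.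

(* Bounded functions with derivative in [-1, 1] that tend to the identity. *)
Definition soft_trunc (j : nat) (s : R) : R := s / (1 + (j.+1%:R^-1 * s) ^+ 2).

Let den_gt0 j s : 0 < 1 + (j.+1%:R^-1 * s) ^+ 2 :> R.
Proof. by rewrite ltr_pwDl// sqr_ge0. Qed.

Lemma soft_trunc_bounded j s : `|soft_trunc j s| <= j.+1%:R.
Proof.
rewrite /soft_trunc normrM normfV (gtr0_norm (den_gt0 j s)) ler_pdivrMr//.
have := den_gt0 j s; set a := _^-1 * s => _.
have -> : s = j.+1%:R * a by rewrite /a mulrA divff ?mul1r// pnatr_eq0.
rewrite normrM ger0_norm// ler_wpM2l//.
have := sqr_ge0 (`|a| - 1); rewrite -[a ^+ 2]real_normK ?num_real//.
have := normr_ge0 a; nra.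
Qed.

Lemma cvg_soft_trunc s : soft_trunc j s @[j --> \oo] --> s.
Proof.
rewrite -[X in _ --> X]divr1 -[X in s / X](addr0 1) -[X in _ + X](expr0n R 2).
rewrite -[X in X ^+ 2](mul0r s).
apply: cvgM; first exact: cvg_cst.
apply: cvgV; first by rewrite mul0r expr0n/= addr0 oner_neq0.
apply: cvgD; first exact: cvg_cst.
apply: (@cvg_comp _ _ _ (fun j : nat => j.+1%:R^-1 * s) (fun x => x ^+ 2) _ (nbhs (0 * s))).
  by apply: cvgM; [exact: cvg_harmonic|exact: cvg_cst].
exact: exprn_continuous.
Qed.

Lemma measurable_soft_trunc j : measurable_fun setT (soft_trunc j).
Proof.
apply: measurable_funM => //.
rewrite (_ : (fun s => _) = (fun s => (1 + (j.+1%:R^-1 * s) ^+ 2) `^ (-1))); last first.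
  by apply/funext => s; rewrite powR_inv1// ltW// den_gt0.
apply: (measurableT_comp (measurable_powR _)).
apply: measurable_funD => //; apply: measurable_funX; exact: measurable_funM.
Qed.

(** The derivative of [soft_trunc j]. *)
Definition dsoft_trunc (j : nat) (s : R) : R :=
  (1 - (j.+1%:R^-1 * s) ^+ 2) / (1 + (j.+1%:R^-1 * s) ^+ 2) ^+ 2.

Lemma measurable_dsoft_trunc j : measurable_fun setT (dsoft_trunc j).
Proof.
have m2 : measurable_fun setT (fun s : R => (j.+1%:R^-1 * s) ^+ 2).
  by apply: measurable_funX; exact: measurable_funM.
apply: measurable_funM; first exact: measurable_funB.
rewrite (_ : (fun s => _) = (fun s => ((1 + (j.+1%:R^-1 * s) ^+ 2) ^+ 2) `^ (-1))); last first.
  by apply/funext => s; rewrite powR_inv1// sqr_ge0.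
apply: (measurableT_comp (measurable_powR _)).
by apply: measurable_funX; exact: measurable_funD.
Qed.

(** With q >= 0, |1 - q| <= 1 + q <= (1 + q)^2. Hence truncation never increases a partial
    derivative. *)
Lemma dsoft_trunc_sqr_le1 j s : dsoft_trunc j s ^+ 2 <= 1.
Proof.
have d0 := den_gt0 j s; rewrite /dsoft_trunc expr_div_n ler_pdivrMr ?exprn_gt0// mul1r.
move: d0; set q := (_ * s) ^+ 2; have q0 : 0 <= q by exact: sqr_ge0.
move=> _; apply: (@le_trans _ _ ((1 + q) ^+ 2)); first by nra.
by rewrite ler_eXnr// expr_ge1// ?lerDl ?addr_ge0.
Qed.

Lemma is_derive_inv (V : normedModType R) (f : V -> R) (x v : V) (df : R) :
  f x != 0 -> is_derive x v f df ->
  is_derive x v (fun y => (f y)^-1) (- (f x) ^- 2 *: df).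
Proof.
move=> fx0 [exf dfE]; apply: DeriveDef; first exact: derivableV.
by rewrite deriveV// dfE.
Qed.

Lemma is_derive_soft_trunc (V : normedModType R) (f : V -> R) (x v : V) (df : R) j :
  is_derive x v f df ->
  is_derive x v (soft_trunc j \o f) (dsoft_trunc j (f x) * df).
Proof.
move=> dfx.
have dg : is_derive x v (fun y => 1 + (j.+1%:R^-1 * f y) ^+ 2)
    (2 * (j.+1%:R^-1 * f x) * (j.+1%:R^-1 * df)).
  rewrite (_ : (fun y => _) = cst 1 + (j.+1%:R^-1 \*: f) ^+ 2); last first.
    by apply/funext => y.
  apply: is_derive_eq (is_deriveD (is_derive_cst _ _ _) (is_deriveX 2 (is_deriveZ _ dfx))) _.
  by rewrite add0r /= expr1.
have gx : 1 + (j.+1%:R^-1 * f x) ^+ 2 != 0 by rewrite gt_eqF.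
have d := is_deriveM dfx
  (@is_derive_inv V (fun y => 1 + (j.+1%:R^-1 * f y) ^+ 2) x v _ gx dg).
apply: (is_derive_eq d).
rewrite /dsoft_trunc /GRing.scale/=; clear d dg; move: gx.
by set a := _^-1; clearbody a => gx; field.
Qed.

End soft_truncation.

Section exhaustion.
Context {R : realType} (n k m : nat) (km : (k + m)%N = n).
Variables (W1 : 'M[R]_(n, k)) (W2 : 'M[R]_(n, m)).
Hypothesis oW : orthogonal_mx (hblock_mx km W1 W2).
Variable rho : 'cV[R]_n -> R.
Hypothesis mrho : measurable_fun setT rho.
Hypothesis rho0 : forall x, 0 <= rho x.
Local Notation triple := (('cV[R]_k * 'cV[R]_m) * 'cV[R]_m)%type.
Local Notation pt := (slice_pt W1 W2).
Local Notation nu := (@lebesgue_vec R (k + (m + m))).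
Local Notation wt := (slice_weight W1 W2 rho).

(** The set [T] of pairs is independent of the region [S], because in the Gaussian case the pairs
    have to be cut off in a rotation invariant way. *)
Definition slice_poincare (S : set 'cV[R]_n) (T : set triple) (Cp : R) : Prop :=
  forall (h : 'cV[R]_n -> R) (A : 'cV[R]_n -> 'cV[R]_n),
    measurable_fun setT h -> measurable_fun setT A -> path_differentiable S h A ->
    (\int[nu]_x (wt (tri x) * \1_T (tri x) *
        (h (pt (tri x).1.1 (tri x).2) - h (pt (tri x).1.1 (tri x).1.2)) ^+ 2)%:E <=
     Cp%:E * \int[lebesgue_vec n]_(x in S) (rho x * norm2 (W2^T *m A x)%R ^+ 2)%:E)%E.

(* [S] is a part of [X] at distance at least [delta] from the complement. *)
Definition interior_region (X S : set 'cV[R]_n) (delta K : R) : Prop :=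
  [/\ measurable S, forall x v, S x -> norm2 v <= delta -> X (x + v),
      forall x v, S x -> norm2 v <= delta -> rho x <= K * rho (x + v) &
      forall x, S x -> 0 < rho x].

(** [K] and [Cp] are fixed along the sequence while [delta] tends to 0, so that the mollification
    error disappears and the constant survives. The last clause provides the pointwise convergence
    for Fatou's lemma. *)
Definition slice_exhausted (X : set 'cV[R]_n) (K Cp : R) : Prop :=
  exists (delta : nat -> R) (S : nat -> set 'cV[R]_n) (T : nat -> set triple),
  [/\ forall j, 0 < delta j, delta @ \oo --> 0,
      forall j, interior_region X (S j) (delta j) K,
      forall j, [/\ measurable (T j),
        forall p, T j p -> S j (pt p.1.1 p.1.2) /\ S j (pt p.1.1 p.2) &
        slice_poincare (S j) (T j) Cp] &
      forall p, 0 < wt p -> \forall j \near \oo, T j p].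

Section energy.
Variables (X : set 'cV[R]_n) (K Cp : R).
Hypotheses (K0 : 0 <= K) (Cp0 : 0 <= Cp) (exh : slice_exhausted X K Cp).

(** The regional estimate differs from the claim by a multiple of [delta j ^+ 2] times the full
    gradient energy [B]; as [B] is finite, this tends to 0. *)
Lemma slice_energy_bounded_le (f : 'cV[R]_n -> R) (D : 'I_n -> 'cV[R]_n -> R) (M : R) :
  measurable_fun setT f -> (forall x, `|f x| <= M) ->
  (forall i, measurable_fun setT (D i)) ->
  (forall x i, X x -> is_derive x (delta_mx i ord0) f (D i x)) ->
  (forall i, (\int[lebesgue_vec n]_x (rho x * D i x ^+ 2)%:E < +oo)%E) ->
  (\int[nu]_x (wt (tri x) *
      (f (pt (tri x).1.1 (tri x).2) - f (pt (tri x).1.1 (tri x).1.2)) ^+ 2)%:E <=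
   (3 * Cp * K)%:E * \int[lebesgue_vec n]_x
      (rho x * norm2 (W2^T *m (\col_i D i x))%R ^+ 2)%:E)%E.
Proof.
move=> mf fM mD dfD ID.
have [delta [S [T [delta0 deltaL SP TP Tev]]]] := exh.
set A := (_ * _)%E.
set B := (\sum_(i < n) \int[lebesgue_vec n]_x (rho x * D i x ^+ 2)%:E)%E.
have mtp1 : measurable_fun setT (fun x => pt (@tri R k m x).1.1 (tri x).1.2).
  apply: measurable_slice_pt.
    exact: (measurableT_comp (measurableT_comp measurable_fst measurable_fst) (@measurable_tri R k m)).
  exact: (measurableT_comp (measurableT_comp measurable_snd measurable_fst) (@measurable_tri R k m)).
have mtp2 : measurable_fun setT (fun x => pt (@tri R k m x).1.1 (tri x).2).
  apply: measurable_slice_pt.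
    exact: (measurableT_comp (measurableT_comp measurable_fst measurable_fst) (@measurable_tri R k m)).
  exact: (measurableT_comp measurable_snd (@measurable_tri R k m)).
have mw : measurable_fun setT (fun x => wt (@tri R k m x)).
  by apply: (measurableT_comp _ (@measurable_tri R k m)); exact: measurable_slice_weight.
apply: (@ge0_integral_le_of_cvg _ _ R nu (fun j x => (wt (tri x) * \1_(T j) (tri x) *
      (f (pt (tri x).1.1 (tri x).2) - f (pt (tri x).1.1 (tri x).1.2)) ^+ 2)%:E) _
  (fun j => A + (6 * (n%:R * delta j ^+ 2 * K))%:E * B)%E A).
- move=> j; apply/measurable_EFinP; apply: measurable_funM.
    apply: measurable_funM => //.
    apply: (measurableT_comp _ (@measurable_tri R k m)).
    by apply: measurable_indic; have [] := TP j.
  by apply: measurable_funX; apply: measurable_funB; exact: (measurableT_comp mf).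
- by move=> j x; rewrite lee_fin mulr_ge0 ?sqr_ge0// mulr_ge0// slice_weight_ge0.
(* At each point the sequence is eventually constant: a triple of positive weight is eventually in
   [T j], and one of weight zero contributes nothing. *)
- move=> x; apply: cvg_near_cst.
  have [w0|w0] := boolP (0 < wt (tri x)).
    by near=> j; rewrite indicE mem_set ?mulr1//; near: j; exact: Tev.
  have -> : wt (tri x) = 0.
    by apply/eqP; rewrite eq_le slice_weight_ge0// leNgt w0.
  by near=> j; rewrite !mul0r.
- move=> j; have [mT TS pT] := TP j; have [mS SX SK Srho] := SP j.
  exact: (slice_energy_region_le oW mrho rho0 mS mT mf fM mD dfD (delta0 j) K0 Cp0 SX SK Srho ID TS pT).
- rewrite -[X in _ --> X]adde0.
  have Bfin : B \is a fin_num.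
    rewrite ge0_fin_numE; first by apply: lte_sum_pinfty => i _; exact: ID.
    by apply: sume_ge0 => i _; apply: integral_ge0 => x _; rewrite lee_fin mulr_ge0 ?sqr_ge0.
  have A0 : (0 <= A)%E.
    rewrite mule_ge0 ?lee_fin ?mulr_ge0//.
    by apply: integral_ge0 => x _; rewrite lee_fin mulr_ge0 ?sqr_ge0.
  apply: cvgeD; [by rewrite fin_num_adde_defl|exact: cvg_cst|].
  rewrite -(fineK Bfin); under eq_fun do rewrite -EFinM.
  apply: cvg_EFin; first exact: nearW.
  rewrite (_ : 0 = 6 * (n%:R * 0 ^+ 2 * K) * fine B); last by rewrite expr0n/= mulr0 mul0r mulr0 mul0r.
  apply: cvgM; last exact: cvg_cst.
  apply: cvgM; first exact: cvg_cst.
  apply: cvgM; last exact: cvg_cst.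
  apply: cvgM; first exact: cvg_cst.
  by rewrite expr2; apply: cvgM.
Unshelve. all: by end_near.
Qed.

(** Truncating multiplies the gradient by the scalar [dsoft_trunc j (f x)], of modulus at most one,
    so the same right-hand side serves for every [j]. *)
Lemma slice_energy_le (f : 'cV[R]_n -> R) (D : 'I_n -> 'cV[R]_n -> R) :
  measurable_fun setT f ->
  (forall i, measurable_fun setT (D i)) ->
  (forall x i, X x -> is_derive x (delta_mx i ord0) f (D i x)) ->
  (forall i, (\int[lebesgue_vec n]_x (rho x * D i x ^+ 2)%:E < +oo)%E) ->
  (\int[nu]_x (wt (tri x) *
      (f (pt (tri x).1.1 (tri x).2) - f (pt (tri x).1.1 (tri x).1.2)) ^+ 2)%:E <=
   (3 * Cp * K)%:E * \int[lebesgue_vec n]_x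
      (rho x * norm2 (W2^T *m (\col_i D i x))%R ^+ 2)%:E)%E.
Proof.
move=> mf mD dfD ID.
pose Dj j i x := dsoft_trunc j (f x) * D i x.
have mt j : measurable_fun setT (soft_trunc j \o f).
  exact: (measurableT_comp (measurable_soft_trunc j) mf).
have mtp1 : measurable_fun setT (fun x => pt (@tri R k m x).1.1 (tri x).1.2).
  apply: measurable_slice_pt.
    exact: (measurableT_comp (measurableT_comp measurable_fst measurable_fst) (@measurable_tri R k m)).
  exact: (measurableT_comp (measurableT_comp measurable_snd measurable_fst) (@measurable_tri R k m)).
have mtp2 : measurable_fun setT (fun x => pt (@tri R k m x).1.1 (tri x).2).
  apply: measurable_slice_pt.
    exact: (measurableT_comp (measurableT_comp measurable_fst measurable_fst) (@measurable_tri R k m)).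
  exact: (measurableT_comp measurable_snd (@measurable_tri R k m)).
have mw : measurable_fun setT (fun x => wt (@tri R k m x)).
  by apply: (measurableT_comp _ (@measurable_tri R k m)); exact: measurable_slice_weight.
have mDj j i : measurable_fun setT (Dj j i).
  by apply: measurable_funM => //; exact: (measurableT_comp (measurable_dsoft_trunc j) mf).
have DjD j i x : Dj j i x ^+ 2 <= D i x ^+ 2.
  by rewrite exprMn ler_piMl ?sqr_ge0// dsoft_trunc_sqr_le1.
set A := (_ * _)%E.
apply: (@ge0_integral_le_of_cvg _ _ R nu (fun j x => (wt (tri x) *
      ((soft_trunc j \o f) (pt (tri x).1.1 (tri x).2) -
       (soft_trunc j \o f) (pt (tri x).1.1 (tri x).1.2)) ^+ 2)%:E) _ (fun=> A) A).
- move=> j; apply/measurable_EFinP; apply: measurable_funM => //.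
  by apply: measurable_funX; apply: measurable_funB; exact: (measurableT_comp (mt j)).
- by move=> j x; rewrite lee_fin mulr_ge0 ?sqr_ge0// slice_weight_ge0.
- move=> x; apply: cvg_EFin; first exact: nearW.
  apply: cvgM; first exact: cvg_cst.
  by rewrite expr2; apply: cvgM; apply: cvgB; exact: cvg_soft_trunc.
- move=> j.
  apply: (le_trans (@slice_energy_bounded_le (soft_trunc j \o f) (Dj j) j.+1%:R (mt j) _ (mDj j) _ _)).
  + by move=> x; exact: soft_trunc_bounded.
  + by move=> x i Xx; apply: is_derive_soft_trunc; exact: dfD.
  + move=> i; apply: le_lt_trans (ID i); apply: ge0_le_integral => //.
    * by move=> x _; rewrite lee_fin mulr_ge0 ?sqr_ge0.
    * by apply/measurable_EFinP; apply: measurable_funM => //; exact: measurable_funX.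
    * by apply/measurable_EFinP; apply: measurable_funM => //; exact: measurable_funX.
    * by move=> x _; rewrite lee_fin ler_wpM2l.
  apply: lee_wpmul2l; first by rewrite lee_fin !mulr_ge0.
  have mn (E : 'I_n -> 'cV[R]_n -> R) : (forall i, measurable_fun setT (E i)) ->
      measurable_fun setT (fun x => (rho x * norm2 (W2^T *m (\col_i E i x))%R ^+ 2)%:E).
    move=> mE; apply/measurable_EFinP; apply: measurable_funM => //.
    apply: measurable_funX; apply: (measurableT_comp (@measurable_norm2 _ _)).
    apply: measurable_mulmx; apply/measurable_fun_mxP => // i j0.
    by under eq_fun do rewrite mxE; exact: mE.
  apply: ge0_le_integral => //.
  + by move=> x _; rewrite lee_fin mulr_ge0 ?sqr_ge0.
  + exact: mn.
  + exact: mn.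
  + move=> x _; rewrite lee_fin ler_wpM2l//.
    have -> : \col_i Dj j i x = dsoft_trunc j (f x) *: \col_i D i x.
      by apply/matrixP => i l; rewrite !mxE.
    rewrite -scalemxAr norm2Z exprMn real_normK ?num_real//.
    by rewrite ler_piMl ?sqr_ge0// dsoft_trunc_sqr_le1.
- exact: cvg_cst.
Qed.

End energy.

End exhaustion.

(** * The uniform law on a convex set *)

Section convexity.
Context {R : realType}.

Lemma convex_setE n (X : set 'cV[R]_n) : convex_set (X : set (convex_lmodType 'cV[R]_n)) ->
  forall x y t, X x -> X y -> 0 <= t <= 1 -> X ((1 - t) *: x + t *: y).
Proof.
move=> cX x y t Xx Xy /andP[t0 t1].
have s0 : 0 <= 1 - t by rewrite subr_ge0.
have s1 : 1 - t <= 1 by rewrite gerBl.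
have := cX x y (Itv01 s0 s1).
move=> /(_ (mem_set Xx) (mem_set Xy)) /set_mem; rewrite /conv/=.
by rewrite unstable.onemK.
Qed.

End convexity.

Section slice_geometry.
Context {R : realType} (n k m : nat) (km : (k + m)%N = n).
Variables (W1 : 'M[R]_(n, k)) (W2 : 'M[R]_(n, m)).
Hypothesis oW : orthogonal_mx (hblock_mx km W1 W2).
Local Notation pt := (slice_pt W1 W2).

Lemma norm2_slice_pt y z : norm2 (pt y z) ^+ 2 = norm2 y ^+ 2 + norm2 z ^+ 2.
Proof.
rewrite /slice_pt hblock_mulE norm2_orth// !norm2_sqr.
case: _ / km; rewrite castmx_id big_split_ord/=; congr (_ + _).
  by apply: eq_bigr => i _; rewrite col_mxEu.
by apply: eq_bigr => i _; rewrite col_mxEd.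
Qed.

Lemma norm2_slice_ptr y z : norm2 z <= norm2 (pt y z).
Proof.
by rewrite -(ler_pXn2r (n := 2))// ?nnegrE ?norm2_ge0// norm2_slice_pt lerDr sqr_ge0.
Qed.

Lemma slice_pt_comb y z z' (t : R) :
  pt y ((1 - t) *: z + t *: z') = (1 - t) *: pt y z + t *: pt y z'.
Proof.
rewrite /slice_pt mulmxDr -!scalemxAr !scalerDr addrACA -scalerDl.
by rewrite (_ : 1 - t + t = 1) ?scale1r//; ring.
Qed.

End slice_geometry.

Section uniform_case.
Context {R : realType} (n : nat) (X : set 'cV[R]_n) (rho : 'cV[R]_n -> R) (c d0 r0 : R)
  (x0 : 'cV[R]_n).
Hypotheses (oX : open X)
  (cX : forall x y t, X x -> X y -> 0 <= t <= 1 -> X ((1 - t) *: x + t *: y))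
  (dX : forall x, X x -> norm2 x <= d0)
  (c0 : 0 < c) (rhoX : forall x, X x -> rho x = c) (rhoNX : forall x, ~ X x -> rho x = 0)
  (d00 : 0 <= d0) (r00 : 0 < r0) (Xx0 : forall v, norm2 v <= r0 -> X (x0 + v)).

(** Starting at 1/2 keeps the ratio [1 - th j] positive for every [j]. *)
Let th (j : nat) : R := (j.+2%:R)^-1.

Let th0 j : 0 < th j. Proof. by rewrite invr_gt0. Qed.

Let th1 j : th j < 1.
Proof. by rewrite /th invf_lt1// (ltr_nat _ 1). Qed.

(** The contraction of [X] towards [x0] with ratio 1 - t, written as a preimage so that
    measurability is immediate. *)
Definition homothety (t : R) : set 'cV[R]_n :=
  [set x | X (x0 + (1 - t)^-1 *: (x - x0))].

Lemma measurable_homothety t : measurable (homothety t).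
Proof.
rewrite -[X in measurable X]setTI /homothety.
have mf : measurable_fun setT (fun x : 'cV[R]_n => x0 + (1 - t)^-1 *: (x - x0)).
  apply: measurable_addmx => //; apply: (measurable_scalemx (s := cst (1 - t)^-1)) => //.
  by apply: (measurable_addmx (g := cst (- x0))).
by apply: (mf measurableT X); exact: open_measurable_mx.
Qed.

(** [x + v] is the convex combination, with weights 1 - t and t, of a point of [X] and of x0 + v /
    t, which lies in the ball of radius [r0] about [x0]. *)
Lemma homothety_interior t x v : 0 < t < 1 -> homothety t x -> norm2 v <= t * r0 -> X (x + v).
Proof.
move=> /andP[t0 t1] Sx vt.
have t1' : 1 - t != 0 by rewrite gt_eqF// subr_gt0.
have -> : x + v = (1 - t) *: (x0 + (1 - t)^-1 *: (x - x0)) + t *: (x0 + t^-1 *: v).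
  rewrite !scalerDr !scalerA !divff ?gt_eqF ?subr_gt0// !scale1r.
  by rewrite scalerBl scale1r addrACA subrK addrA [x0 + (x - _)]addrC subrK.
apply: cX => //; last by rewrite !ltW.
apply: Xx0; rewrite norm2Z ger0_norm; last by rewrite invr_ge0 ltW.
by rewrite mulrC ler_pdivrMr// mulrC.
Qed.

Lemma homothety_sub t x : 0 < t < 1 -> homothety t x -> X x.
Proof.
move=> t01 Sx; rewrite -[x]addr0; apply: (homothety_interior t01 Sx).
rewrite /norm2 big1 ?sqrtr0; first by rewrite mulr_ge0// ltW//; case/andP: t01.
by move=> i _; rewrite mxE expr0n.
Qed.

Lemma homothety_convex t x y s : homothety t x -> homothety t y -> 0 <= s <= 1 ->
  homothety t ((1 - s) *: x + s *: y).
Proof.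
move=> Sx Sy s01; rewrite /homothety/=.
have -> : x0 + (1 - t)^-1 *: ((1 - s) *: x + s *: y - x0) =
  (1 - s) *: (x0 + (1 - t)^-1 *: (x - x0)) + s *: (x0 + (1 - t)^-1 *: (y - x0)).
  apply/matrixP => i j; rewrite !mxE; ring.
exact: cX.
Qed.

Lemma homothety_exhaust x : X x -> \forall j \near \oo, homothety (th j) x.
Proof.
move=> Xx.
suff : (fun j => x0 + (1 - th j)^-1 *: (x - x0)) @ \oo --> x.
  by move=> /(_ X); apply; exact: open_nbhs_nbhs.
have cs : (1 - th j)^-1 @[j --> \oo] --> (1 : R).
  rewrite -[X in _ --> X]invr1 -[X in X^-1](subr0 1).
  apply: cvgV; first by rewrite subr0 oner_neq0.
  apply: cvgB; first exact: cvg_cst.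
  have := @cvg_harmonic R; rewrite -(cvg_shiftS (@harmonic R)); apply: cvg_trans.
  by apply: near_eq_cvg; exact: nearW.
have := cvgD (cvg_cst x0) (cvgZr_tmp (a := x - x0) cs).
by rewrite scale1r subrKC => /(_ _ _ _); apply.
Qed.

Variables (k m : nat) (km : (k + m)%N = n) (W1 : 'M[R]_(n, k)) (W2 : 'M[R]_(n, m)).
Hypothesis oW : orthogonal_mx (hblock_mx km W1 W2).
Hypothesis mrho : measurable_fun setT rho.
Local Notation triple := (('cV[R]_k * 'cV[R]_m) * 'cV[R]_m)%type.
Local Notation pt := (slice_pt W1 W2).
Local Notation wt := (slice_weight W1 W2 rho).

Let rho0 x : 0 <= rho x.
Proof. by have [/rhoX ->|/rhoNX -> //] := pselect (X x); exact: ltW. Qed.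

Definition slice_pairs (S : set 'cV[R]_n) : set triple :=
  [set p | S (pt p.1.1 p.1.2) /\ S (pt p.1.1 p.2)].

Lemma measurable_slice_pairs S : measurable S -> measurable (slice_pairs S).
Proof.
move=> mS.
have -> : slice_pairs S = ((fun p : triple => pt p.1.1 p.1.2) @^-1` S) `&`
  ((fun p : triple => pt p.1.1 p.2) @^-1` S) by apply/seteqP; split.
apply: measurableI; rewrite -[X in measurable X]setTI.
  have mf : measurable_fun setT (fun p : triple => pt p.1.1 p.1.2).
    apply: measurable_slice_pt; first exact: (measurableT_comp measurable_fst measurable_fst).
    exact: (measurableT_comp measurable_snd measurable_fst).
  by apply: (mf measurableT S).
have mf : measurable_fun setT (fun p : triple => pt p.1.1 p.2).
  apply: measurable_slice_pt; first exact: (measurableT_comp measurable_fst measurable_fst).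
  exact: measurable_snd.
by apply: (mf measurableT S).
Qed.

(** On the slice [K] of [S] the weight is the constant c^2 / a, and [uniform_slice] contributes the
    measure of [K]. By [slice_mass_le], c / a times that measure is at most one; the remaining [c]
    rebuilds [rho], and only the diameter bound [2 * d0] is left in the constant. *)
Lemma uniform_poincare (S : set 'cV[R]_n) : measurable S -> S `<=` X ->
  (forall x y t, S x -> S y -> 0 <= t <= 1 -> S ((1 - t) *: x + t *: y)) ->
  slice_poincare W1 W2 rho S (slice_pairs S) (4 * ((2 * d0) ^+ 2 * 2 ^+ m)).
Proof.
move=> mS SX cS h A mh mA pd.
pose F (p : triple) : \bar R := (wt p * \1_(slice_pairs S) p *
  (h (pt p.1.1 p.2) - h (pt p.1.1 p.1.2)) ^+ 2)%:E.
have mp1 : measurable_fun setT (fun p : triple => pt p.1.1 p.1.2).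
  apply: measurable_slice_pt; first exact: (measurableT_comp measurable_fst measurable_fst).
  exact: (measurableT_comp measurable_snd measurable_fst).
have mp2 : measurable_fun setT (fun p : triple => pt p.1.1 p.2).
  apply: measurable_slice_pt; first exact: (measurableT_comp measurable_fst measurable_fst).
  exact: measurable_snd.
have mF : measurable_fun setT F.
  apply/measurable_EFinP; apply: measurable_funM.
    apply: measurable_funM; first exact: measurable_slice_weight.
    by apply: measurable_indic; exact: measurable_slice_pairs.
  by apply: measurable_funX; apply: measurable_funB; exact: (measurableT_comp mh).
have F0 p : (0 <= F p)%E.
  by rewrite lee_fin mulr_ge0 ?sqr_ge0// mulr_ge0// slice_weight_ge0.
have -> := ge0_integral_tri mF F0.
pose G0 x := norm2 (W2^T *m A x) ^+ 2.
have mG0 : measurable_fun setT G0.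
  apply: measurable_funX; apply: (measurableT_comp (@measurable_norm2 _ _)).
  exact: measurable_mulmx.
pose H x : \bar R := (rho x * G0 x * \1_S x)%:E.
have mH : measurable_fun setT H.
  apply/measurable_EFinP; apply: measurable_funM; first exact: measurable_funM.
  exact: measurable_indic.
have H0 x : (0 <= H x)%E by rewrite lee_fin mulr_ge0// mulr_ge0// sqr_ge0.
have -> : (\int[lebesgue_vec n]_(x in S) (rho x * norm2 (W2^T *m A x)%R ^+ 2)%:E =
    \int[lebesgue_vec n]_x H x)%E.
  rewrite [LHS]integral_mkcond; apply: eq_integral => x _.
  by rewrite patchE /H indicE; case: ifP => _; rewrite ?mulr1 ?mulr0.
rewrite -(ge0_integral_hblock oW mH H0).
set Cp := 4 * _.
have Cp0 : 0 <= Cp by rewrite /Cp !mulr_ge0// ?sqr_ge0// exprn_ge0.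
have mHp : measurable_fun setT (fun p : 'cV[R]_k * 'cV[R]_m => H (pt p.1 p.2)).
  by apply: (measurableT_comp mH); exact: measurable_slice_pt.
have mI : measurable_fun setT (fun y => \int[lebesgue_vec m]_z H (pt y z))%E.
  apply: (@measurable_fubini_domain _ _ _ _ R (lebesgue_vec m) setT
    (fun p : 'cV[R]_k * 'cV[R]_m => H (pt p.1 p.2))) => //.
  exact: measurable_funTS.
have I0 y : (0 <= \int[lebesgue_vec m]_z H (pt y z))%E by apply: integral_ge0.
rewrite -(ge0_integralZl (lebesgue_vec k) measurableT mI (fun y _ => I0 y)); last by rewrite lee_fin.
have mF1 : measurable_fun setT (fun p => \int[lebesgue_vec m]_z' F (p, z'))%E.
  by apply: (@measurable_fubini_domain _ _ _ _ R (lebesgue_vec m) setT F) => //; exact: measurable_funTS.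
have F10 p : (0 <= \int[lebesgue_vec m]_z' F (p, z'))%E by apply: integral_ge0.
apply: ge0_le_integral => //.
- by move=> y _; apply: integral_ge0.
- apply: (@measurable_fubini_domain _ _ _ _ R (lebesgue_vec m) setT
    (fun p => \int[lebesgue_vec m]_z' F (p, z'))%E) => //.
  exact: measurable_funTS.
- exact: measurable_funeM.
move=> y _.
pose a := active_density rho W1 W2 y.
have a0 : 0 <= a by exact: active_density_ge0.
pose K := [set z | S (pt y z)].
have my : measurable_fun setT (pt y) by exact: measurable_slice_pt.
have mK : measurable K.
  by rewrite -[X in measurable X]setTI; apply: (my measurableT S).
pose phi z := h (pt y z); pose G z := G0 (pt y z).
have mphi : measurable_fun setT phi by exact: (measurableT_comp mh).
have mG : measurable_fun setT G by exact: (measurableT_comp mG0).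
have G00 z : 0 <= G z by rewrite sqr_ge0.
pose w := c * c / a.
have w0 : 0 <= w by rewrite !mulr_ge0 ?invr_ge0// ltW.
have Kd z z' : K z -> K z' -> norm2 (z' - z) <= 2 * d0.
  move=> Kz Kz'; apply: le_trans (norm2D _ _) _; rewrite norm2N mulrDl mul1r; apply: lerD.
    by apply: le_trans (norm2_slice_ptr oW y z') _; apply: dX; exact: SX.
  by apply: le_trans (norm2_slice_ptr oW y z) _; apply: dX; exact: SX.
have cK z z' t : K z -> K z' -> 0 <= t <= 1 -> K ((1 - t) *: z + t *: z').
  by move=> Kz Kz' t01; rewrite /K/= slice_pt_comb; exact: cS.
have FE z z' : F (y, z, z') = (w%:E * ((phi z' - phi z) ^+ 2 * \1_K z * \1_K z')%:E)%E.
  rewrite -EFinM /F /phi/=; congr EFin.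
  have [[/= S1 S2]|nS] := pselect (slice_pairs S (y, z, z')).
    rewrite !indicE !mem_set// !mulr1; congr (_ * _).
    by rewrite /slice_weight/= !rhoX//; exact: SX.
  rewrite [\1_(slice_pairs S) _]indicE memNset// mulr0 mul0r !indicE.
  have [Kz|nKz] := pselect (K z); last by rewrite [z \in K]memNset// mulr0 mul0r mulr0.
  have [Kz'|nKz'] := pselect (K z'); last by rewrite [z' \in K]memNset// mulr0 mulr0.
  by exfalso; apply: nS.
have U := @uniform_slice R m K phi G (2 * d0) mK mphi mG G00 (mulr_ge0 (ler0n _ 2) d00) cK Kd.
have IE : (\int[lebesgue_vec m]_z \int[lebesgue_vec m]_z' F (y, z, z') =
   w%:E * \int[lebesgue_vec m]_(z in K) \int[lebesgue_vec m]_(z' in K) ((phi z' - phi z) ^+ 2)%:E)%E.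
  have m2 : measurable_fun setT (fun p : 'cV[R]_m * 'cV[R]_m =>
      ((phi p.2 - phi p.1) ^+ 2 * \1_K p.1 * \1_K p.2)%:E).
    apply/measurable_EFinP; apply: measurable_funM.
      apply: measurable_funM.
        apply: measurable_funX; apply: measurable_funB; exact: (measurableT_comp mphi).
      exact: (measurableT_comp (measurable_indic mK)).
    exact: (measurableT_comp (measurable_indic mK)).
  have n2 p : (0 <= ((phi p.2 - phi p.1) ^+ 2 * \1_K p.1 * \1_K p.2)%:E :> \bar R)%E.
    by rewrite lee_fin mulr_ge0// mulr_ge0// sqr_ge0.
  have -> : (\int[lebesgue_vec m]_z \int[lebesgue_vec m]_z' F (y, z, z') =
     \int[lebesgue_vec m]_z (w%:E * \int[lebesgue_vec m]_z'
        ((phi z' - phi z) ^+ 2 * \1_K z * \1_K z')%:E))%E.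
    apply: eq_integral => z _; under eq_integral do rewrite FE.
    apply: (ge0_integralZl (lebesgue_vec m) measurableT).
    - exact: (measurableT_comp m2 (pair1_measurable z)).
    - by move=> z' _; exact: (n2 (z, z')).
    - by rewrite lee_fin.
  rewrite (ge0_integralZl (lebesgue_vec m) measurableT); last 3 first.
  - apply: (@measurable_fubini_domain _ _ _ _ R (lebesgue_vec m) setT
      (fun p : 'cV[R]_m * 'cV[R]_m => ((phi p.2 - phi p.1) ^+ 2 * \1_K p.1 * \1_K p.2)%:E)) => //.
    exact: measurable_funTS.
  - by move=> z _; apply: integral_ge0 => z' _; exact: (n2 (z, z')).
  - by rewrite lee_fin.
  congr (_ * _)%E; rewrite [RHS]integral_mkcond; apply: eq_integral => z _.
  rewrite patchE indicE; case: ifP => _; last first.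
    by under eq_integral do rewrite mulr0 mul0r; rewrite integral0.
  rewrite [RHS]integral_mkcond; apply: eq_integral => z' _.
  by rewrite patchE indicE; case: ifP => _; rewrite ?mulr1 ?mulr0.
rewrite IE.
apply: (@le_trans _ _ (w%:E * (Cp%:E * (lebesgue_vec m K * \int[lebesgue_vec m]_(z in K) (G z)%:E)))%E).
  apply: lee_wpmul2l; first by rewrite lee_fin.
  apply: U => z z' Kz Kz'.
  have dal (t : R) : is_derive t 1 (fun t : R => 1 - t) (cst (-1) t).
    rewrite (_ : (fun t => 1 - t) = (cst 1 : R -> R) - id); last by apply/funext.
    by apply: is_derive_eq; rewrite sub0r.
  have bnd (t : R) : -1 < t < 2^-1 + 1 ->
      [/\ `|1 - t| <= 2, `|t| <= 2, `|cst (-1) t : R| <= 2 & `|cst 1 t : R| <= 2].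
    by move=> /andP[t1 t2]; split; rewrite /cst /= ?normrN ?normr1 ?ler_norml; try (apply/andP; split); lra.
  have mal : measurable_fun (setT : set (measurableTypeR R)) (fun t : R => 1 - t).
    exact: measurable_funB.
  have half0 : 0 < 2^-1 :> R by rewrite invr_gt0.
  have Sp (t : R) : 0 <= t <= 2^-1 -> S (pt y ((1 - t) *: z + t *: z')).
    move=> /andP[t0 t1]; rewrite slice_pt_comb; apply: cS => //.
    by rewrite t0/=; lra.
  (* The path runs along the segment up to the midpoint; 2 bounds the coefficients and their
     derivatives on ]-1, 3/2[. *)
  have P := @path_sqr_le R n k m W1 W2 S h A (fun t => 1 - t) id (cst (-1)) (cst 1) 2^-1 2 y z z'
    pd mA half0 dal (fun t => is_derive_id t 1) bnd mal (@measurable_id _ _ setT) (measurable_cst _)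
    (measurable_cst _) Sp.
  move: P; rewrite subr0 scale1r scale0r addr0.
  rewrite (_ : 1 - 2^-1 = 2^-1 :> R); last by field.
  move=> /le_trans; apply; rewrite le_eqVlt; apply/orP; left; apply/eqP.
  congr (_ * _)%E; apply: eq_integral => t _; rewrite /cst scaleN1r scale1r [- z + _]addrC //.
rewrite muleCA; apply: lee_wpmul2l; first by rewrite lee_fin.
have cK1 : ((a^-1)%:E * (c%:E * lebesgue_vec m K) <= 1)%E.
  apply: le_trans (slice_mass_le W1 W2 rho0 y).
  apply: lee_wpmul2l; first by rewrite lee_fin invr_ge0.
  have -> : (c%:E * lebesgue_vec m K = \int[lebesgue_vec m]_z (c * \1_K z)%:E)%E.
    under eq_integral do rewrite EFinM.
    rewrite ge0_integralZl//; last 2 first.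
      by apply/measurable_EFinP; exact: measurable_indic.
      by rewrite lee_fin ltW.
    by rewrite integral_indic// setIT.
  apply: ge0_le_integral => //.
  - by move=> z _; rewrite lee_fin mulr_ge0// ltW.
  - by apply/measurable_EFinP; apply: measurable_funM => //; exact: measurable_indic.
  - by apply/measurable_EFinP; exact: (measurableT_comp mrho).
  - move=> z _; rewrite lee_fin indicE; have [Kz|nKz] := pselect (K z).
      by rewrite mem_set// mulr1 rhoX//; exact: SX.
    by rewrite memNset// mulr0.
have -> : (\int[lebesgue_vec m]_z H (pt y z) = c%:E * \int[lebesgue_vec m]_(z in K) (G z)%:E)%E.
  rewrite -ge0_integralZl//; last 3 first.
  - by apply/measurable_EFinP; exact: measurable_funTS.
  - by move=> z _; rewrite lee_fin.
  - by rewrite lee_fin ltW.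
  rewrite [RHS]integral_mkcond; apply: eq_integral => z _.
  rewrite patchE /H indicE; have [Kz|nKz] := pselect (K z).
    by rewrite !mem_set// mulr1 rhoX// -?EFinM//; exact: SX.
  by rewrite !memNset// mulr0.
rewrite /w -mulrA EFinM -muleA; apply: lee_wpmul2l; first by rewrite lee_fin ltW.
rewrite mulrC EFinM -muleA muleA.
rewrite -[leRHS]mul1e muleA; apply: lee_wpmul2r; last by rewrite -muleA.
by apply: integral_ge0 => z _; rewrite lee_fin.
Qed.

(** A constant density compares with its translates inside [X] with K = 1, and the contracted copies
    of [X] have margin [th j * r0]. *)
Lemma uniform_exhausted : slice_exhausted W1 W2 rho X 1 (4 * ((2 * d0) ^+ 2 * 2 ^+ m)).
Proof.
have th01 j : 0 < th j < 1 by rewrite th0 th1.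
exists (fun j => th j * r0), (fun j => homothety (th j)), (fun j => slice_pairs (homothety (th j))).
split.
- by move=> j; rewrite mulr_gt0.
- rewrite -(mul0r r0); apply: cvgM; last exact: cvg_cst.
  have := @cvg_harmonic R; rewrite -(cvg_shiftS (@harmonic R)); apply: cvg_trans.
  by apply: near_eq_cvg; exact: nearW.
- move=> j; split.
  + exact: measurable_homothety.
  + by move=> x v Sx vd; exact: (homothety_interior (th01 j) Sx vd).
  + move=> x v Sx vd; rewrite mul1r !rhoX//; first exact: (homothety_interior (th01 j) Sx vd).
    exact: (homothety_sub (th01 j) Sx).
  + by move=> x /(homothety_sub (th01 j)) /rhoX ->.
- move=> j; split => //.
    by apply: measurable_slice_pairs; exact: measurable_homothety.
  apply: uniform_poincare; first exact: measurable_homothety.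
    by move=> x; exact: homothety_sub.
  by move=> x y t; exact: homothety_convex.
- move=> p wp.
  have Xp z : rho (pt p.1.1 z) != 0 -> X (pt p.1.1 z).
    by move=> rz; apply/not_notP => /rhoNX rz0; rewrite rz0 eqxx in rz.
  have : wt p != 0 by rewrite gt_eqF.
  rewrite /slice_weight !mulf_eq0 !negb_or => /andP[/andP[/Xp X1 /Xp X2] _].
  near=> j; split; near: j; exact: homothety_exhaust.
Unshelve. all: by end_near.
Qed.

End uniform_case.

(** * The standard normal law *)

Section gaussian_weight.
Context {R : realType}.

Definition gauss n (x : 'cV[R]_n) : R := expR (- (norm2 x ^+ 2) / 2).

Lemma gauss_gt0 n (x : 'cV[R]_n) : 0 < gauss x.
Proof. exact: expR_gt0. Qed.

Lemma measurable_gauss n : measurable_fun setT (@gauss n).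
Proof.
apply: (measurableT_comp (@measurable_expR R)); apply: measurable_funM => //.
apply: measurableT_comp => //; apply: measurable_funX; exact: measurable_norm2.
Qed.

Definition gauss_mass n : \bar R := \int[lebesgue_vec n]_x (gauss x)%:E.

Lemma gauss_mass_ge0 n : (0 <= gauss_mass n)%E.
Proof. by apply: integral_ge0 => x _; rewrite lee_fin ltW// gauss_gt0. Qed.

(* u exp(-u/2) <= 4 exp(-u/4), and the right-hand side is a rescaled Gaussian. *)
Lemma gauss_second_moment_le m :
  (\int[lebesgue_vec m]_z (gauss z * norm2 z ^+ 2)%:E <= (4 * 2 ^+ m)%:E * gauss_mass m)%E.
Proof.
pose s : R := (Num.sqrt 2)^-1.
have s2 : 0 < Num.sqrt 2 :> R by rewrite sqrtr_gt0.
have s0 : 0 < s by rewrite invr_gt0.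
have g0 (z : 'cV[R]_m) : (0 <= (gauss z)%:E)%E by rewrite lee_fin ltW// gauss_gt0.
have mg : measurable_fun setT (fun z : 'cV[R]_m => (gauss z)%:E).
  by apply/measurable_EFinP; exact: measurable_gauss.
have ms : measurable_fun setT (fun z : 'cV[R]_m => (gauss (s *: z))%:E).
  by apply: (measurableT_comp mg); exact: (measurable_scalemx (s := cst s)).
apply: (@le_trans _ _ (\int[lebesgue_vec m]_z (4%:E * (gauss (s *: z))%:E))%E).
  apply: ge0_le_integral => //.
  - by move=> z _; rewrite lee_fin mulr_ge0 ?sqr_ge0// ltW// gauss_gt0.
  - apply/measurable_EFinP; apply: measurable_funM; first exact: measurable_gauss.
    by apply: measurable_funX; exact: measurable_norm2.
  - exact: measurable_funeM.
  - move=> z _; rewrite -EFinM lee_fin /gauss norm2Z exprMn real_normK ?num_real//.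
    have -> : s ^+ 2 = 2^-1 by rewrite /s exprVn (sqr_sqrtr (ler0n R 2)).
    set u := norm2 z ^+ 2.
    have -> : - u / 2 = - (2^-1 * u) / 2 - u / 4 by field.
    rewrite expRD -mulrA mulrC ler_wpM2r ?expR_ge0//.
    rewrite expRN mulrC ler_pdivrMr ?expR_gt0//.
    by have := expR_ge1Dx (u / 4); lra.
have four0 : (0 <= (4 : R)%:E)%E by rewrite lee_fin.
rewrite (ge0_integralZl _ measurableT ms (fun z _ => g0 (s *: z)) four0).
rewrite EFinM -muleA; apply: lee_wpmul2l => //.
have -> := @ge0_integral_scale R m s (fun z => (gauss z)%:E) s0 mg g0.
rewrite /s -/(gauss_mass m) exprVn invrK; apply: lee_wpmul2r; first exact: gauss_mass_ge0.
rewrite lee_fin; apply: lerXn2r; rewrite ?nnegrE ?sqrtr_ge0//.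
by rewrite -ler_sqr ?nnegrE ?sqrtr_ge0// (sqr_sqrtr (ler0n R 2)) expr2; lra.
Qed.

End gaussian_weight.

Section gaussian_case.
Context {R : realType} (n : nat) (rho : 'cV[R]_n -> R) (c : R).
Hypotheses (c0 : 0 < c) (rhoE : forall x, rho x = c * gauss x)
  (rho1 : (\int[lebesgue_vec n]_x (rho x)%:E = 1)%E).
Variables (k m : nat) (km : (k + m)%N = n) (W1 : 'M[R]_(n, k)) (W2 : 'M[R]_(n, m)).
Hypothesis oW : orthogonal_mx (hblock_mx km W1 W2).
Local Notation triple := (('cV[R]_k * 'cV[R]_m) * 'cV[R]_m)%type.
Local Notation pt := (slice_pt W1 W2).
Local Notation wt := (slice_weight W1 W2 rho).

Let rho_gt0 x : 0 < rho x.
Proof. by rewrite rhoE mulr_gt0// gauss_gt0. Qed.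

Let rho0 x : 0 <= rho x.
Proof. exact: ltW. Qed.

Let mrho : measurable_fun setT rho.
Proof.
rewrite (_ : rho = fun x => c * gauss x); last exact/funext.
by apply: measurable_funM => //; exact: measurable_gauss.
Qed.

Lemma gauss_slice_pt y z : gauss (pt y z) = gauss y * gauss z.
Proof. by rewrite /gauss (norm2_slice_pt oW) -expRD; congr expR; field. Qed.

(** Tonelli factorises the total mass: 1 = c * gauss_mass k * gauss_mass m, so neither factor is 0
    or infinite. The Gaussian integral itself is never evaluated. *)
Lemma gauss_mass_fin : exists2 I : R, 0 < I & gauss_mass m = I%:E.
Proof.
have mr : measurable_fun setT (fun x => (rho x)%:E) by exact/measurable_EFinP.
have := ge0_integral_hblock oW mr (fun x => rho0 x).
rewrite rho1.
have mg p : measurable_fun setT (fun z : 'cV[R]_p => (gauss z)%:E).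
  by apply/measurable_EFinP; exact: measurable_gauss.
have g0 p (z : 'cV[R]_p) : (0 <= (gauss z)%:E)%E by rewrite lee_fin ltW// gauss_gt0.
have -> : (\int[lebesgue_vec k]_y \int[lebesgue_vec m]_z (rho (W1 *m y + W2 *m z)%R)%:E =
    \int[lebesgue_vec k]_y ((c%:E * gauss_mass m) * (gauss y)%:E))%E.
  apply: eq_integral => y _.
  transitivity (\int[lebesgue_vec m]_z ((c * gauss y)%:E * (gauss z)%:E))%E.
    by apply: eq_integral => z _; rewrite rhoE -/(pt y z) gauss_slice_pt mulrA EFinM.
  rewrite (ge0_integralZl _ measurableT (mg m) (fun z _ => g0 m z)); last first.
    by rewrite lee_fin mulr_ge0// ltW// gauss_gt0.
  by rewrite EFinM -muleA [X in (_ * X)%E]muleC muleA.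
have M0 := gauss_mass_ge0 m : (0 <= gauss_mass m :> \bar R)%E.
have M0' := gauss_mass_ge0 k : (0 <= gauss_mass k :> \bar R)%E.
rewrite (ge0_integralZl _ measurableT (mg k) (fun z _ => g0 k z)); last first.
  by rewrite mule_ge0// lee_fin ltW.
rewrite -/(gauss_mass k) => E.
have Mn0 : gauss_mass m != 0 :> \bar R.
  by apply/eqP => M; move: E; rewrite M mule0 mul0e => /eqP; rewrite eq_sym onee_eq0.
case EM : (gauss_mass m : \bar R) M0 Mn0 => [I||] // M0 Mn0.
  by exists I => //; rewrite lt_neqAle eq_sym -lee_fin M0 andbT.
move: E; rewrite EM gt0_muley ?lte_fin//.
have [->|k0] := eqVneq (gauss_mass k : \bar R) 0%E.
  by rewrite mule0 => /eqP; rewrite eq_sym onee_eq0.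
by rewrite gt0_mulye// lt_neqAle eq_sym k0.
Qed.

Lemma active_density_gauss (I : R) y : gauss_mass m = I%:E ->
  active_density rho W1 W2 y = c * gauss y * I.
Proof.
move=> IE; rewrite /active_density /Rintegral.
have -> : (\int[lebesgue_vec m]_z (rho (W1 *m y + W2 *m z)%R)%:E = (c * gauss y)%:E * gauss_mass m)%E.
  rewrite -ge0_integralZl//.
  - by apply: eq_integral => z _; rewrite rhoE -/(pt y z) gauss_slice_pt mulrA EFinM.
  - by apply/measurable_EFinP; exact: measurable_gauss.
  - by move=> z _; rewrite lee_fin ltW// gauss_gt0.
  - by rewrite lee_fin mulr_ge0// ltW// gauss_gt0.
by rewrite IE.
Qed.

(** This sum of squares is invariant under rotating (z, z'), so the whole path joining an admissible
    pair stays in the ball of radius [r]. End points in the ball would not ensure this: for z = z'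
    the path reaches the length of [z] times the square root of 2. *)
Definition gauss_pairs (r : R) : set triple :=
  [set p | norm2 p.1.1 ^+ 2 + norm2 p.1.2 ^+ 2 + norm2 p.2 ^+ 2 <= r ^+ 2].

Lemma measurable_gauss_pairs r : measurable (gauss_pairs r).
Proof.
have mf : measurable_fun setT (fun p : triple =>
    norm2 p.1.1 ^+ 2 + norm2 p.1.2 ^+ 2 + norm2 p.2 ^+ 2).
  apply: measurable_funD; last first.
    apply: measurable_funX; apply: (measurableT_comp (@measurable_norm2 _ _)).
    exact: measurable_snd.
  apply: measurable_funD; apply: measurable_funX; apply: (measurableT_comp (@measurable_norm2 _ _)).
    exact: (measurableT_comp measurable_fst measurable_fst).
  exact: (measurableT_comp measurable_snd measurable_fst).
rewrite -[X in measurable X]setTI.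
have -> : gauss_pairs r = (fun p : triple =>
    norm2 p.1.1 ^+ 2 + norm2 p.1.2 ^+ 2 + norm2 p.2 ^+ 2) @^-1` `]-oo, r ^+ 2].
  by apply/seteqP; split => x /=; rewrite in_itv.
exact: mf.
Qed.

(** For frozen [y] the weight is a function of |z|^2 + |z'|^2, so [gaussian_slice] applies. The
    squared velocity then integrates to at most 4 * 2^m times [gauss_mass m], and this mass cancels
    against the one in the active density. *)
Lemma gaussian_poincare (r : R) : 0 <= r ->
  slice_poincare W1 W2 rho (euclidean_ball r) (gauss_pairs r)
    ((pi / 2) ^+ 2 * (4 * 2 ^+ m)).
Proof.
move=> r0 h A mh mA pd.
have [I I0 IE] := gauss_mass_fin.
pose S := (@euclidean_ball R n r).
have mS : measurable S by exact: measurable_euclidean_ball.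
have mT := measurable_gauss_pairs r.
pose F (p : triple) : \bar R := (wt p * \1_(gauss_pairs r) p *
  (h (pt p.1.1 p.2) - h (pt p.1.1 p.1.2)) ^+ 2)%:E.
have mp1 : measurable_fun setT (fun p : triple => pt p.1.1 p.1.2).
  apply: measurable_slice_pt; first exact: (measurableT_comp measurable_fst measurable_fst).
  exact: (measurableT_comp measurable_snd measurable_fst).
have mp2 : measurable_fun setT (fun p : triple => pt p.1.1 p.2).
  apply: measurable_slice_pt; first exact: (measurableT_comp measurable_fst measurable_fst).
  exact: measurable_snd.
have mF : measurable_fun setT F.
  apply/measurable_EFinP; apply: measurable_funM.
    by apply: measurable_funM; [exact: measurable_slice_weight|exact: measurable_indic].
  by apply: measurable_funX; apply: measurable_funB; exact: (measurableT_comp mh).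
have F0 p : (0 <= F p)%E.
  by rewrite lee_fin mulr_ge0 ?sqr_ge0// mulr_ge0// slice_weight_ge0.
have -> := ge0_integral_tri mF F0.
pose G0 x := norm2 (W2^T *m A x) ^+ 2.
have mG0 : measurable_fun setT G0.
  apply: measurable_funX; apply: (measurableT_comp (@measurable_norm2 _ _)).
  exact: measurable_mulmx.
pose H x : \bar R := (rho x * G0 x * \1_S x)%:E.
have mH : measurable_fun setT H.
  apply/measurable_EFinP; apply: measurable_funM; first exact: measurable_funM.
  exact: measurable_indic.
have H0 x : (0 <= H x)%E by rewrite lee_fin mulr_ge0// mulr_ge0// sqr_ge0.
have -> : (\int[lebesgue_vec n]_(x in euclidean_ball r) (rho x * norm2 (W2^T *m A x)%R ^+ 2)%:E =
    \int[lebesgue_vec n]_x H x)%E.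
  rewrite [LHS]integral_mkcond; apply: eq_integral => x _.
  by rewrite patchE /H indicE; case: ifP => _; rewrite ?mulr1 ?mulr0.
rewrite -(ge0_integral_hblock oW mH H0).
set Cp := _ ^+ 2 * _.
have Cp0 : 0 <= Cp by rewrite mulr_ge0 ?sqr_ge0// mulr_ge0// exprn_ge0.
have mHp : measurable_fun setT (fun p : 'cV[R]_k * 'cV[R]_m => H (pt p.1 p.2)).
  by apply: (measurableT_comp mH); exact: measurable_slice_pt.
have mI : measurable_fun setT (fun y => \int[lebesgue_vec m]_z H (pt y z))%E.
  apply: (@measurable_fubini_domain _ _ _ _ R (lebesgue_vec m) setT
    (fun p : 'cV[R]_k * 'cV[R]_m => H (pt p.1 p.2))) => //.
  exact: measurable_funTS.
have HI0 y : (0 <= \int[lebesgue_vec m]_z H (pt y z))%E by apply: integral_ge0.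
rewrite -(ge0_integralZl (lebesgue_vec k) measurableT mI (fun y _ => HI0 y)); last by rewrite lee_fin.
have mF1 : measurable_fun setT (fun p => \int[lebesgue_vec m]_z' F (p, z'))%E.
  by apply: (@measurable_fubini_domain _ _ _ _ R (lebesgue_vec m) setT F) => //; exact: measurable_funTS.
have F10 p : (0 <= \int[lebesgue_vec m]_z' F (p, z'))%E by apply: integral_ge0.
apply: ge0_le_integral => //.
- by move=> y _; apply: integral_ge0.
- apply: (@measurable_fubini_domain _ _ _ _ R (lebesgue_vec m) setT
    (fun p => \int[lebesgue_vec m]_z' F (p, z'))%E) => //.
  exact: measurable_funTS.
- exact: measurable_funeM.
move=> y _.
have my : measurable_fun setT (pt y) by exact: measurable_slice_pt.
pose phi z := h (pt y z); pose G z := G0 (pt y z).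
have mphi : measurable_fun setT phi by exact: (measurableT_comp mh).
have mG : measurable_fun setT G by exact: (measurableT_comp mG0).
have G00 z : 0 <= G z by rewrite sqr_ge0.
pose Q := [set q : R | norm2 y ^+ 2 + q <= r ^+ 2].
have mQ : measurable Q.
  have mf : measurable_fun setT (fun q : R => norm2 y ^+ 2 + q) by exact: measurable_funD.
  rewrite -[X in measurable X]setTI.
  have -> : Q = (fun q : R => norm2 y ^+ 2 + q) @^-1` `]-oo, r ^+ 2].
    by apply/seteqP; split => x /=; rewrite in_itv.
  exact: mf.
(* The active density is c * gauss y * I, so the slice weight collapses to c / I times three
   Gaussian factors; the indicator is the cut-off of [gauss_pairs]. *)
pose kk (q : R) := c / I * expR (- (norm2 y ^+ 2 + q) / 2) * \1_Q q.
have mkk : measurable_fun setT kk.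
  apply: measurable_funM; last exact: measurable_indic.
  apply: measurable_funM => //; apply: (measurableT_comp (@measurable_expR R)).
  apply: measurable_funM => //; apply: measurableT_comp => //.
  exact: measurable_funD.
have kk0 q : 0 <= kk q.
  by rewrite mulr_ge0// mulr_ge0 ?expR_ge0// ltW// divr_gt0.
have FE z z' : F (y, z, z') = (kk (norm2 z ^+ 2 + norm2 z' ^+ 2) * (phi z' - phi z) ^+ 2)%:E.
  rewrite /F /phi/=; congr (_ * _)%:E; rewrite /kk.
  have -> : \1_(gauss_pairs r) (y, z, z') = \1_Q (norm2 z ^+ 2 + norm2 z' ^+ 2) :> R.
    by rewrite !indicE; congr ((_ : bool)%:R); apply/idP/idP => /set_mem H1; apply/mem_set; move: H1; rewrite /gauss_pairs /Q/= addrA.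
  congr (_ * _); rewrite /slice_weight/= (active_density_gauss _ IE) !rhoE !gauss_slice_pt.
  have -> : expR (- (norm2 y ^+ 2 + (norm2 z ^+ 2 + norm2 z' ^+ 2)) / 2) =
      gauss y * gauss z * gauss z'.
    by rewrite /gauss -!expRD; congr expR; field.
  by field; rewrite !gt_eqF// gauss_gt0.
have U := @gaussian_slice R m phi G kk mphi mG mkk G00 kk0.
have -> : (\int[lebesgue_vec m]_z \int[lebesgue_vec m]_z' F (y, z, z') =
   \int[lebesgue_vec m]_z \int[lebesgue_vec m]_z'
     (kk (norm2 z ^+ 2 + norm2 z' ^+ 2)%R * (phi z' - phi z) ^+ 2)%:E)%E.
  by apply: eq_integral => z _; apply: eq_integral => z' _; exact: FE.
apply: le_trans (U _) _.
  move=> z z' kz.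
  have Sp (t : R) : 0 <= t <= pi / 2 -> S (pt y (cos t *: z + sin t *: z')).
    move=> _; rewrite /S /euclidean_ball/= -ler_sqr ?nnegrE ?norm2_ge0// (norm2_slice_pt oW).
    have Qz : Q (norm2 z ^+ 2 + norm2 z' ^+ 2).
      by apply/not_notP => nQ; move: kz; rewrite /kk indicE memNset// mulr0 ltxx.
    apply: le_trans Qz; rewrite lerD2l -(norm2_rotation t) lerDl.
    exact: sqr_ge0.
  have bnd (t : R) : -1 < t < pi / 2 + 1 ->
      [/\ `|cos t| <= 1, `|sin t| <= 1, `|- sin t| <= 1 & `|cos t| <= 1].
    by move=> _; rewrite normrN; split; rewrite ler_norml ?cos_geN1 ?cos_le1 ?sin_geN1 ?sin_le1.
  have p0 : 0 < pi / 2 :> R by rewrite divr_gt0// pi_gt0.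
  have mcos : measurable_fun (setT : set (measurableTypeR R)) (@cos R).
    exact: continuous_measurable_fun (@continuous_cos R).
  have msin : measurable_fun (setT : set (measurableTypeR R)) (@sin R).
    exact: continuous_measurable_fun (@continuous_sin R).
  have msinN : measurable_fun (setT : set (measurableTypeR R)) (fun t : R => - sin t).
    exact: measurableT_comp.
  have P := @path_sqr_le R n k m W1 W2 S h A cos sin (fun t => - sin t) cos (pi / 2) 1 y z z'
    pd mA p0 (fun t => is_derive_cos t) (fun t => is_derive_sin t) bnd mcos msin msinN mcos Sp.
  by move: P; rewrite cos_pihalf sin_pihalf cos0 sin0 !scale0r !scale1r add0r addr0.
have -> : Cp%:E = (((pi / 2) ^+ 2)%:E * (4 * 2 ^+ m)%:E)%E by rewrite -EFinM.
rewrite -muleA; apply: lee_wpmul2l; first by rewrite lee_fin sqr_ge0.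
have mHy : measurable_fun setT (fun z => H (pt y z)) by exact: (measurableT_comp mH).
rewrite -(ge0_integralZl (lebesgue_vec m) measurableT mHy (fun z _ => H0 _)); last first.
  by rewrite lee_fin mulr_ge0// exprn_ge0.
have mn2 : measurable_fun setT (fun z : 'cV[R]_m => norm2 z ^+ 2).
  by apply: measurable_funX; exact: measurable_norm2.
have mq2 : measurable_fun setT (fun p : 'cV[R]_m * 'cV[R]_m => norm2 p.1 ^+ 2 + norm2 p.2 ^+ 2).
  by apply: measurable_funD; exact: (measurableT_comp mn2).
have mL : measurable_fun setT (fun p : 'cV[R]_m * 'cV[R]_m =>
    (kk (norm2 p.1 ^+ 2 + norm2 p.2 ^+ 2) * (G p.1 * norm2 p.2 ^+ 2))%:E).
  apply/measurable_EFinP; apply: measurable_funM; first exact: (measurableT_comp mkk mq2).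
  by apply: measurable_funM; [exact: (measurableT_comp mG)|exact: (measurableT_comp mn2)].
pose L (p : 'cV[R]_m * 'cV[R]_m) : \bar R :=
  (kk (norm2 p.1 ^+ 2 + norm2 p.2 ^+ 2) * (G p.1 * norm2 p.2 ^+ 2))%:E.
have L0 p : (0 <= L p)%E.
  by rewrite lee_fin mulr_ge0// mulr_ge0// sqr_ge0.
apply: ge0_le_integral => //.
- by move=> z _; apply: integral_ge0 => z' _; exact: (L0 (z, z')).
- apply: (@measurable_fubini_domain _ _ _ _ R (lebesgue_vec m) setT
    (fun p : 'cV[R]_m * 'cV[R]_m => (kk (norm2 p.1 ^+ 2 + norm2 p.2 ^+ 2) * (G p.1 * norm2 p.2 ^+ 2))%:E)) => //.
  exact: measurable_funTS.
- exact: measurable_funeM.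
move=> z _.
have mgn : measurable_fun setT (fun z' : 'cV[R]_m => (gauss z' * norm2 z' ^+ 2)%:E).
  by apply/measurable_EFinP; apply: measurable_funM => //; exact: measurable_gauss.
have gn0 (z' : 'cV[R]_m) : (0 <= (gauss z' * norm2 z' ^+ 2)%:E)%E.
  by rewrite lee_fin mulr_ge0 ?sqr_ge0// ltW// gauss_gt0.
(* The cut-off on the pair is relaxed to the first point lying in [S], which frees the integral over
   [z']. *)
apply: (@le_trans _ _ (\int[lebesgue_vec m]_z' (((I^-1)%:E * H (pt y z)) * (gauss z' * norm2 z' ^+ 2)%:E))%E).
  apply: ge0_le_integral => //.
  - by move=> z' _; exact: (L0 (z, z')).
  - exact: (measurableT_comp mL (pair1_measurable z)).
  - exact: measurable_funeM.
  - move=> z' _; rewrite -!EFinM lee_fin.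
    rewrite (_ : I^-1 * _ * _ = (I^-1 * rho (pt y z) * gauss z' * \1_S (pt y z)) * (G z * norm2 z' ^+ 2)); last first.
      by rewrite /G; ring.
    apply: ler_wpM2r; first by rewrite mulr_ge0// sqr_ge0.
    rewrite /kk rhoE gauss_slice_pt.
    have -> : expR (- (norm2 y ^+ 2 + (norm2 z ^+ 2 + norm2 z' ^+ 2)) / 2) =
        gauss y * gauss z * gauss z'.
      by rewrite /gauss -!expRD; congr expR; field.
    rewrite (_ : I^-1 * _ * _ = c / I * (gauss y * gauss z * gauss z')); last by ring.
    apply: ler_wpM2l.
      by rewrite !mulr_ge0 ?invr_ge0// ltW// gauss_gt0.
    have [Qz|nQz] := pselect (Q (norm2 z ^+ 2 + norm2 z' ^+ 2)); last first.
      by rewrite indicE memNset.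
    rewrite !indicE !mem_set// /S /euclidean_ball/= -ler_sqr ?nnegrE ?norm2_ge0// (norm2_slice_pt oW).
    by apply: le_trans Qz; rewrite lerD2l lerDl sqr_ge0.
rewrite (ge0_integralZl (lebesgue_vec m) measurableT mgn (fun z _ => gn0 z)); last first.
  by rewrite mule_ge0// lee_fin invr_ge0 ltW.
apply: (@le_trans _ _ ((I^-1)%:E * H (pt y z) * ((4 * 2 ^+ m)%:E * gauss_mass m))%E).
  apply: lee_wpmul2l; first by rewrite mule_ge0// lee_fin invr_ge0 ltW.
  exact: gauss_second_moment_le.
rewrite IE /H -!EFinM lee_fin le_eqVlt; apply/orP; left; apply/eqP.
by field; rewrite gt_eqF.
Qed.

(** With radius r = j + 1 and margin 1 / r, |x + v|^2 <= |x|^2 + 2 |x| |v| + |v|^2 <= |x|^2 + 3, so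
    the density ratio is at most exp(3/2) for every [j]. *)
Lemma gaussian_exhausted :
  slice_exhausted W1 W2 rho setT (expR (3 / 2)) ((pi / 2) ^+ 2 * (4 * 2 ^+ m)).
Proof.
exists (fun j => j.+1%:R^-1), (fun j => euclidean_ball j.+1%:R), (fun j => gauss_pairs j.+1%:R).
split.
- by move=> j; rewrite invr_gt0.
- exact: cvg_harmonic.
- move=> j; split => //; first exact: measurable_euclidean_ball.
  move=> x v xj vj; rewrite !rhoE mulrCA ler_wpM2l ?(ltW c0)// /gauss -expRD ler_expR.
  suff : norm2 (x + v) ^+ 2 <= norm2 x ^+ 2 + 3 by lra.
  have xv := norm2D x v.
  apply: (@le_trans _ _ ((norm2 x + norm2 v) ^+ 2)).
    by apply: lerXn2r => //; rewrite nnegrE ?addr_ge0 ?norm2_ge0.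
  rewrite sqrrD -addrA lerD2l.
  have p1 : norm2 x * norm2 v <= 1.
    rewrite -[leRHS](@mulfV _ (j.+1%:R : R)) ?pnatr_eq0//.
    by apply: ler_pM; rewrite ?norm2_ge0.
  have p2 : norm2 v ^+ 2 <= 1.
    rewrite expr_le1 ?norm2_ge0//; apply: le_trans vj _.
    by rewrite invf_le1// ler1n.
  by rewrite -mulr_natr; lra.
- move=> j; split; first exact: measurable_gauss_pairs.
    move=> p Tp; have := sqr_ge0 (norm2 p.1.2); have := sqr_ge0 (norm2 p.2).
    move: Tp; rewrite /gauss_pairs/= => Tp z1 z2.
    by split; rewrite /euclidean_ball/= -ler_sqr ?nnegrE ?norm2_ge0// (norm2_slice_pt oW); lra.
  exact: gaussian_poincare.
- move=> p _.
  pose q := norm2 p.1.1 ^+ 2 + norm2 p.1.2 ^+ 2 + norm2 p.2 ^+ 2.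
  near=> j; rewrite /gauss_pairs/= -/q.
  apply: (@le_trans _ _ j.+1%:R); last by rewrite ler_eXnr// ler1n.
  near: j; exists (Num.truncn q) => // j /= jq.
  apply: ltW; apply: lt_le_trans (truncnS_gt q) _.
  by rewrite ler_nat ltnS.
Unshelve. all: by end_near.
Qed.

End gaussian_case.

Lemma normM_le_sqrD (R : realDomainType) (x y : R) : `|x * y| <= x ^+ 2 + y ^+ 2.
Proof.
rewrite normrM -(real_normK (num_real x)) -(real_normK (num_real y)).
have := sqr_ge0 (`|x| - `|y|); have := normr_ge0 x; have := normr_ge0 y.
set u := `|x|; set v := `|y|; nra.
Qed.

(** * Means of independent samples *)

Section density_law.
Context {R : realType} d {Omega : measurableType d} (P : probability Omega R) (m : nat).
Variables (Z : Omega -> 'cV[R]_m) (q : 'cV[R]_m -> R).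
Hypotheses (mq : measurable_fun setT q) (q0 : forall z, 0 <= q z) (Zq : has_density P Z q).
Local Open Scope ereal_scope.

(* Layer cake: both sides are the integral over [t] of the measures of [phi > t]. *)
Lemma ge0_integral_density (phi : 'cV[R]_m -> R) : measurable_fun setT phi ->
  (forall z, 0 <= phi z)%R ->
  \int[P]_w (phi (Z w))%:E = \int[lebesgue_vec m]_z (phi z * q z)%:E.
Proof.
move=> mphi phi0; have [mZ PZ] := Zq.
pose A : set ('cV[R]_m * measurableTypeR R) := [set p | (0 <= p.2 < phi p.1)%R].
have mA : measurable A.
  have mf : measurable_fun setT (fun p : 'cV[R]_m * measurableTypeR R => (phi p.1 - p.2)%R).
    by apply: measurable_funB => //; exact: (measurableT_comp mphi measurable_fst).
  have -> : A = (setT `&` snd @^-1` `[0%R, +oo[) `&`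
      (setT `&` (fun p : 'cV[R]_m * measurableTypeR R => (phi p.1 - p.2)%R) @^-1` `]0%R, +oo[).
    rewrite !setTI; apply/seteqP; split => p; rewrite /A/= !in_itv/= !andbT subr_gt0.
      by move=> /andP[].
    by move=> [-> ->].
  by apply: measurableI; [exact: measurable_snd|exact: mf].
have phiE z : (phi z)%:E = \int[@lebesgue_measure R]_t (\1_A (z, t))%:E.
  have -> : (fun t => (\1_A (z, t))%:E : \bar R) = (fun t => (\1_(`[0%R, phi z[%classic : set (measurableTypeR R)) t)%:E).
    apply/funext => t; congr EFin; rewrite !indicE; congr ((_ : bool)%:R).
  have mI := @measurable_itv R `[0%R, phi z[.
  have := @integral_indic _ _ R (@lebesgue_measure R) _ measurableT _ mI; rewrite setIT => ->.
  rewrite [RHS]lebesgue_measure_itv/= lte_fin; have := phi0 z; rewrite le_eqVlt => /orP[/eqP <-|z0]; first by rewrite ltxx.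
  by rewrite z0 -EFinD subr0.
have m1A : measurable_fun setT (fun p => (\1_A p)%:E : \bar R).
  by apply/measurable_EFinP; exact: measurable_indic.
have mZt : measurable_fun setT (fun p : Omega * measurableTypeR R => (\1_A (Z p.1, p.2))%:E : \bar R).
  apply: (measurableT_comp m1A); apply/measurable_fun_pair => //.
  exact: (measurableT_comp mZ measurable_fst).
have -> : \int[P]_w (phi (Z w))%:E =
    \int[P]_w \int[@lebesgue_measure R]_t (\1_A (Z w, t))%:E.
  by apply: eq_integral => w _; rewrite phiE.
rewrite (@fubini_tonelli_domains _ _ _ _ R P (@lebesgue_measure R) setT setT
  (fun p => (\1_A (Z p.1, p.2))%:E) measurableT measurableT (measurable_funTS mZt)); last first.
  by move=> p; rewrite lee_fin.
have mqA : measurable_fun setT (fun p : 'cV[R]_m * measurableTypeR R => (\1_A p * q p.1)%:E : \bar R).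
  apply/measurable_EFinP; apply: measurable_funM; first exact: measurable_indic.
  exact: (measurableT_comp mq measurable_fst).
have -> : \int[lebesgue_vec m]_z (phi z * q z)%:E =
    \int[lebesgue_vec m]_z \int[@lebesgue_measure R]_t (\1_A (z, t) * q z)%:E.
  apply: eq_integral => z _; rewrite EFinM phiE muleC -ge0_integralZl//.
  - by apply: eq_integral => t _; rewrite -EFinM mulrC.
  - exact: (measurableT_comp m1A (pair1_measurable z)).
  - by rewrite lee_fin.
rewrite (@fubini_tonelli_domains _ _ _ _ R (lebesgue_vec m) (@lebesgue_measure R) setT setT
  (fun p => (\1_A p * q p.1)%:E) measurableT measurableT (measurable_funTS mqA)); last first.
  by move=> p; rewrite lee_fin mulr_ge0.
apply: eq_integral => t _.
pose At := [set z | A (z, t)].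
have mAt : measurable At.
  by have := measurable_ysection t mA; rewrite /ysection; congr measurable; apply/seteqP; split => z /=; rewrite inE.
have mZAt : measurable (Z @^-1` At) by rewrite -[X in measurable X]setTI; exact: mZ.
have -> : \int[P]_w (\1_A (Z w, t))%:E = P (Z @^-1` At).
  have := integral_indic P measurableT mZAt; rewrite setIT => <-; apply: eq_integral => w _.
  by rewrite !indicE.
rewrite PZ// [LHS]integral_mkcond; apply: eq_integral => z _.
rewrite patchE indicE /At; have [Az|nAz] := pselect (A (z, t)).
  by rewrite !mem_set// mul1r.
by rewrite !memNset// mul0r.
Qed.

Lemma integral_density (phi : 'cV[R]_m -> R) : measurable_fun setT phi ->
  \int[P]_w (phi (Z w))%:E = \int[lebesgue_vec m]_z (phi z * q z)%:E.
Proof.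
move=> mphi; rewrite integralE [RHS]integralE.
have mp : measurable_fun setT (fun z => Num.max (phi z) 0%R) by exact: measurable_maxr.
have mn : measurable_fun setT (fun z => Num.max (- phi z)%R 0%R).
  by apply: measurable_maxr => //; exact: measurableT_comp.
have max0 (x : R) : (0 <= Num.max x 0)%R by rewrite le_max lexx orbT.
congr (_ - _).
  rewrite (_ : (fun w => (phi (Z w))%:E)^\+ = fun w => (Num.max (phi (Z w)) 0%R)%:E).
    rewrite (ge0_integral_density mp) => [|z]; last exact: max0.
    apply: eq_integral => z _; rewrite funeposE maxr_pMl// mul0r.
    by rewrite EFin_max.
  by apply/funext => w; rewrite funeposE -EFin_max.
rewrite (_ : (fun w => (phi (Z w))%:E)^\- = fun w => (Num.max (- phi (Z w))%R 0%R)%:E).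
  rewrite (ge0_integral_density mn) => [|z]; last exact: max0.
  apply: eq_integral => z _; rewrite funenegE maxr_pMl// mul0r mulNr.
  by rewrite EFin_max.
by apply/funext => w; rewrite funenegE -EFinN -EFin_max.
Qed.

Lemma integrable_density (phi : 'cV[R]_m -> R) : measurable_fun setT phi ->
  (lebesgue_vec m).-integrable setT (fun z => (phi z * q z)%:E) ->
  P.-integrable setT (fun w => (phi (Z w))%:E).
Proof.
move=> mphi /integrableP[_ I]; have [mZ _] := Zq; apply/integrableP; split.
  by apply/measurable_EFinP; exact: measurableT_comp.
apply: le_lt_trans I; rewrite le_eqVlt; apply/orP; left; apply/eqP.
have mn : measurable_fun setT (fun z => `|phi z|%R) by exact: measurableT_comp.
transitivity (\int[P]_w (`|phi (Z w)|%R)%:E); first exact: eq_integral.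
rewrite (ge0_integral_density mn) => [|z]; last exact: normr_ge0.
by apply: eq_integral => z _; rewrite abse_EFin normrM (ger0_norm (q0 z)).
Qed.

End density_law.

Section iid_mean.
Context {R : realType} d {Omega : measurableType d} (P : probability Omega R) (m N : nat).
Variables (Z : 'I_N -> Omega -> 'cV[R]_m) (q : 'cV[R]_m -> R).
Hypotheses (mq : measurable_fun setT q) (q0 : forall z, 0 <= q z) (Zq : iid_density P Z q).
Local Open Scope ereal_scope.

Let mZ j : measurable_fun setT (Z j). Proof. by have [+ _] := Zq => /(_ j)[]. Qed.

(** Independence over the index set {i, j} identifies the joint law with the product of the laws on
    rectangles, hence on all measurable sets, and Fubini factorises. The second moments make the
    product integrable. *)
Lemma integral_indep_mul (psi : 'cV[R]_m -> R) (i j : 'I_N) : i != j ->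
  measurable_fun setT psi ->
  \int[P]_w (psi (Z i w) ^+ 2)%:E < +oo -> \int[P]_w (psi (Z j w) ^+ 2)%:E < +oo ->
  P.-integrable setT (fun w => (psi (Z i w))%:E) ->
  P.-integrable setT (fun w => (psi (Z j w))%:E) ->
  \int[P]_w (psi (Z i w) * psi (Z j w))%:E =
  \int[P]_w (psi (Z i w))%:E * \int[P]_w (psi (Z j w))%:E.
Proof.
move=> ij mpsi i2 j2 ii jj.
have mi_mixin := isMeasurableFun.Build _ _ _ _ _ (mZ i).
have mj_mixin := isMeasurableFun.Build _ _ _ _ _ (mZ j).
pose Zi : {RV P >-> 'cV[R]_m} := HB.pack (Z i) mi_mixin.
pose Zj : {RV P >-> 'cV[R]_m} := HB.pack (Z j) mj_mixin.
have mp : measurable_fun setT (fun w => (Z i w, Z j w)) by exact/measurable_fun_pair.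
have mp_mixin := isMeasurableFun.Build _ _ _ _ _ mp.
pose Zp : {RV P >-> ('cV[R]_m * 'cV[R]_m)%type} := HB.pack (fun w => (Z i w, Z j w)) mp_mixin.
pose f (p : 'cV[R]_m * 'cV[R]_m) : \bar R := (psi p.1 * psi p.2)%:E.
have mf : measurable_fun setT f.
  apply/measurable_EFinP; apply: measurable_funM.
    exact: (measurableT_comp mpsi measurable_fst).
  exact: (measurableT_comp mpsi measurable_snd).
have If : P.-integrable setT (f \o Zp).
  apply/integrableP; split; first exact: (measurableT_comp mf mp).
  have m2 l : measurable_fun setT (fun w => (psi (Z l w) ^+ 2)%:E).
    by apply/measurable_EFinP; apply: measurable_funX; exact: measurableT_comp.
  apply: (@le_lt_trans _ _ (\int[P]_w ((psi (Z i w) ^+ 2)%:E + (psi (Z j w) ^+ 2)%:E))).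
    apply: ge0_le_integral => //.
    - apply: measurableT_comp => //; exact: (measurableT_comp mf mp).
    - exact: emeasurable_funD.
    - by move=> w _; rewrite /f/= -EFinD lee_fin normM_le_sqrD.
  rewrite ge0_integralD//; first exact: lte_add_pinfty.
  - by move=> w _; rewrite lee_fin sqr_ge0.
  - by move=> w _; rewrite lee_fin sqr_ge0.
have E1 := integral_distribution mf If.
have prodE : forall C, measurable C ->
    (distribution P Zi \x distribution P Zj) C = distribution P Zp C.
  apply: product_measure_unique => A B mA mB.
  have [_ indep] := Zq.
  have := indep [set i; j]%SET (fun l => if l == i then A else B).
  rewrite big_setU1/=; last by rewrite inE.
  rewrite big_set1 eqxx eq_sym (negbTE ij) => <-; last by move=> l; case: ifP.
  congr (P _); apply/seteqP; split => w /=.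
    by move=> [Aw Bw] l /=; rewrite !inE => /orP[|] /eqP ->; rewrite ?eqxx// eq_sym (negbTE ij).
  move=> H; split.
    by have := H i; rewrite /= !inE eqxx => /(_ isT).
  by have := H j; rewrite /= !inE eqxx orbT eq_sym (negbTE ij) => /(_ isT).
rewrite -[LHS]E1.
rewrite (eq_measure_integral (distribution P Zi \x distribution P Zj)); last first.
  by move=> A mA _; exact: (esym (prodE A mA)).
have If2 : (distribution P Zi \x distribution P Zj).-integrable setT f.
  apply/integrableP; split => //.
  rewrite (eq_measure_integral (distribution P Zp)); last by move=> A mA _; exact: prodE.
  rewrite ge0_integral_distribution//; last exact: measurableT_comp.
  by have /integrableP[_] := If.
rewrite -(integral12_prod_meas1 If2).
have mpe : measurable_fun setT (fun z => (psi z)%:E) by exact/measurable_EFinP.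
have EZi : \int[distribution P Zi]_z (psi z)%:E = \int[P]_w (psi (Z i w))%:E.
  exact: (@integral_distribution _ _ _ _ R P Zi _ mpe ii).
have EZj : \int[distribution P Zj]_z (psi z)%:E = \int[P]_w (psi (Z j w))%:E.
  exact: (@integral_distribution _ _ _ _ R P Zj _ mpe jj).
have iZi : (distribution P Zi).-integrable setT (fun z => (psi z)%:E).
  exact: (@integrable_pushforward _ _ _ _ R Zi).
have iZj : (distribution P Zj).-integrable setT (fun z => (psi z)%:E).
  exact: (@integrable_pushforward _ _ _ _ R Zj).
have fin : \int[P]_w (psi (Z j w))%:E \is a fin_num by exact: integrable_fin_num.
transitivity (\int[distribution P Zi]_a ((fine (\int[P]_w (psi (Z j w))%:E))%:E * (psi a)%:E)).
  apply: eq_integral => a _; rewrite -EZj /fubini_F /f/= fineK ?EZj// -EZj.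
  under eq_integral do rewrite EFinM.
  by rewrite integralZl// muleC.
by rewrite integralZl// fineK// EZi muleC.
Qed.

Variables (F : 'cV[R]_m -> R).
Hypotheses (mF : measurable_fun setT F) (N0 : (0 < N)%N)
  (IF : (lebesgue_vec m).-integrable setT (fun z => (F z * q z)%:E)).
Let g : R := (\int[lebesgue_vec m]_z (F z * q z))%R.

(** The normalisation is read off from the law of the first sample, which exists because [N] is
    positive. *)
Lemma iid_density_mass : \int[lebesgue_vec m]_z (q z)%:E = 1.
Proof.
have [/(_ (Ordinal N0))[_ /(_ setT measurableT)] <- _] := Zq.
by rewrite preimage_setT probability_setT.
Qed.

Let Iq : (lebesgue_vec m).-integrable setT (fun z => (q z)%:E).
Proof.
apply/integrableP; split; first exact/measurable_EFinP.
under eq_integral do rewrite abse_EFin ger0_norm//.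
by rewrite iid_density_mass ltry.
Qed.

Let IFg (c : R) : (lebesgue_vec m).-integrable setT (fun z => ((F z - c) * q z)%:E).
Proof.
rewrite (_ : (fun z => _) = (fun z => (F z * q z)%:E) \- (fun z => c%:E * (q z)%:E)); last first.
  by apply/funext => z; rewrite -EFinM -EFinB mulrBl.
by apply: integrableB => //; exact: integrableZl.
Qed.

Let Rint_sub (c : R) : \int[lebesgue_vec m]_z ((F z - c) * q z)%:E = (g - c)%:E.
Proof.
rewrite (_ : (fun z => _) = (fun z => (F z * q z)%:E) \- (fun z => c%:E * (q z)%:E)); last first.
  by apply/funext => z; rewrite -EFinM -EFinB mulrBl.
rewrite integralB//; last exact: integrableZl.
rewrite integralZl// iid_density_mass mule1 EFinB /g /Rintegral fineK//.
exact: integrable_fin_num.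
Qed.

(** After centring, the cross terms vanish by independence, and the [N] diagonal terms, each equal
    to the variance, are divided by N^2. *)
Lemma iid_mean_sqr_le :
  \int[P]_w ((g - N%:R^-1 * \sum_(j < N) F (Z j w))%R ^+ 2)%:E <=
  (N%:R^-1)%:E * \int[lebesgue_vec m]_z ((F z - g)%R ^+ 2 * q z)%:E.
Proof.
have Nn0 : (N%:R != 0 :> R)%R by rewrite pnatr_eq0 -lt0n.
pose psi z := (F z - g)%R.
have mpsi : measurable_fun setT psi by exact: measurable_funB.
have mpsi2 : measurable_fun setT (fun z => (psi z ^+ 2)%R) by exact: measurable_funX.
set V := \int[lebesgue_vec m]_z _.
have Zqj j : has_density P (Z j) q by have [+ _] := Zq; exact.
have U2 j : \int[P]_w (psi (Z j w) ^+ 2)%:E = V.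
  by rewrite (ge0_integral_density mq q0 (Zqj j) mpsi2) => // z; exact: sqr_ge0.
(* An infinite variance makes the bound trivial; a finite one supplies the second moments for the
   cross terms. *)
have [Voo|] := ltP V +oo; last first.
  by rewrite leye_eq => /eqP ->; rewrite gt0_muley ?leey// lte_fin invr_gt0 ltr0n.
have V0 : 0 <= V by apply: integral_ge0 => z _; rewrite lee_fin mulr_ge0 ?sqr_ge0.
have IU j : P.-integrable setT (fun w => (psi (Z j w))%:E).
  exact: (integrable_density mq q0 (Zqj j) mpsi (IFg g)).
have EU j : \int[P]_w (psi (Z j w))%:E = 0.
  by rewrite (integral_density mq q0 (Zqj j) mpsi) Rint_sub subrr.
have mU j : measurable_fun setT (fun w => psi (Z j w)) by exact: measurableT_comp.
have IUU i j : P.-integrable setT (fun w => (psi (Z i w) * psi (Z j w))%:E).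
  apply/integrableP; split.
    by apply/measurable_EFinP; exact: measurable_funM.
  apply: (@le_lt_trans _ _ (\int[P]_w ((psi (Z i w) ^+ 2)%:E + (psi (Z j w) ^+ 2)%:E))).
    apply: ge0_le_integral => //.
    - apply: measurableT_comp => //; apply/measurable_EFinP; exact: measurable_funM.
    - by apply: emeasurable_funD; apply/measurable_EFinP; exact: measurable_funX.
    - by move=> w _; rewrite abse_EFin -EFinD lee_fin normM_le_sqrD.
  rewrite ge0_integralD//.
  - by rewrite !U2; exact: lte_add_pinfty.
  - by move=> w _; rewrite lee_fin sqr_ge0.
  - by apply/measurable_EFinP; exact: measurable_funX.
  - by move=> w _; rewrite lee_fin sqr_ge0.
  - by apply/measurable_EFinP; exact: measurable_funX.
have EUU i j : \int[P]_w (psi (Z i w) * psi (Z j w))%:E = if i == j then V else 0.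
  have [<-|ij] := eqVneq i j; first by rewrite -(U2 i); apply: eq_integral => w _; rewrite expr2.
  by rewrite integral_indep_mul ?U2// !EU mule0.
have E1 w : (((g - N%:R^-1 * \sum_(j < N) F (Z j w)) ^+ 2)%R)%:E =
    (N%:R^-1 ^+ 2)%:E * \sum_(i < N) \sum_(j < N) (psi (Z i w) * psi (Z j w))%:E.
  rewrite (_ : \sum_(i < N) _ = ((\sum_(i < N) psi (Z i w)) ^+ 2)%:E); last first.
    rewrite expr2 mulr_suml -sumEFin; apply: eq_bigr => i _.
    by rewrite mulr_sumr -sumEFin.
  rewrite -EFinM -exprMn; congr EFin.
  rewrite /psi sumrB sumr_const card_ord -sqrrN; congr (_ ^+ 2)%R.
  by rewrite mulrBr -(mulr_natl g N) mulKf// opprB.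
under eq_integral do rewrite E1.
have IS i : P.-integrable setT (fun w => \sum_(j < N) (psi (Z i w) * psi (Z j w))%:E).
  by apply: (integrable_sum measurableT) => j _; exact: IUU.
rewrite integralZl//; last by apply: (integrable_sum measurableT) => i _; exact: IS.
rewrite integral_sum//.
have -> : \sum_(i < N) \int[P]_w \sum_(j < N) (psi (Z i w) * psi (Z j w))%:E = N%:R%:E * V.
  rewrite (eq_bigr (fun=> V)).
    have Vf : V \is a fin_num by rewrite ge0_fin_numE.
    by rewrite -(fineK Vf) sumEFin sumr_const card_ord -EFinM mulr_natl.
  move=> i _; rewrite integral_sum//.
  rewrite (bigD1 i)//= EUU eqxx big1 ?adde0// => j ji.
  by rewrite EUU eq_sym (negbTE ji).
rewrite muleA -EFinM.
by rewrite expr2 -mulrA mulVf// mulr1.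
Qed.

(** F z - g is the average of F z - F z' over [z'], so Jensen applies. Replacing the mean by a
    second point, at the cost of a factor 2, is what allows paths between two points to be used. *)
Lemma density_variance_le :
  \int[lebesgue_vec m]_z ((F z - g)%R ^+ 2 * q z)%:E <=
  \int[lebesgue_vec m]_z \int[lebesgue_vec m]_z' ((F z' - F z)%R ^+ 2 * (q z * q z'))%:E.
Proof.
have mJ : measurable_fun setT (fun p : 'cV[R]_m * 'cV[R]_m =>
    ((F p.2 - F p.1)%R ^+ 2 * (q p.1 * q p.2))%:E).
  apply/measurable_EFinP; apply: measurable_funM.
    by apply: measurable_funX; apply: measurable_funB; exact: (measurableT_comp mF).
  by apply: measurable_funM; exact: (measurableT_comp mq).
have J0 p : 0 <= ((fun p : 'cV[R]_m * 'cV[R]_m => ((F p.2 - F p.1)%R ^+ 2 * (q p.1 * q p.2))%:E) p).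
  by rewrite lee_fin mulr_ge0 ?sqr_ge0// mulr_ge0.
apply: ge0_le_integral => //.
- by move=> z _; rewrite lee_fin mulr_ge0 ?sqr_ge0.
- apply/measurable_EFinP; apply: measurable_funM => //.
  by apply: measurable_funX; exact: measurable_funB.
- apply: (@measurable_fubini_domain _ _ _ _ R (lebesgue_vec m) setT
    (fun p : 'cV[R]_m * 'cV[R]_m => ((F p.2 - F p.1)%R ^+ 2 * (q p.1 * q p.2))%:E)) => //.
  exact: measurable_funTS.
move=> z _.
have mFz : measurable_fun setT (fun z' => (F z' - F z)%R) by exact: measurable_funB.
have H := @sqr_Rintegral_le _ _ R (lebesgue_vec m) setT (fun z' => (F z' - F z)%R) q 1
  measurableT mFz mq (fun z _ => q0 z) ltr01 iid_density_mass.
move: H; rewrite /Rintegral Rint_sub /= -sqrrN opprB mul1e => H.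
have mFq : measurable_fun setT (fun z' => ((F z' - F z)%R ^+ 2 * q z')%:E).
  by apply/measurable_EFinP; apply: measurable_funM => //; exact: measurable_funX.
have -> : \int[lebesgue_vec m]_z' ((F z' - F z)%R ^+ 2 * (q z * q z'))%:E =
    (q z)%:E * \int[lebesgue_vec m]_z' ((F z' - F z)%R ^+ 2 * q z')%:E.
  rewrite -ge0_integralZl//.
  - by apply: eq_integral => z' _; rewrite -EFinM; congr EFin; ring.
  - by move=> z' _; rewrite lee_fin mulr_ge0 ?sqr_ge0.
  - by rewrite lee_fin.
by rewrite mulrC EFinM; apply: lee_wpmul2l; rewrite ?lee_fin.
Qed.

End iid_mean.

(** * Gradient energy in the inactive directions *)

Section blocks.
Context {R : realType}.

Lemma hblock_orth n k m (km : (k + m)%N = n) (W1 : 'M[R]_(n, k)) (W2 : 'M[R]_(n, m)) :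
  orthogonal_mx (hblock_mx km W1 W2) ->
  [/\ W1^T *m W1 = 1%:M, W2^T *m W1 = 0 & W2^T *m W2 = 1%:M].
Proof.
case: _ / km W1 W2 => W1 W2; rewrite /orthogonal_mx /hblock_mx castmx_id.
rewrite tr_row_mx mul_col_row scalar_mx_block => /eq_block_mx[? _ ? ?].
by split.
Qed.

(** With u = W2^T v one has |W2 u| = |u| and |u|^2 = <W2 u, v>, so Cauchy-Schwarz gives |u| <=
    |v|. *)
Lemma norm2_coisometry n m (W2 : 'M[R]_(n, m)) (v : 'cV[R]_n) :
  W2^T *m W2 = 1%:M -> norm2 (W2^T *m v) <= norm2 v.
Proof.
move=> W22; set u := W2^T *m v.
have nu : norm2 (W2 *m u) ^+ 2 = norm2 u ^+ 2.
  by rewrite !norm2_sqrE trmx_mul -mulmxA (mulmxA W2^T) W22 mul1mx.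
have := dot_sqr_le (W2 *m u) v.
have -> : dot (W2 *m u) v = norm2 u ^+ 2.
  by rewrite -dotxx /u dot_mulmx trmxK.
rewrite nu expr2 => H.
have [u0|u0] := eqVneq (norm2 u) 0; first by rewrite u0 norm2_ge0.
have up : 0 < norm2 u by rewrite lt_neqAle eq_sym u0 norm2_ge0.
by move: H; rewrite ler_pM2l ?exprn_gt0// ler_sqr// ?nnegrE norm2_ge0.
Qed.

(** The supremum dominates its set only if that set is bounded; the sum of the squared row norms
    provides a bound. *)
Lemma norm2_opnorm n (A : 'M[R]_n) x : norm2 x <= 1 -> norm2 (A *m x) <= opnorm A.
Proof.
move=> x1; apply: ub_le_sup; last by exists x.
pose r := \sum_i norm2 (row i A)^T ^+ 2.
have r0 : 0 <= r by apply: sumr_ge0 => i _; exact: sqr_ge0.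
exists (1 + r) => _ [y y1 <-]; rewrite norm2_le ?addr_ge0//.
apply: (@le_trans _ _ r); last by have := r0; nra.
apply: ler_sum => i _.
have -> : (A *m y) i ord0 = dot (row i A)^T y.
  by rewrite mxE; apply: eq_bigr => j _; rewrite !mxE.
apply: le_trans (dot_sqr_le _ _) _; rewrite ler_piMr ?sqr_ge0//.
by rewrite expr_le1// norm2_ge0.
Qed.

Lemma norm2_delta n (j : 'I_n) : norm2 (delta_mx j ord0 : 'cV[R]_n) = 1.
Proof.
rewrite /norm2 (bigD1 j)//= mxE !eqxx expr1n big1 ?addr0 ?sqrtr1// => i ij.
by rewrite mxE (negbTE ij) expr0n.
Qed.

Lemma castmx_delta n k m (km : (k + m)%N = n) (l : 'I_k) (j : 'I_n) : l = j :> nat ->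
  castmx (km, erefl) (col_mx (delta_mx l ord0) (0 : 'cV[R]_m)) = delta_mx j ord0.
Proof.
case: _ / km j => j lj; rewrite castmx_id; apply/matrixP => i i'.
rewrite [i']ord1 (_ : j = lshift m l); last exact/val_inj.
rewrite mxE; case: splitP => p ip; rewrite !mxE.
  by rewrite (_ : i = lshift m p) ?eq_lshift//; exact/val_inj.
by rewrite (_ : i = rshift k p) ?eq_rlshift//; exact/val_inj.
Qed.

End blocks.

Section eigen.
Context {R : realType} (n k m : nat) (km : (k + m)%N = n).
Variables (W1 : 'M[R]_(n, k)) (W2 : 'M[R]_(n, m)) (W : 'M[R]_n) (lambda : 'rV[R]_n) (eps : R).
Hypotheses (oW : orthogonal_mx (hblock_mx km W1 W2)) (oWW : orthogonal_mx W)
  (lam0 : forall i, 0 <= lambda ord0 i) (eps0 : 0 < eps)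
  (close : opnorm (W - hblock_mx km W1 W2) <= eps).

Let head := \sum_(i < n | (i < k)%N) lambda ord0 i.
Let tail := \sum_(i < n | (k <= i)%N) lambda ord0 i.

Lemma eigen_trace :
  \tr (W2^T *m (W *m diag_mx lambda *m W^T) *m W2) =
  \sum_j lambda ord0 j * norm2 (W2^T *m (W *m delta_mx j ord0)) ^+ 2.
Proof.
have -> : W2^T *m (W *m diag_mx lambda *m W^T) *m W2 =
    (W2^T *m W) *m (diag_mx lambda *m (W2^T *m W)^T).
  by rewrite trmx_mul trmxK !mulmxA.
rewrite mxtrace_mulC -mulmxA /mxtrace; apply: eq_bigr => j _.
rewrite mul_diag_mx mxE; congr (_ * _).
rewrite mulmxA norm2_sqr mxE; apply: eq_bigr => i _.
rewrite [X in X * _]mxE -expr2; congr (_ ^+ 2).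
rewrite [RHS]mxE (bigD1 j)//= [delta_mx _ _ _ _]mxE !eqxx mulr1 big1 ?addr0// => l lj.
by rewrite [delta_mx _ _ _ _]mxE (negbTE lj) mulr0.
Qed.

Lemma inactive_energy_le :
  \tr (W2^T *m (W *m diag_mx lambda *m W^T) *m W2) <=
  (eps * Num.sqrt head + Num.sqrt tail) ^+ 2.
Proof.
have [W11 W21 W22] := hblock_orth oW.
have h0 : 0 <= head by apply: sumr_ge0.
have t0 : 0 <= tail by apply: sumr_ge0.
(* The square of the sum exceeds this by the nonnegative cross term only. *)
apply: (@le_trans _ _ (eps ^+ 2 * head + tail)); last first.
  rewrite sqrrD exprMn !sqr_sqrtr// -addrA lerD2l lerDr.
  by rewrite mulrn_wge0// !mulr_ge0 ?sqrtr_ge0// ltW.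
rewrite eigen_trace (bigID (fun j : 'I_n => (j < k)%N))/=; apply: lerD; last first.
  rewrite /tail; under eq_bigl do rewrite -leqNgt.
  apply: ler_sum => j _; rewrite ler_piMr// expr_le1// ?norm2_ge0//.
  apply: le_trans (norm2_coisometry _ W22) _.
  by rewrite norm2_orth// norm2_delta.
rewrite mulr_sumr; apply: ler_sum => j jk; rewrite mulrC; apply: ler_wpM2r => //.
apply: lerXn2r; rewrite ?nnegrE ?norm2_ge0 ?(ltW eps0)//.
have E : W2^T *m (hblock_mx km W1 W2 *m (delta_mx j ord0 : 'cV_n)) = 0.
  by rewrite -(castmx_delta km (l := Ordinal jk))// -hblock_mulE mulmx0 addr0 mulmxA W21 mul0mx.
have -> : W2^T *m (W *m (delta_mx j ord0 : 'cV_n)) =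
    W2^T *m ((W - hblock_mx km W1 W2) *m delta_mx j ord0).
  by rewrite mulmxBl mulmxBr E subr0.
apply: le_trans (norm2_coisometry _ W22) _; apply: le_trans close.
by apply: norm2_opnorm; rewrite norm2_delta.
Qed.

End eigen.

(** * Extension by zero off the support, and the gradient moment matrix *)

Section zero_extension.
Context {R : realType} (n : nat) (rho f : 'cV[R]_n -> R).
Local Notation X := (pos_set rho).
Hypotheses (rho0 : forall x, 0 <= rho x) (mrho : measurable_fun setT rho) (oX : open X)
  (mf : measurable_fun X f) (fp : square_integrable_partials rho f).

(** The given functions are arbitrary off the support. Set to zero there they become measurable on
    the whole space, while near a point of the open support nothing changes, derivatives
    included. *)
Definition zero_ext (g : 'cV[R]_n -> R) : 'cV[R]_n -> R := patch (cst 0) X g.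

Lemma zero_extE g x : X x -> zero_ext g x = g x.
Proof. by move=> Xx; rewrite /zero_ext patchE mem_set. Qed.

Lemma zero_ext0 g x : ~ X x -> zero_ext g x = 0.
Proof. by move=> Xx; rewrite /zero_ext patchE memNset. Qed.

Lemma rho_out x : ~ X x -> rho x = 0.
Proof. by move=> nX; apply/eqP; rewrite eq_le rho0 leNgt andbT; apply/negP. Qed.

Let mX : measurable X. Proof. exact: open_measurable_mx. Qed.

Lemma measurable_zero_ext g : measurable_fun X g -> measurable_fun setT (zero_ext g).
Proof. by move=> mg; apply/(measurable_restrictT _ mX). Qed.

Lemma zero_ext_near g x : X x -> \near x, g x = zero_ext g x.
Proof.
move=> Xx; near=> y; rewrite zero_extE//; near: y; exact: open_nbhs_nbhs.
Unshelve. all: by end_near. Qed.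

Lemma is_derive_zero_ext x i : X x ->
  is_derive x (delta_mx i ord0) (zero_ext f) (zero_ext (partial f i) x).
Proof.
move=> Xx; rewrite zero_extE//; apply: (near_eq_is_derive (zero_ext_near f Xx)).
by apply: DeriveDef => //; have [/(_ x Xx)] := fp i.
Qed.

(** On the support the partial derivative is the pointwise limit of the difference quotients with
    steps 1 / (j + 1), each of them measurable. *)
Lemma measurable_zero_ext_partial i : measurable_fun setT (zero_ext (partial f i)).
Proof.
apply: measurable_zero_ext.
pose e : 'cV[R]_n := delta_mx i ord0.
have mF := measurable_zero_ext mf.
apply: (@measurable_fun_cvg _ _ _ X
  (fun (j : nat) x => j.+1%:R * (zero_ext f (j.+1%:R^-1 *: e + x) - zero_ext f x))).
  move=> j; apply: measurable_funTS; apply: measurable_funM => //; apply: measurable_funB => //.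
  by apply: (measurableT_comp mF); exact: (measurable_addmx (f := cst (j.+1%:R^-1 *: e))).
move=> x Xx; have [ex exE] := is_derive_zero_ext i Xx; rewrite (zero_extE _ Xx) in exE.
(* The steps never vanish, so they tend to 0 in the punctured sense in which the derivative is a
   limit. *)
have cv : (@harmonic R) @ \oo --> (0 : R)^'.
  move=> A A0; have H : \forall j \near \oo, (harmonic j : R) != 0 -> A (harmonic j).
    exact: (@cvg_harmonic R _ A0).
  change (\forall j \near \oo, A (harmonic j)).
  by apply: filterS H => j; apply; rewrite /harmonic/= invr_neq0.
rewrite -exE.
have H : (fun h => h^-1 *: ((zero_ext f \o shift x) (h *: e) - zero_ext f x)) @ 0^' -->
    'D_e (zero_ext f) x by exact: ex.
have := @cvg_comp _ _ _ _ _ _ _ _ cv H; apply: cvg_trans.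
by apply: near_eq_cvg; near=> j; rewrite /= /harmonic invrK.
Unshelve. all: by end_near. Qed.

Lemma partial_energy_fin i :
  (\int[lebesgue_vec n]_x (rho x * zero_ext (partial f i) x ^+ 2)%:E < +oo)%E.
Proof.
have [_ /integrableP[_]] := fp i; apply: le_lt_trans.
rewrite le_eqVlt; apply/orP; left; apply/eqP.
rewrite [RHS]integral_mkcond; apply: eq_integral => x _; rewrite patchE.
have [Xx|nXx] := pselect (X x).
  rewrite (mem_set Xx) zero_extE// abse_EFin ger0_norm; first by rewrite mulrC.
  by rewrite mulr_ge0// sqr_ge0.
by rewrite (memNset nXx) zero_ext0// expr0n mulr0.
Qed.

Lemma integrable_partial_mul i j :
  (lebesgue_vec n).-integrable setT
    (fun x => (rho x * (zero_ext (partial f i) x * zero_ext (partial f j) x))%:E).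
Proof.
have mD l := measurable_zero_ext_partial l.
have m2 l : measurable_fun setT (fun x => (rho x * zero_ext (partial f l) x ^+ 2)%:E).
  by apply/measurable_EFinP; apply: measurable_funM => //; exact: measurable_funX.
have n2 l x : (0 <= (rho x * zero_ext (partial f l) x ^+ 2)%:E)%E.
  by rewrite lee_fin mulr_ge0 ?sqr_ge0.
have mp : measurable_fun setT
    (fun x => (rho x * (zero_ext (partial f i) x * zero_ext (partial f j) x))%:E).
  by apply/measurable_EFinP; apply: measurable_funM => //; exact: measurable_funM.
apply/integrableP; split => //.
apply: (@le_lt_trans _ _ (\int[lebesgue_vec n]_x
  ((rho x * zero_ext (partial f i) x ^+ 2)%:E + (rho x * zero_ext (partial f j) x ^+ 2)%:E))%E).
  apply: ge0_le_integral => //.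
  - by apply: measurableT_comp.
  - exact: (emeasurable_funD (m2 i) (m2 j)).
  - move=> x _; rewrite abse_EFin -EFinD lee_fin normrM (ger0_norm (rho0 x)) -mulrDr ler_wpM2l//.
    exact: normM_le_sqrD.
rewrite (ge0_integralD (lebesgue_vec n) measurableT (fun x _ => n2 i x) (m2 i)
  (fun x _ => n2 j x) (m2 j)).
by apply: lte_add_pinfty; exact: partial_energy_fin.
Qed.

(** The entries of [gradient_moment] are real-valued integrals; integrability of the products of
    partial derivatives shows that none of them is a default value. *)
Lemma gradient_momentE i j : (\int[lebesgue_vec n]_x
    (rho x * (zero_ext (partial f i) x * zero_ext (partial f j) x))%:E)%E =
  (gradient_moment rho f i j)%:E.
Proof.
rewrite mxE /Rintegral.
have <- : (\int[lebesgue_vec n]_x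
    (rho x * (zero_ext (partial f i) x * zero_ext (partial f j) x))%:E)%E =
  (\int[lebesgue_vec n]_(x in X) (partial f i x * partial f j x * rho x)%:E)%E.
  rewrite [RHS]integral_mkcond; apply: eq_integral => x _; rewrite patchE.
  have [Xx|nXx] := pselect (X x).
    by rewrite (mem_set Xx) !zero_extE// mulrC.
  by rewrite (memNset nXx) zero_ext0// mul0r mulr0.
by rewrite fineK//; apply: integrable_fin_num => //; exact: integrable_partial_mul.
Qed.

Lemma gradient_energyE m (W2 : 'M[R]_(n, m)) :
  (\int[lebesgue_vec n]_x
      (rho x * norm2 (W2^T *m (\col_i zero_ext (partial f i) x))%R ^+ 2)%:E)%E =
  (\tr (W2^T *m gradient_moment rho f *m W2))%:E.
Proof.
pose D i x := zero_ext (partial f i) x.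
have colE x l : (W2^T *m (\col_i zero_ext (partial f i) x)) l ord0 = \sum_i W2 i l * D i x.
  by rewrite mxE; apply: eq_bigr => i _; rewrite !mxE.
have E x : (rho x * norm2 (W2^T *m (\col_i zero_ext (partial f i) x))%R ^+ 2)%:E =
    (\sum_l \sum_j \sum_i (W2 i l * W2 j l)%:E * (rho x * (D i x * D j x))%:E)%E.
  rewrite norm2_sqr mulr_sumr -sumEFin; apply: eq_bigr => l _.
  rewrite colE expr2 mulr_suml mulr_sumr -sumEFin; apply: eq_bigr => j _.
  rewrite mulr_sumr mulr_sumr -sumEFin; apply: eq_bigr => i _.
  rewrite -EFinM; congr EFin.
  by move: (D i x) (D j x) (W2 i l) (W2 j l) (rho x) => *; ring.
have I1 l j i : (lebesgue_vec n).-integrable setT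
    (fun x => ((W2 i l * W2 j l)%:E * (rho x * (D i x * D j x))%:E)%E).
  by apply: integrableZl => //; exact: integrable_partial_mul.
have I2 l j : (lebesgue_vec n).-integrable setT
    (fun x => (\sum_i (W2 i l * W2 j l)%:E * (rho x * (D i x * D j x))%:E)%E).
  by apply: (integrable_sum measurableT) => i _.
have I3 l : (lebesgue_vec n).-integrable setT
    (fun x => (\sum_j \sum_i (W2 i l * W2 j l)%:E * (rho x * (D i x * D j x))%:E)%E).
  by apply: (integrable_sum measurableT) => i _.
under eq_integral do rewrite E.
rewrite integral_sum// /mxtrace -sumEFin; apply: eq_bigr => l _.
rewrite integral_sum// mxE -sumEFin; apply: eq_bigr => j _.
rewrite integral_sum// mxE mulr_suml -sumEFin; apply: eq_bigr => i _.
rewrite integralZl//; last exact: integrable_partial_mul.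
by rewrite /D gradient_momentE -EFinM [W2^T _ _]mxE; congr EFin; ring.
Qed.

End zero_extension.

Lemma hblock_mxtr (R : realType) n k m (km : (k + m)%N = n) (W1 : 'M[R]_(n, k))
    (W2 : 'M[R]_(n, m)) :
  hblock_mx km W1 W2 *m (hblock_mx km W1 W2)^T = W1 *m W1^T + W2 *m W2^T.
Proof.
by case: _ / km W1 W2 => W1 W2; rewrite /hblock_mx castmx_id tr_row_mx mul_row_col.
Qed.

Lemma continuous_mulmx (R : realType) n k (A : 'M[R]_(n, k)) :
  continuous (fun y : 'cV[R]_k => A *m y).
Proof.
have -> : (fun y : 'cV[R]_k => A *m y) = fun y => \sum_i y i ord0 *: col i A.
  apply/funext => y; apply/matrixP => i j; rewrite mxE summxE; apply: eq_bigr => l _.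
  by rewrite [j]ord1 !mxE mulrC.
apply: continuous_big => [|i _ y]; first exact: add_continuous.
exact: (cvgZr_tmp (@coord_continuous R k 1 i ord0 y)).
Qed.

(** * Active variables and the sampling error *)

Section active_variables.
Context {R : realType} (n k m : nat) (km : (k + m)%N = n).
Variables (W1 : 'M[R]_(n, k)) (W2 : 'M[R]_(n, m)) (rho f : 'cV[R]_n -> R).
Hypotheses (oW : orthogonal_mx (hblock_mx km W1 W2)).
Local Notation X := (pos_set rho).
Local Notation AD := (active_domain rho W1).
Local Notation pt := (slice_pt W1 W2).
Hypotheses (rho0 : forall x, 0 <= rho x) (mrho : measurable_fun setT rho) (oX : open X)
  (mf : measurable_fun X f).
Local Notation F := (zero_ext rho f).
Local Notation a := (active_density rho W1 W2).

Lemma mul_tr_slice_pt y z : W1^T *m pt y z = y.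
Proof.
have [W11 W21 _] := hblock_orth oW.
have W12 : W1^T *m W2 = 0 by rewrite -[LHS]trmxK trmx_mul trmxK W21 trmx0.
by rewrite /slice_pt mulmxDr !mulmxA W11 W12 mul1mx mul0mx addr0.
Qed.

Lemma slice_pt_tr x : pt (W1^T *m x) (W2^T *m x) = x.
Proof.
have : hblock_mx km W1 W2 *m (hblock_mx km W1 W2)^T = 1%:M by apply: mulmx1C; exact: oW.
rewrite hblock_mxtr => H.
by rewrite -[RHS]mul1mx -H /slice_pt mulmxDl !mulmxA.
Qed.

Lemma active_domainP y : AD y <-> exists z, X (pt y z).
Proof.
split=> [[x Xx <-]|[z Xz]]; first by exists (W2^T *m x); rewrite slice_pt_tr.
by exists (pt y z) => //; rewrite mul_tr_slice_pt.
Qed.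

(** The domain is open: it is the union over [z] of the open sets of those [y] for which [pt y z]
    lies in the support. Openness makes the uncountable union harmless. *)
Lemma measurable_active_domain : measurable AD.
Proof.
apply: open_measurable_mx.
have -> : AD = \bigcup_z [set y | X (pt y z)].
  by apply/seteqP; split => y; [move=> /active_domainP[z Xz]; exists z|move=> [z _ Xz]; apply/active_domainP; exists z].
apply: bigcup_open => z _; apply: open_comp => // y _.
exact: (cvgD (@continuous_mulmx R n k W1 y) (cvg_cst _)).
Qed.

Lemma measurable_cond_density :
  measurable_fun setT (fun p : 'cV[R]_k * 'cV[R]_m => cond_density rho W1 W2 p.1 p.2).
Proof.
apply: measurable_funM.
  by apply: (measurableT_comp mrho); exact: measurable_slice_pt.
rewrite (_ : (fun p => _) = (fun p : 'cV[R]_k * 'cV[R]_m => a p.1 `^ (-1))); last first.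
  by apply/funext => p; rewrite powR_inv1// active_density_ge0.
apply: (measurableT_comp (measurable_powR _)).
exact: (measurableT_comp (measurable_active_density W1 W2 mrho) measurable_fst).
Qed.

(** The conditional density vanishes exactly where the extension may change [f]. *)
Lemma ghat_zero_ext y :
  ghat rho f W1 W2 y = \int[lebesgue_vec m]_z (F (pt y z) * cond_density rho W1 W2 y z).
Proof.
apply: eq_Rintegral => z _; have [Xz|nXz] := pselect (X (pt y z)); first by rewrite zero_extE.
by rewrite /cond_density -/(pt y z) (rho_out rho0 nXz) mul0r !mulr0.
Qed.

Let mF := measurable_zero_ext oX mf.

Lemma measurable_ghat : measurable_fun setT (ghat rho f W1 W2).
Proof.
rewrite (_ : ghat rho f W1 W2 = fun y =>
    \int[lebesgue_vec m]_z (F (pt y z) * cond_density rho W1 W2 y z)); last first.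
  by apply/funext => y; exact: ghat_zero_ext.
apply: (@measurable_Rintegral_fubini _ _ _ _ R (lebesgue_vec m)
  (fun p : 'cV[R]_k * 'cV[R]_m => F (pt p.1 p.2) * cond_density rho W1 W2 p.1 p.2)).
apply: measurable_funM; last exact: measurable_cond_density.
by apply: (measurableT_comp mF); exact: measurable_slice_pt.
Qed.

Lemma measurable_ghat_error d (Omega : measurableType d) N
    (Z : 'I_N -> 'cV[R]_k -> Omega -> 'cV[R]_m) :
  (forall j, measurable_fun (AD `*` setT) (fun p : 'cV[R]_k * Omega => Z j p.1 p.2)) ->
  measurable_fun (AD `*` setT) (fun p : 'cV[R]_k * Omega =>
    (ghat rho f W1 W2 p.1 - ghatN rho f W1 W2 Z p.1 p.2) ^+ 2).
Proof.
move=> mZ.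
apply: measurable_funX; apply: measurable_funB.
  by apply: measurable_funTS; exact: (measurableT_comp measurable_ghat measurable_fst).
apply: measurable_funM => //; apply: measurable_sum => j.
have mD : measurable (AD `*` [set: Omega]) by apply: measurableX => //; exact: measurable_active_domain.
have m1 : measurable_fun (AD `*` [set: Omega]) (fun p : 'cV[R]_k * Omega => W1 *m p.1).
  by apply: measurable_funTS; apply: measurable_mulmx; exact: measurable_fst.
have m2 : measurable_fun (AD `*` [set: Omega]) (fun p : 'cV[R]_k * Omega => W2 *m Z j p.1 p.2).
  exact: (measurableT_comp (measurable_mulmx W2 (@measurable_id _ 'cV[R]_m setT)) (mZ j)).
apply: (measurableT_comp mF); apply/measurable_fun_mxP => // i l.
under eq_fun do rewrite mxE.
exact: (measurable_funD ((measurable_fun_mxP _ mD).1 m1 i l) ((measurable_fun_mxP _ mD).1 m2 i l)).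
Qed.

(** Tonelli in the coordinates (y, z), the error being constant on slices. The last hypothesis
    excludes slices whose infinite mass [active_density] would record as 0. *)
Lemma active_error_eq (e : 'cV[R]_k -> R) : measurable_fun AD e -> (forall y, 0 <= e y) ->
  (forall y, AD y -> (\int[lebesgue_vec m]_z (rho (pt y z))%:E = (a y)%:E)%E) ->
  (\int[lebesgue_vec n]_(x in X) (e (W1^T *m x)%R * rho x)%:E =
   \int[lebesgue_vec k]_(y in AD) (e y * a y)%:E)%E.
Proof.
move=> me e0 aE.
have mAD := measurable_active_domain.
pose E := patch (cst 0) AD e.
have mE : measurable_fun setT E by apply/(measurable_restrictT _ mAD).
have E0 y : 0 <= E y by rewrite /E patchE; case: ifP.
have mG : measurable_fun setT (fun x => (E (W1^T *m x)%R * rho x)%:E).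
  apply/measurable_EFinP; apply: measurable_funM => //.
  by apply: (measurableT_comp mE); exact: measurable_mulmx.
transitivity (\int[lebesgue_vec n]_x (E (W1^T *m x)%R * rho x)%:E)%E.
  rewrite integral_mkcond; apply: eq_integral => x _; rewrite patchE.
  have [Xx|nXx] := pselect (X x).
    rewrite (mem_set Xx) /E patchE mem_set//; by exists x.
  by rewrite (memNset nXx) (rho_out rho0 nXx) mulr0.
rewrite -(ge0_integral_hblock oW mG); last first.
  by move=> x; rewrite lee_fin mulr_ge0.
rewrite [RHS]integral_mkcond; apply: eq_integral => y _.
transitivity (\int[lebesgue_vec m]_z ((E y)%:E * (rho (pt y z))%:E))%E.
  by apply: eq_integral => z _; rewrite -/(pt y z) mul_tr_slice_pt EFinM.
rewrite ge0_integralZl//; last 3 first.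
- by apply/measurable_EFinP; apply: (measurableT_comp mrho); exact: measurable_slice_pt.
- by move=> z _; rewrite lee_fin.
- by rewrite lee_fin.
rewrite patchE /E patchE; have [Ay|nAy] := pselect (AD y).
  by rewrite (mem_set Ay) aE// EFinM.
by rewrite (memNset nAy) mul0e.
Qed.

Section sampling.
Context d {Omega : measurableType d} (P : probability Omega R) (N : nat).
Variable Z : 'I_N -> 'cV[R]_k -> Omega -> 'cV[R]_m.
Hypotheses (N0 : (0 < N)%N)
  (Z_iid : forall y, AD y -> iid_density P (fun j => Z j y) (cond_density rho W1 W2 y))
  (Z_meas : forall j, measurable_fun (AD `*` setT) (fun p : 'cV[R]_k * Omega => Z j p.1 p.2)).

Let mcond y : measurable_fun setT (cond_density rho W1 W2 y).
Proof. exact: (measurableT_comp measurable_cond_density (pair1_measurable y)). Qed.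

Let cond0 y z : 0 <= cond_density rho W1 W2 y z.
Proof. by rewrite divr_ge0// active_density_ge0. Qed.

(* The samples have total mass one, which excludes the junk values of
   [active_density] and [cond_density] on its domain. *)
Lemma active_density_fin y : AD y ->
  a y != 0 /\ (\int[lebesgue_vec m]_z (rho (pt y z))%:E = (a y)%:E)%E.
Proof.
move=> Ay; have M := iid_density_mass (Z_iid Ay) N0.
have a0 : a y != 0.
  apply/eqP => a0; move: M; rewrite integral0_eq; last first.
    by move=> z _; rewrite /cond_density a0 invr0 mulr0.
  by move=> /eqP; rewrite eq_sym onee_eq0.
split => //; move: a0; rewrite /active_density /Rintegral -/(pt y _).
have : (0 <= \int[lebesgue_vec m]_z (rho (pt y z))%:E)%E.
  by apply: integral_ge0 => z _; rewrite lee_fin.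
by rewrite /slice_pt; case: (\int[_]_z _)%E => //=; rewrite eqxx.
Qed.

Hypothesis f_cond : cond_integrable rho f W1 W2.

(** The variance of the sample mean is bounded by the conditional double integral over pairs. Its
    two conditional densities carry the square of [a y] in the denominator; the outer factor [a y]
    cancels one of them and leaves [slice_weight]. *)
Lemma conditional_error_le y : AD y ->
  (\int[P]_w ((ghat rho f W1 W2 y - ghatN rho f W1 W2 Z y w)%R ^+ 2 * a y)%:E <=
   (N%:R^-1)%:E * \int[lebesgue_vec m]_z \int[lebesgue_vec m]_z'
     (slice_weight W1 W2 rho (y, z, z') * (F (pt y z') - F (pt y z))%R ^+ 2)%:E)%E.
Proof.
move=> Ay; have [an0 aE] := active_density_fin Ay.
have a0 : 0 <= a y by exact: active_density_ge0.
have mFy : measurable_fun setT (fun z => F (pt y z)).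
  by apply: (measurableT_comp mF); exact: measurable_slice_pt.
have IF : (lebesgue_vec m).-integrable setT (fun z => (F (pt y z) * cond_density rho W1 W2 y z)%:E).
  apply: eq_integrable (f_cond Ay) => // z _; congr EFin.
  have [Xz|nXz] := pselect (X (pt y z)); first by rewrite zero_extE.
  by rewrite /cond_density -/(pt y z) (rho_out rho0 nXz) mul0r !mulr0.
have H1 := iid_mean_sqr_le (@mcond y) (@cond0 y) (Z_iid Ay) mFy N0 IF.
have H2 := density_variance_le (@mcond y) (@cond0 y) (Z_iid Ay) mFy N0 IF.
rewrite -ghat_zero_ext in H1 H2.
set e := (fun w => (ghat rho f W1 W2 y - ghatN rho f W1 W2 Z y w) ^+ 2).
have me : measurable_fun setT e.
  pose e' (p : 'cV[R]_k * Omega) := (ghat rho f W1 W2 p.1 - ghatN rho f W1 W2 Z p.1 p.2) ^+ 2.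
  have me' := measurable_ghat_error Z_meas.
  have mD : measurable (AD `*` [set: Omega]).
    by apply: measurableX => //; exact: measurable_active_domain.
  have mP : measurable_fun setT (patch (cst 0) (AD `*` [set: Omega]) e').
    exact/(measurable_restrictT _ mD).
  rewrite (_ : e = patch (cst 0) (AD `*` [set: Omega]) e' \o pair y).
    exact: (measurableT_comp mP (pair1_measurable y)).
  by apply/funext => w; rewrite /= patchE mem_set.
have -> : (\int[P]_w (e w * a y)%:E = (a y)%:E * \int[P]_w (e w)%:E)%E.
  rewrite -ge0_integralZl//.
  - by apply: eq_integral => w _; rewrite mulrC EFinM.
  - exact/measurable_EFinP.
  - by move=> w _; rewrite lee_fin sqr_ge0.
apply: (@le_trans _ _ ((a y)%:E * ((N%:R^-1)%:E * \int[lebesgue_vec m]_z \int[lebesgue_vec m]_z'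
    ((F (pt y z') - F (pt y z))%R ^+ 2 *
      (cond_density rho W1 W2 y z * cond_density rho W1 W2 y z'))%:E))%E).
  apply: lee_wpmul2l; first by rewrite lee_fin.
  by apply: (le_trans H1); apply: lee_wpmul2l => //; rewrite lee_fin invr_ge0.
rewrite muleCA; apply: lee_wpmul2l; first by rewrite lee_fin invr_ge0.
pose J (p : 'cV[R]_m * 'cV[R]_m) : \bar R := ((F (pt y p.2) - F (pt y p.1))%R ^+ 2 *
      (cond_density rho W1 W2 y p.1 * cond_density rho W1 W2 y p.2))%:E.
have mJ : measurable_fun setT J.
  apply/measurable_EFinP; apply: measurable_funM.
    by apply: measurable_funX; apply: measurable_funB; exact: (measurableT_comp mFy).
  by apply: measurable_funM; exact: (measurableT_comp (@mcond y)).
have J0 p : (0 <= J p)%E by rewrite lee_fin mulr_ge0 ?sqr_ge0// mulr_ge0.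
have mJ1 : measurable_fun setT (fun z => \int[lebesgue_vec m]_z' J (z, z'))%E.
  apply: (@measurable_fubini_domain _ _ _ _ R (lebesgue_vec m) setT J) => //.
  exact: measurable_funTS.
have J10 z : (0 <= \int[lebesgue_vec m]_z' J (z, z'))%E by apply: integral_ge0.
have ay0 : (0 <= (a y)%:E)%E by rewrite lee_fin.
rewrite -(ge0_integralZl (lebesgue_vec m) measurableT mJ1 (fun z _ => J10 z) ay0).
rewrite le_eqVlt; apply/orP; left; apply/eqP; apply: eq_integral => z _.
have mJz : measurable_fun setT (fun z' => J (z, z')).
  exact: (measurableT_comp mJ (pair1_measurable z)).
rewrite -(ge0_integralZl (lebesgue_vec m) measurableT mJz (fun z' _ => J0 _) ay0).
apply: eq_integral => z' _; rewrite -EFinM /J /slice_weight /cond_density/= -!/(pt y _).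
congr EFin; move: (F _) (F _) (rho _) (rho _) => *; field.
exact: an0.
Qed.

(** Tonelli moves the expectation inside the integral over [y], so the law of the samples is used
    for one fixed [y] at a time; joint measurability of the samples is what permits the exchange. *)
Lemma active_error_le :
  (\int[P]_w \int[lebesgue_vec k]_(y in AD)
    ((ghat rho f W1 W2 y - ghatN rho f W1 W2 Z y w)%R ^+ 2 * a y)%:E <=
   (N%:R^-1)%:E * \int[lebesgue_vec (k + (m + m))]_x (slice_weight W1 W2 rho (tri x) *
      (F (pt (tri x).1.1 (tri x).2) - F (pt (tri x).1.1 (tri x).1.2))%R ^+ 2)%:E)%E.
Proof.
have mAD := measurable_active_domain.
have ma := measurable_active_density W1 W2 mrho.
have me := measurable_ghat_error Z_meas.
pose E (p : 'cV[R]_k * Omega) : \bar R :=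
  ((ghat rho f W1 W2 p.1 - ghatN rho f W1 W2 Z p.1 p.2)%R ^+ 2 * a p.1)%:E.
have mE : measurable_fun (AD `*` setT) E.
  apply/measurable_EFinP; apply: measurable_funM => //.
  by apply: measurable_funTS; exact: (measurableT_comp ma measurable_fst).
have E0 p : (0 <= E p)%E by rewrite lee_fin mulr_ge0 ?sqr_ge0// active_density_ge0.
rewrite -(@fubini_tonelli_domains _ _ _ _ R (lebesgue_vec k) P AD setT E mAD measurableT mE E0).
pose G (p : ('cV[R]_k * 'cV[R]_m) * 'cV[R]_m) : \bar R :=
  (slice_weight W1 W2 rho p * (F (pt p.1.1 p.2) - F (pt p.1.1 p.1.2))%R ^+ 2)%:E.
have mp1 : measurable_fun setT (fun p : ('cV[R]_k * 'cV[R]_m) * 'cV[R]_m => pt p.1.1 p.1.2).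
  apply: measurable_slice_pt; first exact: (measurableT_comp measurable_fst measurable_fst).
  exact: (measurableT_comp measurable_snd measurable_fst).
have mp2 : measurable_fun setT (fun p : ('cV[R]_k * 'cV[R]_m) * 'cV[R]_m => pt p.1.1 p.2).
  apply: measurable_slice_pt; first exact: (measurableT_comp measurable_fst measurable_fst).
  exact: measurable_snd.
have mG : measurable_fun setT G.
  apply/measurable_EFinP; apply: measurable_funM; first exact: measurable_slice_weight.
  by apply: measurable_funX; apply: measurable_funB; exact: (measurableT_comp mF).
have G0 p : (0 <= G p)%E by rewrite lee_fin mulr_ge0 ?sqr_ge0// slice_weight_ge0.
have -> := ge0_integral_tri mG G0.
have mG1 : measurable_fun setT (fun p => \int[lebesgue_vec m]_z' G (p, z'))%E.
  by apply: (@measurable_fubini_domain _ _ _ _ R (lebesgue_vec m) setT G) => //; exact: measurable_funTS.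
have G10 p : (0 <= \int[lebesgue_vec m]_z' G (p, z'))%E by apply: integral_ge0.
have mG2 : measurable_fun setT (fun y => \int[lebesgue_vec m]_z \int[lebesgue_vec m]_z' G ((y, z), z'))%E.
  apply: (@measurable_fubini_domain _ _ _ _ R (lebesgue_vec m) setT
    (fun p => \int[lebesgue_vec m]_z' G (p, z'))%E) => //.
  exact: measurable_funTS.
have G20 y : (0 <= \int[lebesgue_vec m]_z \int[lebesgue_vec m]_z' G ((y, z), z'))%E.
  by apply: integral_ge0.
have N1 : (0 <= (N%:R^-1 : R)%:E)%E by rewrite lee_fin invr_ge0.
rewrite -(ge0_integralZl (lebesgue_vec k) measurableT mG2 (fun y _ => G20 y) N1).
have mD : measurable (AD `*` [set: Omega]) by exact: measurableX.
rewrite [leLHS]integral_mkcond; apply: ge0_le_integral => //.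
- by move=> y _; rewrite patchE; case: ifP => // _; apply: integral_ge0.
- pose E' := patch (cst 0%E) (AD `*` [set: Omega]) E.
  have mE' : measurable_fun setT E' by exact/(measurable_restrictT _ mD).
  rewrite (_ : patch _ _ _ = fun y => \int[P]_w E' (y, w))%E.
    apply: (@measurable_fubini_domain _ _ _ _ R P setT E') => //; first exact: measurable_funTS.
    by move=> p; rewrite /E' patchE; case: ifP.
  apply/funext => y; rewrite patchE; have [Ay|nAy] := pselect (AD y).
    by rewrite (mem_set Ay); apply: eq_integral => w _; rewrite /E' patchE mem_set.
  rewrite (memNset nAy) integral0_eq// => w _; rewrite /E' patchE memNset// => -[].
  by [].
- exact: measurable_funeM.
move=> y _; rewrite patchE; have [Ay|nAy] := pselect (AD y); last first.
  by rewrite (memNset nAy) mule_ge0.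
rewrite (mem_set Ay); exact: conditional_error_le.
Qed.

Lemma active_error_fubini_eq :
  (\int[P]_w \int[lebesgue_vec n]_(x in X)
    ((ghat rho f W1 W2 (W1^T *m x) - ghatN rho f W1 W2 Z (W1^T *m x) w)%R ^+ 2 * rho x)%:E =
   \int[P]_w \int[lebesgue_vec k]_(y in AD)
    ((ghat rho f W1 W2 y - ghatN rho f W1 W2 Z y w)%R ^+ 2 * a y)%:E)%E.
Proof.
have me := measurable_ghat_error Z_meas.
apply: eq_integral => w _.
apply: (active_error_eq (e := fun y => (ghat rho f W1 W2 y - ghatN rho f W1 W2 Z y w) ^+ 2)).
- have mAD := measurable_active_domain.
  apply: (@measurable_comp _ _ _ _ _ _ (AD `*` [set: Omega]) (fun p : 'cV[R]_k * Omega =>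
    (ghat rho f W1 W2 p.1 - ghatN rho f W1 W2 Z p.1 p.2) ^+ 2) AD (fun y => (y, w))) => //.
  + exact: measurableX.
  + by move=> _ [y Ay <-].
  + by apply: measurable_funTS; apply/measurable_fun_pair.
- by move=> y; exact: sqr_ge0.
- by move=> y Ay; have [] := active_density_fin Ay.
Qed.

End sampling.

End active_variables.

(** * The theorem *)

Section exhaustion_constant.
Context {R : realType} (n : nat) (rho : 'cV[R]_n -> R).
Hypotheses (rho_dens : prob_density rho) (oX : open (pos_set rho)).

Let rho0 x : 0 <= rho x. Proof. by have [] := rho_dens. Qed.
Let mrho : measurable_fun setT rho. Proof. by have [] := rho_dens. Qed.
Let rho1 : (\int[lebesgue_vec n]_x (rho x)%:E = 1)%E. Proof. by have [] := rho_dens. Qed.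

(** The order of quantifiers carries the uniformity: [C] precedes the split and the matrices,
    whereas [K] and [Cp] may vary with them since only their product enters the final bound. *)
Definition exhausted_by (C : R) : Prop :=
  forall k m (km : (k + m)%N = n) (W1 : 'M[R]_(n, k)) (W2 : 'M[R]_(n, m)),
  orthogonal_mx (hblock_mx km W1 W2) ->
  exists K Cp : R, [/\ 0 <= K, 0 <= Cp, slice_exhausted W1 W2 rho (pos_set rho) K Cp &
    3 * Cp * K <= C].

Lemma exp2_le_km k m : (k + m)%N = n -> 2 ^+ m <= 2 ^+ n :> R.
Proof. by move=> <-; rewrite ler_eXn2l ?leq_addl// ltr1n. Qed.

Lemma pos_set_nonempty : exists x, pos_set rho x.
Proof.
apply/not_existsP => H; move: rho1; rewrite integral0_eq.
  by move=> /eqP; rewrite eq_sym onee_eq0.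
by move=> x _; rewrite (rho_out rho0)//.
Qed.

Lemma uniform_exhausted_by : uniform_bounded_convex rho ->
  exists2 C, 0 < C & exhausted_by C.
Proof.
move=> [bX cX rhoX].
have [x0 Xx0] := pos_set_nonempty.
set c := (fine _)^-1 in rhoX.
have c0 : 0 < c by rewrite -(rhoX _ Xx0).
have [M [_ /(_ (`|M| + 1))]] := bX.
have Mlt : M < `|M| + 1 by rewrite (le_lt_trans (ler_norm M))// ltrDl.
move=> /(_ Mlt) HM.
pose B := `|M| + 1.
have B0 : 0 <= B by rewrite addr_ge0.
(* Boundedness is in the entrywise norm, so |x|^2 <= n B^2, which (n B + B)^2 dominates. *)
have dX x : pos_set rho x -> norm2 x <= n%:R * B + B.
  move=> Xx; rewrite norm2_le ?addr_ge0 ?mulr_ge0//.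
  apply: (@le_trans _ _ (\sum_(i < n) B ^+ 2)).
    apply: ler_sum => i _; rewrite -(real_normK (num_real (x i ord0))).
    apply: lerXn2r; rewrite ?nnegrE//.
    apply: le_trans (HM x Xx).
    have := mx_normrE x; rewrite /Num.norm/= => ->.
    exact: (@le_bigmax _ _ _ _ (fun ij : 'I_n * 'I_1 => `|x ij.1 ij.2|) (i, ord0)).
  rewrite sumr_const card_ord -mulr_natl.
  have n0 : 0 <= n%:R :> R by [].
  have := mulr_ge0 n0 (sqr_ge0 B); have := mulr_ge0 (sqr_ge0 (n%:R : R)) (sqr_ge0 B).
  have := sqr_ge0 B; nra.
have [r0 r00 Hr] : exists2 r : R, 0 < r & forall v, norm2 v <= r -> pos_set rho (x0 + v).
  have /nbhs_ballP[e /= e0 He] : nbhs x0 (pos_set rho) by exact: open_nbhs_nbhs.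
  exists (e / 2); first by rewrite divr_gt0.
  move=> v ve; apply: He; rewrite -ball_normE /ball_/= opprD addNKr normrN.
  apply: (@le_lt_trans _ _ (e / 2)); last by rewrite ltr_pdivrMr// ltr_pMr// ltr1n.
  apply: le_trans ve.
  have := mx_normrE v; rewrite /Num.norm/= => ->.
  by apply: bigmax_le => [|[i j] _]; rewrite ?norm2_ge0//= [j]ord1 norm2_coord.
pose d0 := n%:R * B + B.
have d00 : 0 <= d0 by rewrite addr_ge0// mulr_ge0.
(* 2^n replaces the 2^m of the slice constant, which removes the dependence on the split; adding 1
   below makes positivity immediate. *)
pose C0 := 3 * (4 * ((2 * d0) ^+ 2 * 2 ^+ n)).
have C00 : 0 <= C0 by rewrite !mulr_ge0// ?exprn_ge0// ?mulr_ge0.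
exists (C0 + 1); first by rewrite ltr_wpDl.
move=> k m km W1 W2 oW; exists 1, (4 * ((2 * d0) ^+ 2 * 2 ^+ m)); split => //.
- by rewrite !mulr_ge0// ?exprn_ge0// ?mulr_ge0.
- apply: (uniform_exhausted oX (convex_setE cX) dX c0 rhoX (rho_out rho0) d00 r00 Hr oW mrho).
- rewrite mulr1 /C0 ler_wpDr// ler_wpM2l// ler_wpM2l// ler_wpM2l ?sqr_ge0//.
  exact: exp2_le_km km.
Qed.

Lemma normal_exhausted_by : standard_normal rho -> exists2 C, 0 < C & exhausted_by C.
Proof.
move=> rhoE.
pose c : R := ((2 * pi) `^ (n%:R / 2))^-1.
have c0 : 0 < c by rewrite invr_gt0 powR_gt0// mulr_gt0// pi_gt0.
have rhoG x : rho x = c * gauss x by rewrite rhoE.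
have XT : pos_set rho = setT.
  by apply/seteqP; split => // x _; rewrite /pos_set/= rhoG mulr_gt0// gauss_gt0.
pose C0 : R := 3 * ((pi / 2) ^+ 2 * (4 * 2 ^+ n)) * expR (3 / 2).
have C00 : 0 <= C0.
  by rewrite mulr_ge0 ?expR_ge0// mulr_ge0// mulr_ge0 ?sqr_ge0// mulr_ge0// exprn_ge0.
exists (C0 + 1); first by rewrite ltr_wpDl.
move=> k m km W1 W2 oW.
exists (expR (3 / 2)), ((pi / 2) ^+ 2 * (4 * 2 ^+ m)); split.
- exact: expR_ge0.
- by rewrite mulr_ge0 ?sqr_ge0// mulr_ge0// exprn_ge0.
- by rewrite XT; exact: gaussian_exhausted c0 rhoG rho1 _ _ _ _ _ oW.
- rewrite /C0 ler_wpDr// ler_wpM2r ?expR_ge0// ler_wpM2l// ler_wpM2l ?sqr_ge0// ler_wpM2l//.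
  exact: exp2_le_km km.
Qed.

End exhaustion_constant.

Theorem theorem4p6 (R : realType) (n : nat) (n_ge2 : (2 <= n)%N)
    (rho : 'cV[R]_n -> R) (rho_adm : admissible_density rho)
    (rho_case : uniform_bounded_convex rho \/ standard_normal rho) :
  exists2 C : R, 0 < C &
  forall (d : measure_display) (Omega : measurableType d)
    (P : probability Omega R)
    (X : Omega -> 'cV[R]_n) (X_rho : has_density P X rho)
    (f : 'cV[R]_n -> R) (f_meas : measurable_fun (pos_set rho) f)
    (f_partials : square_integrable_partials rho f)
    (W : 'M[R]_n) (lambda : 'rV[R]_n) (W_orth : orthogonal_mx W)
    (C_eigen : gradient_moment rho f = W *m diag_mx lambda *m W^T)
    (lambda_ge0 : forall i, 0 <= lambda ord0 i)
    (lambda_noninc : forall i j : 'I_n,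
      (i <= j)%N -> lambda ord0 j <= lambda ord0 i)
    (k m : nat) (k_gt0 : (0 < k)%N) (m_gt0 : (0 < m)%N)
    (km : (k + m)%N = n)
    (W1 : 'M[R]_(n, k)) (W2 : 'M[R]_(n, m))
    (What_orth : orthogonal_mx (hblock_mx km W1 W2))
    (eps : R) (eps_gt0 : 0 < eps)
    (W_close : opnorm (W - hblock_mx km W1 W2) <= eps)
    (f_cond : cond_integrable rho f W1 W2)
    (N : nat) (N_gt0 : (0 < N)%N)
    (Z : 'I_N -> 'cV[R]_k -> Omega -> 'cV[R]_m)
    (Z_iid : forall y, active_domain rho W1 y ->
      iid_density P (fun j => Z j y) (cond_density rho W1 W2 y))
    (Z_meas : forall j, measurable_fun (active_domain rho W1 `*` setT)
      (fun p : 'cV[R]_k * Omega => Z j p.1 p.2)),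
  let g := ghat rho f W1 W2 in
  let gN := ghatN rho f W1 W2 Z in
  let fg x := g (W1^T *m x) in
  let fgN x w := gN (W1^T *m x) w in
  let errX := (\int[P]_w \int[lebesgue_vec n]_(x in pos_set rho)
    ((fg x - fgN x w) ^+ 2 * rho x)%:E)%E in
  let errY := (\int[P]_w \int[lebesgue_vec k]_(y in active_domain rho W1)
    ((g y - gN y w) ^+ 2 * active_density rho W1 W2 y)%:E)%E in
  errX = errY /\
  (errY <= (C / N%:R *
    (eps * Num.sqrt (\sum_(i < n | (i < k)%N) lambda ord0 i)
     + Num.sqrt (\sum_(i < n | (k <= i)%N) lambda ord0 i)) ^+ 2)%:E)%E.
Proof.
have [rho_dens oX _ _ _] := rho_adm; have [rho0 mrho rho1] := rho_dens.
have [C C0 exC] : exists2 C, 0 < C & exhausted_by rho C.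
  by case: rho_case; [exact: uniform_exhausted_by|exact: normal_exhausted_by].
exists C => // d Omega P X X_rho f f_meas f_partials W lambda W_orth C_eigen lambda_ge0 _.
move=> k m _ _ km W1 W2 oW eps eps0 close f_cond N N0 Z Z_iid Z_meas g gN fg fgN errX errY.
split; first exact: (active_error_fubini_eq oW rho0 mrho oX f_meas N0 Z_iid Z_meas).
apply: (le_trans (active_error_le oW rho0 mrho oX f_meas N0 Z_iid Z_meas f_cond)).
have [K [Cp [K0 Cp0 exh CpK]]] := exC _ _ km W1 W2 oW.
have mD i := measurable_zero_ext_partial oX f_meas f_partials i.
have H := slice_energy_le oW mrho rho0 K0 Cp0 exh (measurable_zero_ext oX f_meas) mD
  (fun x i Xx => is_derive_zero_ext oX f_partials i Xx) (partial_energy_fin rho0 f_partials).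
(* The right-hand side becomes a real trace in the eigenvalues, so that only the matrix estimate
   [inactive_energy_le] remains. *)
rewrite (gradient_energyE rho0 mrho oX f_meas f_partials) C_eigen -EFinM in H.
apply: (le_trans (lee_wpmul2l _ H)); first by rewrite lee_fin invr_ge0.
rewrite -EFinM lee_fin [C / _]mulrC -[X in _ <= X]mulrA; apply: ler_wpM2l; first by rewrite invr_ge0.
apply: (@le_trans _ _ (3 * Cp * K * (eps * Num.sqrt (\sum_(i < n | (i < k)%N) lambda ord0 i)
     + Num.sqrt (\sum_(i < n | (k <= i)%N) lambda ord0 i)) ^+ 2)).
  by apply: ler_wpM2l; [rewrite !mulr_ge0|exact: (inactive_energy_le oW)].
by apply: ler_wpM2r; rewrite ?sqr_ge0.
Qed.
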